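(* Let $(a,b,c)$ satisfy the standing conditions and let $\epsilon,\delta>0$ be arbitrary small parameters. There exists $\varepsilon_0=\varepsilon_0(a,b,c,\epsilon,\delta)>0$ such that for $0<\varepsilon<\varepsilon_0$ and every global $H^1\times H^1$ solution $(u,\eta)$ of the $abcd$ system with $\|(u,\eta)(0)\|_{H^1\times H^1}<\varepsilon$ the following hold. (1) If $153b^2-54b+4\le 9ac$, then $$\lim_{t\to\infty}\|(u,\eta)(t)\|_{(H^1\times H^1)(I_{ext}(t))}=0\qquad( * )$$ with $I_{ext}(t)=(-\infty,-(1+\epsilon)t)\cup((1+\delta)t,\infty)$. (2) If $$54\,ac\ \ge\ b\Big(\sqrt{48(6b-1)^2+(21b-2)^2}-(21b-2)\Big),$$ then $( * )$ holds with $I_{ext}(t)=\big(-\infty,-(3\tfrac{\sqrt{ac}}{b}+\epsilon)t\big)\cup\big((3\tfrac{\sqrt{ac}}{b}+\delta)t,\infty\big)$. (3) Suppose $a=c=\frac16-b<0$ and let $\sigma(b)=\dfrac{2(b-\frac16)(b-\frac18)}{b(b-\frac1{12})}>0$. Then $( * )$ holds with $I_{ext}(t)=(-\infty,-(1+\epsilon)t)\cup((1+\delta)t,\infty)$ whenever $\frac16<b\le\frac{1}{12}(3+\sqrt3)$, and with $I_{ext}(t)=(-\infty,-(\sigma(b)+\epsilon)t)\cup((\sigma(b)+\delta)t,\infty)$ whenever $b>\frac1{12}(3+\sqrt3)$.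
   Context: The Hamiltonian $abcd$ system (with $b=d$) is $$(1-b\partial_x^2)\partial_t\eta+\partial_x(a\,\partial_x^2u+u+u\eta)=0,\qquad (1-b\partial_x^2)\partial_tu+\partial_x\big(c\,\partial_x^2\eta+\eta+\tfrac12u^2\big)=0,\qquad (t,x)\in\mathbb R\times\mathbb R,$$ with real-valued $u,\eta$. Standing conditions: $b=d>0$, $a,c<0$, and $a+b=\frac12(\theta^2-\frac13)$, $c+b=\frac12(1-\theta^2)$ for some $\theta\in[0,1]$ (these force $b>\frac16$). $\|(u,\eta)\|_{(H^1\times H^1)(I)}^2=\int_I(u^2+u_x^2+\eta^2+\eta_x^2)\,dx$ (up to equivalent norm). *)

(* Defs.v *)
From HB Require Import structures.
From mathcomp Require Import all_boot all_order all_algebra.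
From mathcomp Require Import all_classical all_reals all_analysis.
Set Implicit Arguments.
Unset Strict Implicit.
Unset Printing Implicit Defensive.
Import Order.TTheory GRing.Theory Num.Theory.
Import numFieldNormedType.Exports.
Local Open Scope classical_set_scope.
Local Open Scope ring_scope.

Local Notation leb R := (@lebesgue_measure R).

Definition test_function (R : realType) (phi : R -> R) : Prop :=
  (forall (n : nat) (x : R), derivable (phi^`(n))%classic x 1) /\
  compact (closure [set x | phi x != 0]).

Definition L2 (R : realType) (f : R -> R) : Prop :=
  (f : measurableTypeR R -> R) \in Lfun (leb R) 2%:E.

Definition is_weak_derivative (R : realType) (f g : R -> R) : Prop :=
  forall phi : R -> R, test_function phi ->
    \int[leb R]_x (f x * (phi^`())%classic x) = - \int[leb R]_x (g x * phi x).

Definition H1 (R : realType) (f : R -> R) : Prop :=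
  L2 f /\ exists2 g : R -> R, L2 g & is_weak_derivative f g.

(* A representative of the weak derivative of f; it is unique almost
   everywhere when f is in H^1, and meaningless otherwise. *)
Definition weak_derivative (R : realType) (f : R -> R) : R -> R :=
  get [set g : R -> R | L2 g /\ is_weak_derivative f g].

Definition H1norm (R : realType) (I : set R) (f g : R -> R) : \bar R :=
  ((\int[leb R]_(x in I)
      ((f x) ^+ 2 + (weak_derivative f x) ^+ 2 +
       (g x) ^+ 2 + (weak_derivative g x) ^+ 2)%:E) `^ 2^-1)%E.

Definition abcd_parameters (R : realType) (a b c : R) : Prop :=
  [/\ 0 < b, a < 0, c < 0 &
    exists theta : R, [/\ 0 <= theta <= 1,
      a + b = 2^-1 * (theta ^+ 2 - 3^-1) &
      c + b = 2^-1 * (1 - theta ^+ 2)]].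

Definition H1_continuous (R : realType) (u eta : R -> R -> R) : Prop :=
  (forall t, H1 (u t) /\ H1 (eta t)) /\
  (forall t0, H1norm setT (u t \- u t0) (eta t \- eta t0) @[t --> t0] --> 0%E).

(* The two equations at each time t, in the sense of distributions in x:
   they are paired with phi and all space derivatives are moved onto phi, so
   that (1 - b dx^2) is carried by phi - b phi''. The first argument of u and
   eta is time. *)
Definition abcd_equations (R : realType) (a b c : R) (u eta : R -> R -> R) :
    Prop :=
  forall (phi : R -> R) (t : R), test_function phi ->
    is_derive t 1
      (fun s => \int[leb R]_x (eta s x * (phi x - b * (phi^`(2))%classic x)) : R)
      (\int[leb R]_x (a * u t x * (phi^`(3))%classic x +
                      (u t x + u t x * eta t x) * (phi^`())%classic x)) /\
    is_derive t 1
      (fun s => \int[leb R]_x (u s x * (phi x - b * (phi^`(2))%classic x)) : R)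
      (\int[leb R]_x (c * eta t x * (phi^`(3))%classic x +
                      (eta t x + 2^-1 * (u t x) ^+ 2) * (phi^`())%classic x)).

Definition global_H1_solution (R : realType) (a b c : R)
    (u eta : R -> R -> R) : Prop :=
  H1_continuous u eta /\ abcd_equations a b c u eta.

Definition Iext (R : realType) (vl vr t : R) : set R :=
  `]-oo, (- (vl * t))[ `|` `](vr * t), +oo[.

Definition exterior_decay (R : realType) (u eta : R -> R -> R) (vl vr : R) :
    Prop :=
  H1norm (Iext vl vr t) (u t) (eta t) @[t --> +oo] --> 0%E.

Definition sigma_speed (R : realType) (b : R) : R :=
  (2 * (b - 6^-1) * (b - 8^-1)) / (b * (b - 12^-1)).

(* Main.v *)
(* Write B = (1 - b dx^2)^-1, f = B u, g = B eta. Up to exact x-derivatives, the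
   energy density (u^2 + eta^2 - a u_x^2 - c eta_x^2) / 2 is a diagonal quadratic
   form in f, ..., f''', g, ..., g''', and the flux of the linear system is
     f g - (2a + 2c + b) f' g' + 3ac f'' g'' + abc f''' g'''.
   The constraints on (a, b, c) make the flux at most the energy, coefficient by
   coefficient, so that linear waves travel at speed at most 1. Integrate the
   energy against a slowly varying weight whose two fronts move inwards with a
   speed sigma > 1: for a small solution the cubic terms and the derivatives of
   the weight are absorbed by the gap sigma - 1, and the weighted energy hardly
   grows. Solutions are only H^1 in space, so this is done for the solution
   mollified at scale s^2; the commutators of the mollification with the
   products are O(s^2), against derivatives of size 1/s, and vanish as s -> 0.
   With fronts at infinity the estimate propagates smallness to all times; with
   fronts starting at distance (v - sigma) T it bounds the energy outside speed
   v at time T by a tail of the initial energy. Hence all admissible parameters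
   give decay outside the speeds 1 + epsilon and 1 + delta. The hypothesis of
   (2) forces 3 sqrt(ac) / b >= 1, and sigma(b) >= 1 in the second case of (3),
   so that everything follows from this. *)
Require Import Defs.
From mathcomp Require Import all_boot all_order all_algebra.
From mathcomp Require Import all_classical all_reals all_analysis measurable_realfun.
From mathcomp Require Import poly ring lra.
Import Order.TTheory GRing.Theory Num.Theory.
Import numFieldNormedType.Exports.
Local Open Scope classical_set_scope.
Local Open Scope ring_scope.

Set Implicit Arguments.
Unset Strict Implicit.
Unset Printing Implicit Defensive.

(** * Differentiation and integration on the line *)

Section Calculus.
Context {R : realType}.
Notation mu := (@lebesgue_measure R).
Implicit Types (f g F G : R -> R) (D : set R).

(** The obstacle is that the flux is nonlocal: [u_t] and [eta_t] are x-derivatives of [B] applied to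
    nonlinear expressions, so flux and energy cannot be compared pointwise in [u] and [eta]. With
    [f], [g] and the nonlinear potentials [n = B (u eta)], [m = B (u^2 / 2)] as unknowns, everything
    is a polynomial in finitely many derivatives. The estimate then reduces to one inequality
    between real numbers, [energy_pointwise], and to the vanishing of the integral of an
    exponentially decaying derivative. The potentials [n], [m] are controlled in the same pointwise
    way, without kernel estimates: adding the exact derivative of [tau * n * n'] to the identity
    turns a weighted bound on [n - b n''] into one on [n] and [n']. The exponents of [s] come from
    Hölder continuity of order 1/2: a function of H^1 oscillates by O(s) over a distance [s^2], so
    the commutator with a product, a product of two oscillations, is O(s^2). The derivative of a
    mollified H^1 function is bounded by the square root of the height [s^-2] of the kernel. *)

Lemma integrable_dominated D f g : measurable D -> measurable_fun D f ->
  mu.-integrable D (EFin \o g) -> (forall x, D x -> `|f x| <= g x) ->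
  mu.-integrable D (EFin \o f).
Proof.
move=> mD mf ig fg; apply: le_integrable ig => //.
- exact/measurable_EFinP.
- by move=> x Dx /=; rewrite lee_fin (le_trans (fg x Dx))// ler_norm.
Qed.

Lemma derivable_measurable f f' : (forall x : R, is_derive x 1 f (f' x)) ->
  measurable_fun setT f.
Proof.
move=> df; apply: continuous_measurable_fun => x.
by apply: differentiable_continuous; apply/derivable1_diffP; case: (df x).
Qed.

Lemma derivable_continuous f f' : (forall x : R, is_derive x 1 f (f' x)) ->
  continuous f.
Proof.
move=> df x; apply: differentiable_continuous; apply/derivable1_diffP.
by case: (df x).
Qed.

(** The majorant is asked only near [t0]: the bounds available later, on H^1 norms and on weights,
    are locally uniform in time. *)
Lemma is_derive_integral D (f df : R -> R -> R) (t0 r : R) g :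
  measurable D -> 0 < r ->
  (forall t, `|t - t0| < r -> mu.-integrable D (EFin \o f t)) ->
  (forall t y, `|t - t0| < r -> D y -> is_derive t 1 (f ^~ y) (df t y)) ->
  mu.-integrable D (EFin \o g) ->
  (forall t y, `|t - t0| < r -> D y -> `|df t y| <= g y) ->
  is_derive t0 1 (fun t => \int[mu]_(y in D) f t y) (\int[mu]_(y in D) df t0 y).
Proof.
move=> mD r0 intf derf intg dfg.
pose G (y : R) : R := `|g y|.
have intG : mu.-integrable D (EFin \o G).
  exact: (integrable_norm intg).
have near_t t : `]t0 - r, t0 + r[%classic t -> `|t - t0| < r.
  by rewrite /= in_itv/= distrC ltr_distlC.
have I0 : `]t0 - r, t0 + r[%classic t0.
  by rewrite /= in_itv/= ltrBlDr ltrDl r0.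
have derf1 t y : `]t0 - r, t0 + r[%classic t -> D y -> derivable (f ^~ y) t 1.
  by move=> /near_t tr Dy; case: (derf t y tr Dy).
have Gub t y : `]t0 - r, t0 + r[%classic t -> D y -> `|partial1of2 f t y| <= G y.
  move=> /near_t tr Dy; rewrite partial1of2E.
  by case: (derf t y tr Dy) => _ ->; rewrite (le_trans (dfg t y tr Dy))// ler_norm.
have cv := @cvg_differentiation_under_integral R _ _ mu f D mD t0 _ _ I0
  (fun t It => intf t (near_t t It)) derf1 G (fun y => normr_ge0 _) intG Gub.
have -> : \int[mu]_(y in D) df t0 y = \int[mu]_(y in D) partial1of2 f t0 y.
  apply: eq_Rintegral => y /set_mem Dy; rewrite partial1of2E.
  by case: (derf t0 y (near_t _ I0) Dy) => _ ->.
apply: DeriveDef.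
  apply/cvg_ex; eexists; move: cv.
  rewrite [X in X @ _ --> _ -> _](_ : _ = (fun h => h^-1 *:
    (\int[mu]_(y in D) f (h *: 1 + t0) y - \int[mu]_(y in D) f t0 y))); last first.
    by apply/funext => h; rewrite [h *: 1]mulr1.
  exact.
rewrite -derive1E /derive1; apply: cvg_lim => //.
Qed.


Lemma cvg_Rintegral_exhaust D (A : nat -> set R) f : measurable D ->
  (forall n, measurable (A n)) -> (forall n, A n `<=` D) ->
  (forall x, D x -> \forall n \near \oo, A n x) ->
  mu.-integrable D (EFin \o f) ->
  (\int[mu]_(x in A n) f x) @[n --> \oo] --> \int[mu]_(x in D) f x.
Proof.
move=> mD mA AD ADx intf.
have mf : measurable_fun D f.
  by apply/measurable_EFinP; exact: (measurable_int mu).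
have -> : (fun n => \int[mu]_(x in A n) f x) =
    (fun n => \int[mu]_(x in D) (f \_ (A n)) x).
  apply/funext => n; rewrite -Rintegral_mkcondr; congr Rintegral.
  by apply/esym/setIidr.
have mfA n : measurable_fun D (f \_ (A n)).
  apply/(measurable_restrict _ (mA n) mD).
  by apply: measurable_funS mf => // x [].
have cv : forall x, D x -> (EFin \o (f \_ (A n))) x @[n --> \oo] --> (EFin \o f) x.
  move=> x Dx; apply: cvg_near_cst; apply: filterS (ADx x Dx) => n Anx.
  by rewrite /= patchE mem_set.
have [] := @dominated_convergence _ _ _ mu D mD
  (fun n => EFin \o (f \_ (A n))) (EFin \o f) (EFin \o (fun x => `|f x|)).
- by move=> n; exact: ((measurable_EFinP _ _).2 (mfA n)).
- exact: ((measurable_EFinP _ _).2 mf).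
- exact: aeW.
- exact: (integrable_norm intf).
- apply: aeW => x n Dx /=; rewrite lee_fin patchE; case: ifP => _ //.
  by rewrite normr0.
move=> _ _ cvI; apply: fine_cvg; rewrite fineK; first exact: cvI.
exact: integrable_fin_num.
Qed.

Lemma Rintegral_FTC2 f F a b : a <= b -> (forall x : R, is_derive x 1 F (f x)) ->
  continuous f -> \int[mu]_(x in `[a, b]) f x = F b - F a.
Proof.
rewrite le_eqVlt => /predU1P[<- _ _|ab dF cf].
  by rewrite set_itv1 Rintegral_set1 subrr.
have cF := derivable_continuous dF.
rewrite /Rintegral (@continuous_FTC2 _ f F a b)//.
- exact: continuous_subspaceT.
- split.
  + by move=> x _; case: (dF x).
  + by apply: cvg_at_right_filter; exact: cF.
  + by apply: cvg_at_left_filter; exact: cF.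
- by move=> x _; rewrite derive1E; case: (dF x).
Qed.

Lemma integrable_expRN_ge0 k : 0 < k ->
  mu.-integrable `[0, +oo[ (EFin \o (fun x : R => expR (- (k * x)))).
Proof.
move=> k0.
have dG (x : R) : is_derive x 1 (fun x => expR (- (k * x))) (- (k * expR (- (k * x)))).
  apply: is_derive_eq; rewrite /GRing.scale/= !(mulr1,mulr0,addr0,scaler0,add0r); ring.
have cG : continuous (fun x => expR (- (k * x))) by exact: derivable_continuous dG.
have dF (x : R) : is_derive x 1 (fun x => - k^-1 * expR (- (k * x))) (expR (- (k * x))).
  apply: is_derive_eq; rewrite /GRing.scale/=.
  by field; rewrite gt_eqF.
have cF : continuous (fun x => - k^-1 * expR (- (k * x))) by exact: derivable_continuous dF.
apply/integrableP; split.
  by apply/measurable_EFinP; apply: measurable_funTS; exact: continuous_measurable_fun.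
under eq_integral do rewrite /= ger0_norm ?expR_ge0//.
rewrite (@ge0_continuous_FTC2y _ _ (fun x => - k^-1 * expR (- (k * x))) 0 0)//.
- by rewrite ltry.
- exact: continuous_subspaceT.
- rewrite -[X in _ --> X](mulr0 (- k^-1)); apply: cvgM; first exact: cvg_cst.
  apply: (@cvg_comp _ _ _ (fun x : R => k * x) (fun y => expR (- y)) _ (pinfty_nbhs R)).
    apply: gt0_cvgMry => //; exact: cvg_id.
  exact: cvgr_expR.
- by apply: cvg_at_right_filter; exact: cF.
- by move=> x _; rewrite derive1E; case: (dF x).
Qed.

Lemma integrable_expRN_abs k : 0 < k ->
  mu.-integrable setT (EFin \o (fun x : R => expR (- (k * `|x|)))).
Proof.
move=> k0.
have cG : continuous (fun x : R => expR (- (k * `|x|))).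
  move=> x; apply: continuous_comp; last exact: continuous_expR.
  apply: cvgN; apply: cvgM; first exact: cvg_cst.
  exact: norm_continuous.
apply/integrableP; split.
  by apply/measurable_EFinP; exact: continuous_measurable_fun.
under eq_integral do rewrite /= ger0_norm ?expR_ge0//.
rewrite ge0_symfun_integralT//; last first.
  by move=> x /=; rewrite normrN.
rewrite lte_mul_pinfty//.
have -> : [set x : R | (0 <= x)%R] = `[0, +oo[%classic.
  by apply/seteqP; split => x /=; rewrite in_itv/= andbT.
have /integrableP[_] := integrable_expRN_ge0 k0; apply: le_lt_trans.
rewrite le_eqVlt; apply/orP; left; apply/eqP; apply: eq_integral => x.
by rewrite inE/= in_itv/= andbT => x0; rewrite ger0_norm ?expR_ge0// ger0_norm.
Qed.

Lemma cvg_expRN k : 0 < k -> expR (- (k * n%:R)) @[n --> \oo] --> (0 : R).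
Proof.
move=> k0; apply: (@cvg_comp _ _ _ (fun n : nat => n%:R : R)
  (fun x => expR (- (k * x))) _ (pinfty_nbhs R)); first exact: cvgr_idn.
apply: (@cvg_comp _ _ _ (fun x : R => k * x) (fun y => expR (- y)) _ (pinfty_nbhs R)).
  by apply: gt0_cvgMry => //; exact: cvg_id.
exact: cvgr_expR.
Qed.

(** This removes the exact derivatives from the energy identity: integrate over [[-n, n]] and let
    the boundary terms decay. *)
Lemma Rintegral_derive_eq0 (k K : R) f F : 0 < k ->
  (forall x : R, is_derive x 1 F (f x)) -> continuous f ->
  (forall x, `|F x| <= K * expR (- (k * `|x|))) ->
  (forall x, `|f x| <= K * expR (- (k * `|x|))) ->
  \int[mu]_x f x = 0.
Proof.
move=> k0 dF cf FK fK.
have intf : mu.-integrable setT (EFin \o f).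
  apply: (integrable_dominated measurableT _ _ (fun x _ => fK x)).
    exact: continuous_measurable_fun.
  apply: (@eq_integrable _ _ _ mu _ measurableT (fun x => K%:E * (expR (- (k * `|x|)))%:E)%E).
    by move=> x _; rewrite -EFinM.
  by apply: integrableZl => //; exact: integrable_expRN_abs.
have cv1 : (\int[mu]_(x in `[- n%:R, n%:R]) f x) @[n --> \oo] --> \int[mu]_x f x.
  apply: (cvg_Rintegral_exhaust measurableT) => // x _.
  near=> n; rewrite /= in_itv/= -ler_norml.
  by near: n; exact: nbhs_infty_ger.
apply: (cvg_unique _ cv1) => //.
have -> : (fun n : nat => \int[mu]_(x in `[- n%:R, n%:R]) f x) =
   (fun n : nat => F n%:R - F (- n%:R)).
  by apply/funext => n; rewrite (@Rintegral_FTC2 _ F)// -subr_ge0 opprK addr_ge0.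
apply/cvgr0Pnorm_le => e e0.
have : (2 * K) * expR (- (k * n%:R)) @[n --> \oo] --> 2 * K * 0.
  by apply: cvgM; [exact: cvg_cst|exact: cvg_expRN].
rewrite mulr0 => /cvgr0Pnorm_le/(_ e e0); apply: filterS => n Hn.
rewrite (le_trans _ Hn)// (le_trans _ (ler_norm _))//.
rewrite (le_trans (ler_normB _ _))//.
have := FK n%:R; have := FK (- n%:R); rewrite normrN !normr_nat; lra.
Unshelve. all: by end_near. Qed.

(** The version with a boundary term, which inverts the resolvent and gives the Sobolev inequality.
    In both uses an exponential factor inside [F] makes merely bounded functions admissible. *)
Lemma Rintegral_derive_itvy (k K a : R) f F : 0 < k ->
  (forall x : R, is_derive x 1 F (f x)) -> continuous f ->
  (forall x, a <= x -> `|F x| <= K * expR (- (k * (x - a)))) ->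
  mu.-integrable `[a, +oo[ (EFin \o f) ->
  \int[mu]_(x in `[a, +oo[) f x = - F a.
Proof.
move=> k0 dF cf FK intf.
have cv1 : (\int[mu]_(x in `[a, a + n%:R]) f x) @[n --> \oo] -->
    \int[mu]_(x in `[a, +oo[) f x.
  apply: (cvg_Rintegral_exhaust _ _ _ _ intf) => //.
    by move=> n x /=; rewrite !in_itv/= => /andP[->].
  move=> x /=; rewrite in_itv/= andbT => ax.
  near=> n; rewrite /= in_itv/= ax/= -lerBlDl.
  by near: n; exact: nbhs_infty_ger.
apply: (cvg_unique _ cv1) => //.
have -> : (fun n : nat => \int[mu]_(x in `[a, a + n%:R]) f x) =
   (fun n : nat => F (a + n%:R) - F a).
  by apply/funext => n; rewrite (@Rintegral_FTC2 _ F)// lerDl.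
suff cv2 : F (a + n%:R) @[n --> \oo] --> (0 : R).
  by have := cvgB cv2 (cvg_cst (F a)); rewrite sub0r; exact.
apply/cvgr0Pnorm_le => e e0.
have : K * expR (- (k * n%:R)) @[n --> \oo] --> K * 0.
  by apply: cvgM; [exact: cvg_cst|exact: cvg_expRN].
rewrite mulr0 => /cvgr0Pnorm_le/(_ e e0); apply: filterS => n Hn.
rewrite (le_trans _ Hn)// (le_trans _ (ler_norm _))//.
by rewrite (le_trans (FK _ _)) ?lerDl// addrAC subrr add0r.
Unshelve. all: by end_near. Qed.

End Calculus.

(** * Mollifiers *)

Section Bump.
Context {R : realType}.
Notation mu := (@lebesgue_measure R).
Implicit Types (p q : {poly R}) (t x y : R).

(** The flat functions [p(1/t) exp(-1/t)]. The polynomial is a parameter so that the class is stable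
    under differentiation, which yields all derivatives at once. *)
Definition flat p t : R := if 0 < t then p.[t^-1] * expR (- t^-1) else 0.

(** By the chain rule the derivative of [p(1/t) exp(-1/t)] is [t^-2 (p - p')(1/t) exp(-1/t)]. *)
Definition dflat p : {poly R} := 'X^2 * (p - p^`()).

Lemma horner_expR_bound q :
  exists2 C : R, 0 <= C & forall s, 0 <= s -> `|q.[s]| <= C * expR s.
Proof.
exists (\sum_(i < size q) `|q`_i| * (i`!)%:R).
  by apply: sumr_ge0 => i _; rewrite mulr_ge0.
move=> s s0; rewrite horner_coef (le_trans (ler_norm_sum _ _ _))// mulr_suml.
apply: ler_sum => i _; rewrite normrM -mulrA ler_wpM2l// normrX ger0_norm//.
case: (nat_of_ord i) => [|n].
  by rewrite expr0 fact0 mul1r -expR0 ler_expR.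
have := expR_ge1Dxn n s0; have f0 : (0 : R) < (n.+1)`!%:R by rewrite ltr0n fact_gt0.
move=> H; rewrite -ler_pdivrMl// mulrC; apply: le_trans H; by rewrite lerDr.
Qed.

Lemma is_derive_flat p t : is_derive t 1 (flat p) (flat (dflat p) t).
Proof.
have [t0|t0|->] := ltgtP t 0.
- rewrite {2}/flat ltNge (ltW t0)/=.
  apply: (@near_eq_is_derive _ _ _ (cst 0)) => //.
    near=> z; rewrite /flat ltNge ifF//; apply/negbF/ltW; near: z.
    exact: lt_nbhsl.
- rewrite {2}/flat t0 /dflat hornerM hornerXn hornerD hornerN.
  apply: (@near_eq_is_derive R R R (fun z : R => (p.[z^-1] * expR (- z^-1) : R))) => //.
    by near=> z; rewrite /flat ifT//; near: z; exact: lt_nbhsr.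
  have t00 : t != 0 by rewrite gt_eqF.
  have dV : is_derive t 1 (fun z : R => z^-1) (- t ^- 2).
    apply: DeriveDef; first exact: (@derivableV _ _ id).
    by rewrite (@deriveV _ _ id)// derive_id /GRing.scale/= mulr1.
  have dp : is_derive t 1 (fun z => p.[z^-1]) (p^`().[t^-1] * (- t ^- 2)).
    exact: (@is_derive1_comp _ (horner p) (fun z : R => z^-1)).
  apply: is_derive_eq; rewrite /GRing.scale/=.
  by field.
- rewrite {2}/flat ltxx.
  (* At 0 the derivative is 0 because [flat p h = O(h^2)]: bound [p * 'X^2] at [1/h] by a multiple
     of [exp(1/h)]. *)
  have [C C0 HC] := horner_expR_bound (p * 'X^2).
  have bnd h : `|flat p h| <= C * h ^+ 2.
    rewrite /flat; case: ifPn => h0; last by rewrite normr0 mulr_ge0// sqr_ge0.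
    have hV : 0 <= h^-1 by rewrite invr_ge0 ltW.
    have := HC _ hV; rewrite hornerM hornerXn !normrM.
    rewrite (ger0_norm hV) (ger0_norm (expR_ge0 _)) -expr2 => H.
    rewrite expRN ler_pdivrMr ?expR_gt0//.
    have -> : `|p.[h^-1]| = (`|p.[h^-1]| * h^-1 ^+ 2) * h ^+ 2.
      by field; rewrite gt_eqF.
    by rewrite (mulrAC C) ler_wpM2r// sqr_ge0.
  have cv : h^-1 *: (flat p (h *: 1 + 0) - flat p 0) @[h --> 0^'] --> (0 : R).
    apply/cvgrPdist_le => e e0; near=> h.
    have h0 : h != 0 by near: h; exact: nbhs_dnbhs_neq.
    rewrite sub0r normrN addr0 [h *: 1]mulr1 {2}/flat ltxx subr0 /GRing.scale/= normrM normfV.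
    rewrite ler_pdivrMl ?normr_gt0// (le_trans (bnd h))// -normr_id -real_normK ?num_real//.
    rewrite normr_id expr2 mulrA mulrC ler_wpM2l//.
    have : `|h| <= e / (C + 1).
      near: h; apply: dnbhs0_le; rewrite divr_gt0//; lra.
    rewrite ler_pdivlMr; last lra.
    apply: le_trans; rewrite mulrDr mulr1 mulrC lerDl//.
  apply: DeriveDef; first by apply/cvg_ex; exists 0.
  exact: cvg_lim.
Unshelve. all: by end_near. Qed.

(** A class containing [bump h] and closed under differentiation; membership gives the derivability
    at every order that [test_function] asks for. *)
Inductive bumps (h : R) : (R -> R) -> Prop :=
| bump_base p q : bumps h (fun x => flat p (1 + h^-1 * x) * flat q (1 - h^-1 * x))
| bump_add f g : bumps h f -> bumps h g -> bumps h (f \+ g).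

Lemma bumps_derive h f : bumps h f ->
  exists2 f', bumps h f' & forall x : R, is_derive x 1 f (f' x).
Proof.
elim=> [p q|f1 f2 _ [g1 b1 d1] _ [g2 b2 d2]].
  exists ((fun x => flat (h^-1 *: dflat p) (1 + h^-1 * x) * flat q (1 - h^-1 * x)) \+
          (fun x => flat p (1 + h^-1 * x) * flat (- h^-1 *: dflat q) (1 - h^-1 * x))).
    by apply: bump_add; exact: bump_base.
  have flatZ a r t : flat (a *: r) t = a * flat r t.
    by rewrite /flat; case: ifP => _; rewrite ?mulr0// hornerZ mulrA.
  move=> x /=; rewrite !flatZ.
  have e1 : is_derive x 1 (fun x : R => 1 + h^-1 * x) h^-1.
    by apply: is_derive_eq; rewrite /GRing.scale/=; ring.
  have e2 : is_derive x 1 (fun x : R => 1 - h^-1 * x) (- h^-1).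
    by apply: is_derive_eq; rewrite /GRing.scale/=; ring.
  have k1 := @is_derive1_comp _ (flat p) (fun x : R => 1 + h^-1 * x) x _ _ (is_derive_flat p (1 + h^-1 * x)) e1.
  have k2 := @is_derive1_comp _ (flat q) (fun x : R => 1 - h^-1 * x) x _ _ (is_derive_flat q (1 - h^-1 * x)) e2.
  apply: (is_derive_eq (is_deriveM k1 k2)).
  rewrite /GRing.scale/=; ring.
by exists (g1 \+ g2); [exact: bump_add|move=> x; exact: is_deriveD].
Qed.

Lemma bumps_derive1n h f n : bumps h f -> bumps h (f^`(n))%classic.
Proof.
move=> bf; elim: n => [//|n /bumps_derive[g bg dg]]; rewrite derive1nS.
by have -> : ((f^`(n))%classic^`())%classic = g;
  [apply/funext => x; rewrite derive1E; case: (dg x)|].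
Qed.

Definition bump (h : R) x := flat 1 (1 + h^-1 * x) * flat 1 (1 - h^-1 * x).

Lemma bump_eq0 h x : 0 < h -> h <= `|x| -> bump h x = 0.
Proof.
move=> h0 hx; rewrite /bump /flat.
have hV : 0 < h^-1 by rewrite invr_gt0.
have : 1 <= h^-1 * `|x| by rewrite -[leLHS](mulVf (lt0r_neq0 h0)) ler_pM2l.
case: (lerP 0 x) => x0; first rewrite ger0_norm//.
  by move=> H; rewrite [X in _ * (if X then _ else _)]ltNge subr_le0 H/= mulr0.
rewrite ltr0_norm// mulrN => H.
by rewrite ltNge -lerBrDl sub0r lerNr H/= mul0r.
Qed.

Lemma test_bump h : 0 < h -> test_function (bump h).
Proof.
move=> h0; split.
  move=> n x; have /bumps_derive[g _ dg] := bumps_derive1n n (bump_base h 1 1).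
  by case: (dg x).
apply: (@subclosed_compact _ _ `[- h, h]); first exact: closed_closure.
  exact: segment_compact.
apply: (@subset_trans _ (closure `[- h, h]%classic)); last first.
  by rewrite -(closure_id _).1//; exact: itv_closed.
apply: closure_subset => x /= bx; rewrite in_itv/= -ler_norml leNgt.
by apply: contra_neqN bx => /ltW; exact: bump_eq0.
Qed.

Lemma flat1_ge0 t : 0 <= flat 1 t.
Proof. by rewrite /flat; case: ifP => // _; rewrite hornerC mul1r expR_ge0. Qed.

Lemma flat1_le1 t : flat 1 t <= 1.
Proof.
rewrite /flat; case: ifP => // t0; rewrite hornerC mul1r -expR0 ler_expR.
by rewrite oppr_le0 invr_ge0 ltW.
Qed.

Lemma bump_ge0 h x : 0 <= bump h x.
Proof. by rewrite mulr_ge0// flat1_ge0. Qed.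

Lemma bump_le1 h x : bump h x <= 1.
Proof. by rewrite mulr_ile1// ?flat1_ge0// flat1_le1. Qed.

Lemma bumpN h x : bump h (- x) = bump h x.
Proof. by rewrite /bump mulrC !mulrN opprK. Qed.

(** On the middle half both arguments [1 + x/h] and [1 - x/h] are at least 1/2, where [flat 1] is at
    least [expR (- 2)]. *)
Lemma bump_ge h x : 0 < h -> `|x| <= h / 2 -> expR (- 4) <= bump h x.
Proof.
move=> h0; rewrite ler_norml => /andP[x1 x2].
have y1 : h^-1 * x <= 2^-1 by rewrite ler_pdivrMl// mulrC.
have y2 : - 2^-1 <= h^-1 * x by rewrite ler_pdivlMl// mulrN.
have aux t : 2^-1 <= t -> expR (- 2) <= flat 1 t.
  move=> t2; have t0 : 0 < t by rewrite (lt_le_trans _ t2)// invr_gt0.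
  rewrite /flat t0 hornerC mul1r ler_expR lerN2 -[leRHS]invrK lef_pV2// posrE//.
have -> : - 4 = - 2 + - 2 :> R by ring.
rewrite expRD ler_pM// ?expR_ge0//; apply: aux; lra.
Qed.

Lemma bump_continuous h : continuous (bump h).
Proof. by have [g _ dg] := bumps_derive (bump_base h 1 1); exact: derivable_continuous dg. Qed.


(* The graph of [bump h] sits above height [expR (- 4)] on an interval of
   length [h], so normalising it costs a factor [expR 4 / h] only. *)
Lemma mollifier_exists h : 0 < h -> exists rho : R -> R,
  [/\ test_function rho, forall x, 0 <= rho x <= expR 4 / h,
    forall x, h <= `|x| -> rho x = 0, forall x, rho (- x) = rho x &
    (\int[mu]_x (rho x)%:E)%E = 1%E].
Proof.
move=> h0.
have mb : measurable_fun setT (bump h).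
  by apply: continuous_measurable_fun; exact: bump_continuous.
have intle (D : set R) : measurable D ->
    (\int[mu]_(x in D) (bump h x)%:E <= \int[mu]_x (bump h x)%:E)%E.
  move=> mD; apply: ge0_subset_integral => //; first exact/measurable_EFinP.
  by move=> x _; rewrite lee_fin bump_ge0.
have c_ge : ((expR (- 4) * h)%:E <= \int[mu]_x (bump h x)%:E)%E.
  apply: (le_trans _ (intle `[- (h / 2), h / 2]%classic (measurable_itv _))).
  have -> : (expR (- 4) * h)%:E =
    (\int[mu]_(x in `[(- (h / 2))%R, (h / 2)%R]) (expR (- 4))%:E)%E.
    rewrite integral_cst//= lebesgue_measure_itv/= lte_fin.
    have -> : - (h / 2) < h / 2 by lra.
    rewrite -EFinD -EFinM; congr (_ * _)%:E; lra.
  apply: ge0_le_integral => //.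
  - by apply/measurable_EFinP; exact: measurable_funTS.
  - by move=> x /=; rewrite in_itv/= -ler_norml => hx; rewrite lee_fin bump_ge.
have c_lt : (\int[mu]_x (bump h x)%:E < +oo)%E.
  apply: (@le_lt_trans _ _ (\int[mu]_(x in `[(- h)%R, h]) 1%:E)%E).
    rewrite [leRHS]integral_mkcond; apply: ge0_le_integral => //.
    - by move=> x _; rewrite lee_fin bump_ge0.
    - exact/measurable_EFinP.
    - by apply/(measurable_restrictT _ _).1.
    - move=> x _; rewrite patchE; case: ifPn => [_|]; first by rewrite lee_fin bump_le1.
      rewrite notin_setE/= in_itv/= -ler_norml => /negP; rewrite -ltNge => /ltW hx.
      by rewrite bump_eq0.
  by rewrite integral_cst//= mul1e lebesgue_measure_itv/=; case: ifP => // _; rewrite -EFinD ltry.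
pose c := fine (\int[mu]_x (bump h x)%:E).
have cE : (\int[mu]_x (bump h x)%:E)%E = c%:E.
  by rewrite fineK// ge0_fin_numE// integral_ge0// => x _; rewrite lee_fin bump_ge0.
have c0 : expR (- 4) * h <= c by rewrite -lee_fin -cE.
have cp : 0 < c by rewrite (lt_le_trans _ c0)// mulr_gt0// expR_gt0.
exists (fun x => c^-1 * bump h x).
have dn n : ((fun x => c^-1 * bump h x)^`(n))%classic =
    (fun x => c^-1 * (bump h)^`(n)%classic x).
  elim: n => [//|n IH]; rewrite !derive1nS IH; apply/funext => x.
  have [+ _] := test_bump h0 => /(_ n x) dx.
  by rewrite !derive1E deriveZ.
split.
- have [db cb] := test_bump h0; split.
    by move=> n x; rewrite dn; apply: derivableZ; exact: db.
  rewrite (_ : [set x | c^-1 * bump h x != 0] = [set x | bump h x != 0])//.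
  by apply/eq_set => x; rewrite mulf_eq0 invr_eq0 (gt_eqF cp).
- move=> x; rewrite mulr_ge0 ?bump_ge0 ?invr_ge0 ?(ltW cp)//=.
  rewrite -[leRHS]mulr1 ler_pM ?bump_ge0 ?bump_le1 ?invr_ge0 ?(ltW cp)//.
  rewrite -[expR 4]invrK -expRN -invfM lef_pV2// posrE//.
  by rewrite mulr_gt0// expR_gt0.
- by move=> x hx; rewrite bump_eq0// mulr0.
- by move=> x; rewrite bumpN.
- under eq_integral do rewrite EFinM.
  rewrite ge0_integralZl//.
  + by rewrite cE -EFinM mulVf// gt_eqF.
  + exact/measurable_EFinP.
  + by move=> x _; rewrite lee_fin bump_ge0.
  + by rewrite lee_fin invr_ge0 ltW.
Qed.

End Bump.

(** * Calculus of test functions *)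

Section TestFunctions.
Context {R : realType}.
Notation mu := (@lebesgue_measure R).
Implicit Types (f g phi rho : R -> R).

Lemma is_derive_derive1n phi n (x : R) : test_function phi ->
  is_derive x 1 (phi^`(n))%classic ((phi^`(n.+1))%classic x).
Proof.
by move=> [dphi _]; apply: DeriveDef; [exact: dphi|rewrite derive1nS derive1E].
Qed.

(** Here [M] may be negative, which is why later arguments sometimes pass to the absolute value of
    [M]. *)
Lemma compact_supportP phi : compact (closure [set x | phi x != 0]) <->
  exists M : R, forall x, M < `|x| -> phi x = 0.
Proof.
split=> [/compact_bounded[M [_ HM]]|[M HM]].
  exists (M + 1) => x Mx; apply/eqP/negPn/negP => phix.
  have := HM (M + 1) _ x (@subset_closure _ [set x | phi x != 0] _ phix).
  by rewrite ltrDl ltr01 => /(_ isT) /=; rewrite leNgt Mx.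
apply: (@subclosed_compact _ _ `[- M, M]); first exact: closed_closure.
  exact: segment_compact.
apply: (@subset_trans _ (closure `[- M, M]%classic)); last first.
  by rewrite -(closure_id _).1//; exact: itv_closed.
apply: closure_subset => x /= bx; rewrite in_itv/= -ler_norml leNgt.
by apply: contra_neqN bx; exact: HM.
Qed.

Lemma test_function_derive1n phi n : test_function phi ->
  test_function (phi^`(n))%classic.
Proof.
move=> tphi; split.
  move=> k x; have -> : ((phi^`(n))^`(k) = phi^`(k + n))%classic.
    by rewrite /derive1n iterD.
  by case: tphi.
apply/compact_supportP; have [_ /compact_supportP[M HM]] := tphi.
exists M; elim: n => [//|n IH] x Mx; rewrite derive1nS derive1E.
rewrite (@near_eq_derive _ _ _ _ (cst 0)) ?derive_cst//.
near=> y; apply: IH; near: y.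
have : `|y| @[y --> x] --> `|x| by exact: norm_continuous.
by move=> /cvgrPdist_lt => /(_ (`|x| - M)); rewrite subr_gt0 => /(_ Mx);
  apply: filterS => y; have := ler_norm (`|x| - `|y|); lra.
Unshelve. all: by end_near. Qed.

Lemma test_function_bounded phi : test_function phi ->
  exists2 C : R, 0 <= C & forall x, `|phi x| <= C.
Proof.
move=> tphi; have [_ /compact_supportP[M HM]] := tphi.
have cphi : continuous phi := derivable_continuous (fun x => is_derive_derive1n 0 x tphi).
have M0 : - `|M| <= `|M| by rewrite ge0_cp.
have [|c _ Hc] := @EVT_max _ (fun x => `|phi x|) _ _ M0.
  by apply: continuous_subspaceT => x; apply: cvg_norm; exact: cphi.
exists `|phi c| => // x.
have [xM|xM] := lerP `|x| `|M|; first by apply: Hc; rewrite in_itv/= -ler_norml.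
by rewrite HM ?normr0// (le_lt_trans (ler_norm _)).
Qed.

(** The equations and weak derivatives will be tested against reflected kernels [rho (x - y)]; each
    derivative in [y] costs a sign. *)
Lemma derive1n_reflect phi (x : R) n : test_function phi ->
  ((fun y => phi (x - y))^`(n))%classic =
  (fun y => (- 1) ^+ n * (phi^`(n))%classic (x - y)).
Proof.
move=> tphi; elim: n => [|n IH]; first by apply/funext => y; rewrite expr0 mul1r.
rewrite derive1nS IH; apply/funext => y; rewrite derive1E.
have d1 : is_derive y 1 (fun y : R => x - y) (- 1).
  by apply: is_derive_eq; rewrite /GRing.scale/=; ring.
have d2 := @is_derive1_comp _ _ (fun y : R => x - y) y _ _
  (is_derive_derive1n n (x - y) tphi) d1.
have [_] := @is_deriveZ _ _ _ _ ((-1) ^+ n) _ _ _ d2.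
by rewrite /GRing.scale/= => ->; rewrite exprS; ring.
Qed.

Lemma test_function_reflect phi (x : R) : test_function phi ->
  test_function (fun y => phi (x - y)).
Proof.
move=> tphi; split.
  move=> n y; rewrite (derive1n_reflect x n tphi).
  have d1 : is_derive y 1 (fun y : R => x - y) (- 1).
    by apply: is_derive_eq; rewrite /GRing.scale/=; ring.
  have d2 := @is_derive1_comp _ _ (fun y : R => x - y) y _ _
    (is_derive_derive1n n (x - y) tphi) d1.
  by have [] := @is_deriveZ _ _ _ _ ((-1) ^+ n) _ _ _ d2.
apply/compact_supportP; have [_ /compact_supportP[M HM]] := tphi.
exists (M + `|x|) => y My; apply: HM; rewrite -ltrBrDr in My.
by rewrite (lt_le_trans My)// distrC lerB_dist.
Qed.

Lemma integral_translate (G : R -> R) (x : R) : continuous G ->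
  (forall y, 0 <= G y) -> (\int[mu]_y (G (y - x))%:E = \int[mu]_y (G y)%:E)%E.
Proof.
move=> cG G0.
have dF (y : R) : is_derive y 1 (fun y : R => y - x) 1.
  by apply: is_derive_eq; rewrite oppr0 addr0.
have F1 : ((fun y : R => y - x)^`())%classic = cst 1.
  by apply/funext => y; rewrite derive1E; case: (dF y).
rewrite [RHS](@increasing_ge0_integration_by_substitutionT _ (fun y => y - x))//.
- by apply: eq_integral => y _ /=; rewrite fctE F1 mulr1.
- by move=> y z yz; rewrite ltrD2r.
- by rewrite F1; move=> z; exact: cst_continuous.
- by rewrite F1; exact: is_cvg_cst.
- by rewrite F1; exact: is_cvg_cst.
- apply/cvgrNyPle => A; near=> y; rewrite lerBlDr; near: y.
  exact: nbhs_ninfty_le (num_real _).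
- apply/cvgryPge => A; near=> y; rewrite lerBrDr; near: y.
  exact: nbhs_pinfty_ge (num_real _).
Unshelve. all: by end_near. Qed.

End TestFunctions.

(** * Convolution with a test function *)

Section Mollification.
Context {R : realType}.
Notation mu := (@lebesgue_measure R).
Implicit Types (f g u v phi rho : R -> R) (k n : nat).

Lemma L2_measurable u : L2 u -> measurable_fun setT u.
Proof. by rewrite /L2 inE => /andP[/=]; rewrite inE. Qed.

Lemma L2_integrable_sqr u : L2 u ->
  mu.-integrable setT (EFin \o (fun x => u x ^+ 2)).
Proof. exact: Lfun2_integrable_sqr. Qed.

Lemma L2_integrable_mul u v : L2 u -> L2 v ->
  mu.-integrable setT (EFin \o (fun x => u x * v x)).
Proof. by move=> u2 v2; apply/Lfun1_integrable; exact: Lfun2_mul_Lfun1. Qed.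

Lemma L2D u v : L2 u -> L2 v -> L2 (u \+ v).
Proof. exact: (proj2 (@Lfun_addr_closed _ _ _ mu 2%:E (lee1n 2))). Qed.

Lemma L2N u : L2 u -> L2 (\- u).
Proof. exact: (@Lfun_oppr_closed _ _ _ mu 2%:E u). Qed.

Definition locint u := measurable_fun setT u /\
  forall a b : R, mu.-integrable `[a, b] (EFin \o u).

Lemma integrable_locint u : mu.-integrable setT (EFin \o u) -> locint u.
Proof.
move=> iu; split; first by apply/measurable_EFinP; exact: (measurable_int mu).
by move=> a b; apply: integrableS iu.
Qed.

Lemma integrable_cst_itv (a b c : R) :
  mu.-integrable `[a, b] (EFin \o (cst c : R -> R)).
Proof.
apply: continuous_compact_integrable; first exact: segment_compact.
by apply: continuous_subspaceT => x; exact: cst_continuous.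
Qed.

Lemma L2_locint u : L2 u -> locint u.
Proof.
move=> u2; have mu2 := L2_measurable u2; split => // a b.
apply: (@integrable_dominated _ _ _ (fun x => 1 + u x ^+ 2)) => //.
- exact: measurable_funTS.
- have := @integrableD _ _ _ mu `[a, b] (measurable_itv _)
    (EFin \o (cst 1 : R -> R)) (EFin \o (fun x => u x ^+ 2))
    (@integrable_cst_itv a b 1).
  by apply; apply: integrableS (L2_integrable_sqr u2).
- move=> x _; rewrite ler_norml; apply/andP; split; nra.
Qed.

(** The convolution of [u] with the [k]-th derivative of [rho]. With the order as an argument,
    [moll rho u] is the sequence of successive derivatives of one smooth function. *)
Definition moll rho u k (x : R) : R :=
  \int[mu]_y (u y * (rho^`(k))%classic (x - y)).

(** The majorant does not depend on [x] in [[a, b]], as differentiation under the integral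
    requires. *)
Lemma moll_dominated phi (M C a b : R) u :
  (forall x, M < `|x| -> phi x = 0) -> (forall x, `|phi x| <= C) ->
  locint u ->
  mu.-integrable setT
    (EFin \o (((fun y => C * `|u y|) : R -> R) \_ `[a - M, b + M])) /\
  (forall x y, a <= x <= b -> `|u y * phi (x - y)| <=
      (((fun y => C * `|u y|) : R -> R) \_ `[a - M, b + M]) y).
Proof.
move=> phiM phiC [mu_ iu]; split.
  rewrite -restrict_EFin; apply/integrable_restrict => //; rewrite setTI.
  have := @integrableZl _ _ _ mu `[a - M, b + M] (measurable_itv _) C
    (EFin \o (fun y => `|u y|)) (integrable_norm (iu _ _)).
  by [].
move=> x y /andP[ax xb]; rewrite patchE; case: ifPn => [_|].
  by rewrite normrM mulrC ler_wpM2r.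
rewrite notin_setE/= in_itv/= => H; rewrite phiM ?mulr0 ?normr0//.
rewrite ltNge; apply/negP; rewrite ler_norml => /andP[h1 h2].
by apply: H; apply/andP; split; lra.
Qed.

Lemma measurable_reflect f (x : R) : measurable_fun setT f ->
  measurable_fun setT (fun y : R => f (x - y)).
Proof.
move=> mf; apply: measurableT_comp => //.
apply: continuous_measurable_fun => y; apply: cvgB; first exact: cvg_cst.
exact: cvg_id.
Qed.

Lemma test_measurable phi n : test_function phi ->
  measurable_fun setT (phi^`(n))%classic.
Proof. by move=> t; exact: derivable_measurable (fun x => is_derive_derive1n n x t). Qed.

Lemma moll_integrable rho u k (x : R) : test_function rho -> locint u ->
  mu.-integrable setT (EFin \o (fun y => u y * (rho^`(k))%classic (x - y))).
Proof.
move=> trho lu; have tk := test_function_derive1n k trho.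
have [C C0 HC] := test_function_bounded tk.
have [_ /compact_supportP[M HM]] := tk.
have [i1 i2] := moll_dominated x x HM HC lu.
apply: (integrable_dominated measurableT _ i1); last first.
  by move=> y _; apply: i2; rewrite lexx.
apply: measurable_funM; first by case: lu.
by apply: measurable_reflect; exact: test_measurable.
Qed.

Lemma is_derive_moll rho u k (x : R) : test_function rho -> locint u ->
  is_derive x 1 (moll rho u k) (moll rho u k.+1 x).
Proof.
move=> trho lu; have tk := test_function_derive1n k.+1 trho.
have [C C0 HC] := test_function_bounded tk.
have [_ /compact_supportP[M HM]] := tk.
have [i1 i2] := moll_dominated (x - 1) (x + 1) HM HC lu.
apply: (@is_derive_integral _ setT (fun z y => u y * (rho^`(k))%classic (z - y))
  (fun z y => u y * (rho^`(k.+1))%classic (z - y)) x 1 _ measurableT ltr01 _ _ i1).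
- by move=> z _; exact: moll_integrable.
- move=> z y _ _.
  have d1 : is_derive z 1 (fun z : R => z - y) 1.
    by apply: is_derive_eq; rewrite /GRing.scale/=; ring.
  have d2 := @is_derive1_comp _ _ (fun z : R => z - y) z _ _
    (is_derive_derive1n k (z - y) trho) d1.
  have := @is_deriveZ _ _ _ _ (u y) _ _ _ d2.
  by rewrite /GRing.scale/= mulr1.
- move=> z y; rewrite ltr_distl => /andP[zx1 zx2] _.
  by apply: i2; rewrite (ltW zx1) (ltW zx2).
Qed.

(** The sign from reflecting the kernel cancels the sign in the definition of the weak
    derivative. *)
Lemma moll_weak rho u u' k (x : R) : test_function rho ->
  locint u -> is_weak_derivative u u' -> moll rho u k.+1 x = moll rho u' k x.
Proof.
move=> trho lu wu; have tk := test_function_derive1n k trho.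
have := wu _ (test_function_reflect x tk).
have -> : ((fun y => (rho^`(k))%classic (x - y))^`())%classic =
  (fun y => - (rho^`(k.+1))%classic (x - y)).
  have := derive1n_reflect x 1 tk; rewrite derive1n1 expr1 => ->.
  by apply/funext => y; rewrite mulN1r derive1n1 -derive1nS.
rewrite /moll => H; rewrite -[RHS]opprK -H.
rewrite -[LHS]opprK; congr (- _).
rewrite -mulN1r -RintegralZl//; last exact: moll_integrable.
by apply: eq_Rintegral => y _; rewrite mulrN mulN1r.
Qed.

Lemma moll_bound_L1 rho k : test_function rho ->
  exists2 C : R, 0 <= C & forall u x, mu.-integrable setT (EFin \o u) ->
    `|moll rho u k x| <= C * \int[mu]_y `|u y|.
Proof.
move=> trho; have tk := test_function_derive1n k trho.
have [C C0 HC] := test_function_bounded tk.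
exists C => // u x iu.
have lu := integrable_locint iu.
have iN := integrable_norm iu.
rewrite (le_trans (le_normr_Rintegral _ (moll_integrable k x trho lu)))//.
rewrite -RintegralZl//; apply: le_Rintegral => //.
- exact: (integrable_norm (moll_integrable k x trho lu)).
- exact: (integrableZl measurableT C iN).
- by move=> y _; rewrite normrM mulrC ler_wpM2r.
Qed.

(** From [2 |u| <= 1 + u^2] on the support of the kernel. Only finiteness, locally uniform in time,
    is wanted, so the bound is not homogeneous in [u]. *)
Lemma moll_bound_L2 rho k : test_function rho ->
  exists2 C : R, 0 <= C & forall u x, L2 u ->
    `|moll rho u k x| <= C * (1 + \int[mu]_y (u y ^+ 2)).
Proof.
move=> trho; have tk := test_function_derive1n k trho.
have [C C0 HC] := test_function_bounded tk.
have [_ /compact_supportP[M HM]] := tk.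
exists (C * (`|M| *+ 2 + 1)); first by rewrite mulr_ge0// addr_ge0// mulrn_wge0.
move=> u x u2.
have lu := L2_locint u2.
have i2 := L2_integrable_sqr u2.
rewrite (le_trans (le_normr_Rintegral _ (moll_integrable k x trho lu)))//.
pose I : set R := `[x - `|M|, x + `|M|]%classic.
have mI : measurable I by exact: measurable_itv.
have i1 : mu.-integrable setT (EFin \o ((cst 1 : R -> R) \_ I)).
  rewrite -restrict_EFin; apply/integrable_restrict => //; rewrite setTI.
  exact: (@integrable_cst_itv _ _ 1).
have E1 : \int[mu]_y ((cst 1 : R -> R) \_ I) y = `|M| *+ 2.
  rewrite -Rintegral_mkcond Rintegral_cst//= /I lebesgue_measure_itv/= lte_fin mul1r.
  have := normr_ge0 M; rewrite le_eqVlt => /predU1P[<-|M0].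
    by rewrite subr0 addr0 ltxx mul0rn.
  have -> : x - `|M| < x + `|M| by lra.
  by rewrite -EFinD/=; ring.
have iS : mu.-integrable setT (EFin \o (fun y => ((cst 1 : R -> R) \_ I) y + u y ^+ 2)).
  exact: (integrableD measurableT i1 i2).
apply: (@le_trans _ _ (C * \int[mu]_y (((cst 1 : R -> R) \_ I) y + u y ^+ 2))).
  rewrite -RintegralZl//; apply: le_Rintegral => //.
  - exact: (integrable_norm (moll_integrable k x trho lu)).
  - exact: (integrableZl measurableT C iS).
  - move=> y _; rewrite normrM mulrC patchE; case: ifPn => [_|].
      have := normr_ge0 (u y); rewrite ler_pM// /=; rewrite -real_normK ?num_real//; nra.
    rewrite notin_setE /I/= in_itv/= => H.
    rewrite HM ?normr0 ?mul0r.
      by apply: mulr_ge0 => //; apply: addr_ge0 => //; exact: sqr_ge0.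
    rewrite ltNge; apply/negP => xyM; apply: H.
    move: xyM => /le_trans/(_ (ler_norm M)).
    by rewrite ler_norml => /andP[h1 h2]; apply/andP; split; lra.
rewrite RintegralD// E1 -mulrA ler_wpM2l//.
have : 0 <= \int[mu]_y (u y ^+ 2) by apply: Rintegral_ge0 => y _; rewrite sqr_ge0.
have : 0 <= `|M| *+ 2 by rewrite mulrn_wge0.
by move: (`|M| *+ 2) (\int[mu]_y (u y ^+ 2)) => A B; nra.
Qed.


Lemma integral_mollifier (rho : R -> R) (x : R) : test_function rho -> (forall z, 0 <= rho z) ->
  (forall z, rho (- z) = rho z) -> (\int[mu]_z (rho z)%:E)%E = 1%E ->
  (\int[mu]_y (rho (x - y))%:E)%E = 1%E.
Proof.
move=> trho r0 rN <-.
rewrite -(@integral_translate _ rho x)//.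
  by apply: eq_integral => y _; rewrite -rN opprB.
exact: derivable_continuous (fun z => is_derive_derive1n 0 z trho).
Qed.

Lemma Rintegral_mollifier (rho : R -> R) (x : R) : test_function rho -> (forall z, 0 <= rho z) ->
  (forall z, rho (- z) = rho z) -> (\int[mu]_z (rho z)%:E)%E = 1%E ->
  \int[mu]_y (rho (x - y)) = 1.
Proof. by move=> t r0 rN r1; rewrite /Rintegral integral_mollifier. Qed.

Definition mollifier (h : R) rho := [/\ test_function rho,
  forall x, 0 <= rho x <= expR 4 / h, forall x, h <= `|x| -> rho x = 0,
  forall x, rho (- x) = rho x & (\int[mu]_x (rho x)%:E)%E = 1%E].

Lemma moll_sub_cst h rho u (c x : R) : mollifier h rho -> locint u ->
  moll rho u 0 x - c = \int[mu]_y ((u y - c) * rho (x - y)).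
Proof.
move=> [trho r0 _ rN r1] lu.
have lc : locint (cst c : R -> R).
  by split; [exact: measurable_cst|move=> a b; exact: integrable_cst_itv].
have ic := moll_integrable 0 x trho lc.
have i1 : mu.-integrable setT (EFin \o (fun y => rho (x - y))).
  have l1 : locint (cst 1 : R -> R).
    by split; [exact: measurable_cst|move=> a b; exact: integrable_cst_itv].
  have := moll_integrable 0 x trho l1.
  by apply: eq_integrable => // y _; rewrite /= mul1r.
have -> : c = \int[mu]_y (c * rho (x - y)).
  rewrite RintegralZl// Rintegral_mollifier ?mulr1// => z.
  by case/andP: (r0 z).
rewrite /moll -RintegralB//; last exact: moll_integrable.
apply: eq_Rintegral => y _.
rewrite RintegralZl// Rintegral_mollifier ?mulr1// ?mulrBl// => z.
by case/andP: (r0 z).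
Qed.

(* [J (v - c)^2 >= 0] with [c = J v]. *)
Lemma moll_sqr_le h rho u (x : R) : mollifier h rho -> L2 u ->
  (moll rho u 0 x) ^+ 2 <= \int[mu]_y (u y ^+ 2 * rho (x - y)).
Proof.
move=> mr u2; have [trho r0 _ rN r1] := mr.
have lu := L2_locint u2.
have lu2 := integrable_locint (L2_integrable_sqr u2).
have i1 := moll_integrable 0 x trho lu.
have i2 := moll_integrable 0 x trho lu2.
have ll : locint (cst 1 : R -> R).
  by split; [exact: measurable_cst|move=> a b; exact: integrable_cst_itv].
have i3 := moll_integrable 0 x trho ll.
set c := moll rho u 0 x.
have H0 : 0 <= \int[mu]_y ((u y - c) ^+ 2 * rho (x - y)).
  apply: Rintegral_ge0 => y _; rewrite mulr_ge0 ?sqr_ge0//.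
  by case/andP: (r0 (x - y)).
have i4 : mu.-integrable setT
    (EFin \o (fun y => - (2 * c) * (u y * rho (x - y)))).
  exact: (integrableZl measurableT (- (2 * c)) i1).
have i5 : mu.-integrable setT
    (EFin \o (fun y => c ^+ 2 * (1 * rho (x - y)))).
  exact: (integrableZl measurableT (c ^+ 2) i3).
have E2 : \int[mu]_y (- (2 * c) * (u y * rho (x - y))) = - (2 * c) * c.
  by rewrite RintegralZl.
have E3 : \int[mu]_y (c ^+ 2 * (1 * rho (x - y))) = c ^+ 2.
  rewrite RintegralZl//; under eq_Rintegral do rewrite mul1r.
  by rewrite Rintegral_mollifier ?mulr1// => z; case/andP: (r0 z).
have E : \int[mu]_y ((u y - c) ^+ 2 * rho (x - y)) =
   \int[mu]_y (u y ^+ 2 * rho (x - y)) + (- (2 * c)) * c + c ^+ 2.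
  rewrite -E2 -E3 -RintegralD// -RintegralD//; last exact: (integrableD measurableT i2 i4).
  apply: eq_Rintegral => y _; ring.
move: H0; rewrite E; nra.
Qed.

End Mollification.

(** * Weighted L^2 bounds and convergence at Lebesgue points *)

Section MollificationBounds.
Context {R : realType}.
Notation mu := (@lebesgue_measure R).
Implicit Types (f g u v w phi rho : R -> R) (k n : nat).

Lemma moll_measurable rho u k : test_function rho -> locint u ->
  measurable_fun setT (moll rho u k).
Proof. by move=> t l; exact: derivable_measurable (fun x => is_derive_moll k x t l). Qed.

(** Jensen's inequality for the probability kernel, then Tonelli. Slow variation moves the weight
    from [x] to [y], after which the kernel integrates to 1 in [x]. *)
Lemma moll_weighted (h K : R) rho u w : mollifier h rho -> L2 u ->
  measurable_fun setT w -> (forall x, 0 <= w x) -> 0 <= K ->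
  (forall x y, `|x - y| <= h -> w x <= K * w y) ->
  (\int[mu]_x (w x * (moll rho u 0 x) ^+ 2)%:E <=
   \int[mu]_x (K * (w x * u x ^+ 2))%:E)%E.
Proof.
move=> mr u2 mw w0 K0 wK; have [trho r0 rh rN r1] := mr.
have r0' z : 0 <= rho z by case/andP: (r0 z).
have lu := L2_locint u2.
have lu2 := integrable_locint (L2_integrable_sqr u2).
have mrho : measurable_fun setT rho := test_measurable 0 trho.
have mu_ := L2_measurable u2.
pose F (z : measurableTypeR R * measurableTypeR R) : R := w z.1 * (u z.2 ^+ 2 * rho (z.1 - z.2)).
have F0 z : 0 <= F z by rewrite mulr_ge0// mulr_ge0 ?sqr_ge0.
have mF : measurable_fun setT F.
  apply: measurable_funM; first exact: measurableT_comp.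
  apply: measurable_funM.
    by apply: measurable_funX; exact: measurableT_comp.
  by apply: measurableT_comp => //; exact: measurable_funB.
apply: (@le_trans _ _ (\int[mu]_x \int[mu]_y (F (x, y))%:E)%E).
  apply: ge0_le_integral => //.
  - by move=> x _; rewrite lee_fin mulr_ge0 ?sqr_ge0.
  - apply/measurable_EFinP; apply: measurable_funM => //.
    by apply: measurable_funX; exact: moll_measurable.
  - have := @measurable_fun_fubini_tonelli_F _ _ _ _ R mu (EFin \o F).
    apply; first exact/measurable_EFinP.
    by move=> z; rewrite lee_fin.
  - move=> x _; apply: (@le_trans _ _ (w x * \int[mu]_y (u y ^+ 2 * rho (x - y)))%:E).
      by rewrite lee_fin ler_wpM2l// (moll_sqr_le x mr).
    have iF : mu.-integrable setT (EFin \o (fun y => u y ^+ 2 * rho (x - y))).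
      exact: (moll_integrable 0 x trho lu2).
    rewrite -RintegralZl// /Rintegral fineK//.
    by apply: integrable_fin_num => //; exact: (integrableZl measurableT (w x) iF).
rewrite (@fubini_tonelli _ _ _ _ R mu mu (EFin \o F)); last 2 first.
- exact/measurable_EFinP.
- by move=> z; rewrite lee_fin.
have mG : measurable_fun setT (fun y => \int[mu]_x (EFin \o F) (x, y))%E.
  have := @measurable_fun_fubini_tonelli_G _ _ _ _ R mu (EFin \o F).
  apply; first exact/measurable_EFinP.
  by move=> z; rewrite lee_fin.
apply: ge0_le_integral => //.
- by move=> y _; apply: integral_ge0 => x _; rewrite lee_fin.
- apply/measurable_EFinP; apply: measurable_funM => //; apply: measurable_funM => //.
  exact: measurable_funX.
move=> y _.
have my : measurable_fun setT (fun x : R => rho (x - y)).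
  by apply: measurableT_comp => //; exact: measurable_funB.
apply: (@le_trans _ _ (\int[mu]_x ((K * (w y * u y ^+ 2))%:E * (rho (x - y))%:E))%E).
  apply: ge0_le_integral => //.
  - by move=> x _; rewrite lee_fin.
  - apply/measurable_EFinP; rewrite /F/=; apply: measurable_funM => //.
    by apply: measurable_funM => //; exact: measurable_cst.
  - by apply: emeasurable_funM; exact/measurable_EFinP.
  - move=> x _; rewrite -EFinM lee_fin /F/=.
    have [hxy|hxy] := lerP h `|x - y|; first by rewrite rh// !mulr0.
    rewrite -[leRHS]mulrA [leRHS](_ : _ = K * w y * (u y ^+ 2 * rho (x - y))); last ring.
    apply: ler_wpM2r; last by apply: wK; exact: ltW.
    by apply: mulr_ge0 => //; exact: sqr_ge0.
rewrite ge0_integralZl//.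
- have crho : continuous rho := derivable_continuous (fun z => is_derive_derive1n 0 z trho).
  by rewrite (@integral_translate _ rho y)// r1 mule1.
- exact/measurable_EFinP.
- by move=> x _; rewrite lee_fin.
- by rewrite lee_fin mulr_ge0// mulr_ge0 ?sqr_ge0.
Qed.

Lemma integrable_moll_sqr h rho u : mollifier h rho -> L2 u ->
  mu.-integrable setT (EFin \o (fun x => moll rho u 0 x ^+ 2)).
Proof.
move=> mr u2; have [trho _ _ _ _] := mr; have lu := L2_locint u2.
apply/integrableP; split.
  by apply/measurable_EFinP; apply: measurable_funX; exact: moll_measurable.
have := @moll_weighted h 1 rho u (cst 1) mr u2 (@measurable_cst _ _ _ _ _ _) (fun=> ler01) ler01.
have /integrableP[_ iu] := L2_integrable_sqr u2.
move=> /(_ (fun _ _ _ => _)); rewrite /= mulr1 => /(_ (fun _ _ => lexx 1)).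
move=> H; apply: (le_lt_trans _ iu); apply: (le_trans _ (le_trans H _)).
  rewrite le_eqVlt; apply/orP; left; apply/eqP; apply: eq_integral => x _.
  by rewrite /= mul1r ger0_norm ?sqr_ge0.
rewrite le_eqVlt; apply/orP; left; apply/eqP; apply: eq_integral => x _.
by rewrite /= !mul1r ger0_norm ?sqr_ge0.
Qed.

Lemma Rintegral_moll_sqr h rho u : mollifier h rho -> L2 u ->
  \int[mu]_x (moll rho u 0 x ^+ 2) <= \int[mu]_x (u x ^+ 2).
Proof.
move=> mr u2.
have := @moll_weighted h 1 rho u (cst 1) mr u2 (@measurable_cst _ _ _ _ _ _) (fun=> ler01) ler01.
rewrite /= mulr1 => /(_ (fun _ _ _ => lexx 1)) H.
have i1 := integrable_moll_sqr mr u2.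
have i2 := L2_integrable_sqr u2.
rewrite /Rintegral -lee_fin !fineK; [|exact: integrable_fin_num..].
under eq_integral do rewrite -[X in X%:E]mul1r.
apply: (le_trans H); rewrite le_eqVlt; apply/orP; left; apply/eqP.
by apply: eq_integral => x _; rewrite !mul1r.
Qed.

Lemma locally_integrable_locint u : locint u -> locally_integrable setT u.
Proof.
move=> [mu_ iu]; split => //; first exact: openT.
move=> K _ /[dup] cK /compact_bounded[M [_ HM]].
have /integrableP[_ H] := integrable_norm (iu (- (M + 1)) (M + 1)).
apply: le_lt_trans H; rewrite [leRHS](_ : _ =
   \int[mu]_(x in `[(- (M + 1))%R, (M + 1)%R]) (`|u x|)%:E)%E; last first.
  by apply: eq_integral => x _; rewrite /= normr_id.
apply: ge0_subset_integral => //.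
- exact: compact_measurable.
- by apply/measurable_EFinP; apply: measurableT_comp => //; exact: measurable_funTS.
- move=> x Kx /=; rewrite in_itv/= -ler_norml.
  by have := HM (M + 1); rewrite ltrDl ltr01 => /(_ isT x Kx).
Qed.

(** The kernel is at most [expR 4 / h] on a ball of measure [2 h], so the error is at most
    [2 * expR 4] times the mean oscillation over that ball. *)
Lemma cvg_moll (hs : nat -> R) (rhos : nat -> R -> R) u (x : R) :
  (forall n, 0 < hs n) -> hs n @[n --> \oo] --> (0 : R) ->
  (forall n, mollifier (hs n) (rhos n)) -> locint u -> lebesgue_pt u x ->
  moll (rhos n) u 0 x @[n --> \oo] --> u x.
Proof.
move=> hs0 hscv mrs lu lpt.
have [mu_ iu] := lu.
have lc : locint (cst (u x) : R -> R).
  by split; [exact: measurable_cst|move=> a b; exact: integrable_cst_itv].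
have bnd n : ((`|moll (rhos n) u 0 x - u x|)%:E <= (2 * expR 4)%:E * davg u x (hs n))%E.
  have [trho r0 rh rN r1] := mrs n.
  rewrite (moll_sub_cst (u x) x (mrs n) lu).
  have i0 : mu.-integrable setT (EFin \o (fun y => (u y - u x) * rhos n (x - y))).
    have := integrableB measurableT (moll_integrable 0 x trho lu)
      (moll_integrable 0 x trho lc).
    by apply: eq_integrable => // y _; rewrite /= -EFinB mulrBl.
  have mball : measurable (ball x (hs n)) by exact: measurable_ball.
  have ibd : (`|\int[mu]_y ((u y - u x) * rhos n (x - y))|%:E <=
      \int[mu]_(y in ball x (hs n)) (expR 4 / hs n * `|u y - u x|)%:E)%E.
    apply: (@le_trans _ _ (\int[mu]_y (`|(u y - u x) * rhos n (x - y)|)%:E)%E).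
      by rewrite EFin_normr_Rintegral// le_abse_integral//; case/integrableP: i0.
    rewrite [leRHS]integral_mkcond; apply: ge0_le_integral => //.
    - by have /integrableP[] := integrable_norm i0.
    - apply/(measurable_restrictT _ _).1 => //; apply/measurable_EFinP.
      apply: measurable_funM => //; apply: measurableT_comp => //.
      by apply: measurable_funTS; exact: measurable_funB.
    - move=> y _; rewrite patchE; case: ifPn => [_|].
        rewrite lee_fin normrM mulrC ler_wpM2r//.
        by have /andP[a1 a2] := r0 (x - y); rewrite ger0_norm.
      rewrite notin_setE/= /ball/= => /negP; rewrite -leNgt => H.
      by rewrite rh// mulr0 normr0.
  apply: (le_trans ibd).
  under eq_integral do rewrite EFinM.
  rewrite ge0_integralZl//; last 2 first.
  - apply/measurable_EFinP; apply: measurableT_comp => //.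
    by apply: measurable_funTS; exact: measurable_funB.
  - by rewrite lee_fin divr_ge0 ?expR_ge0// ltW.
  rewrite /davg /iavg lebesgue_measure_ball; last exact: ltW.
  rewrite inver mulrn_eq0/= gt_eqF// muleA -EFinM.
  rewrite [2 * expR 4 / (hs n *+ 2)](_ : _ = expR 4 / hs n)//.
  by have := hs0 n; rewrite -mulr_natr => h0; field; rewrite gt_eqF.
have cvd : davg u x (hs n) @[n --> \oo] --> 0%E.
  apply: (@cvg_comp _ _ _ hs (davg u x) _ (0^'+)) => //.
  move=> U /(hscv _) HU.
  have {}HU : \forall n \near \oo, 0 < hs n -> U (hs n) := HU.
  by apply: filterS HU => n Hn; exact: Hn (hs0 n).
have /fine_cvgP[fd cd] := cvd.
apply/cvgrPdist_le => e e0.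
have C0 : 0 < 2 * expR 4 :> R by rewrite mulr_gt0// expR_gt0.
have /cvgr0Pnorm_le/(_ (e / (2 * expR 4))) := cd.
rewrite divr_gt0// => /(_ isT) cd'.
near=> n.
have fn : davg u x (hs n) \is a fin_num by near: n; exact: fd.
rewrite distrC -lee_fin (le_trans (bnd n))// -(fineK fn) -EFinM lee_fin.
rewrite mulrC -ler_pdivlMr// (le_trans (ler_norm _))//.
by near: n; exact: cd'.
Unshelve. all: by end_near. Qed.

End MollificationBounds.

(** * Sobolev and Morrey estimates *)

Section Sobolev.
Context {R : realType}.
Notation mu := (@lebesgue_measure R).
Implicit Types (f g u v w phi rho : R -> R) (k n : nat).

Lemma ae_mono (P Q : R -> Prop) : (forall x, P x -> Q x) ->
  {ae mu, forall x, P x} -> {ae mu, forall x, Q x}.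
Proof.
move=> PQ [N [mN N0 PN]]; exists N; split => //.
by apply: subset_trans PN => x /= nQ Px; apply: nQ; exact: PQ.
Qed.

Lemma ae_and (P Q : R -> Prop) :
  {ae mu, forall x, P x} -> {ae mu, forall x, Q x} ->
  {ae mu, forall x, P x /\ Q x}.
Proof.
move=> p q; have := negligibleU p q.
apply: negligibleS => x /= /not_andP[nP|nQ]; by [left|right].
Qed.

Lemma cvgr0_sqr (s : nat -> R) : s n @[n --> \oo] --> (0 : R) ->
  s n ^+ 2 @[n --> \oo] --> (0 : R).
Proof.
move=> scv; rewrite (_ : (fun n => s n ^+ 2) = (fun n => s n * s n)); last first.
  by apply/funext => n; rewrite expr2.
by rewrite -[X in _ --> X](mulr0 0); exact: cvgM.
Qed.

Lemma mollifier_sequence : exists (s : nat -> R) (rhos : nat -> R -> R),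
  [/\ forall n, 0 < s n <= 1, s n @[n --> \oo] --> (0 : R) &
      forall n, mollifier (s n ^+ 2) (rhos n)].
Proof.
pose s n : R := n.+1%:R^-1.
have s0 n : 0 < s n by rewrite invr_gt0.
have /choice[rhos Hrhos] : forall n, exists rho, mollifier (s n ^+ 2) rho.
  by move=> n; apply: mollifier_exists; rewrite exprn_gt0.
exists s, rhos; split => //; last exact: cvg_harmonic.
by move=> n; rewrite s0 invf_le1// ler1n.
Qed.

Lemma ae_cvg_moll (s : nat -> R) (rhos : nat -> R -> R) u :
  (forall n, 0 < s n <= 1) -> s n @[n --> \oo] --> (0 : R) ->
  (forall n, mollifier (s n ^+ 2) (rhos n)) -> locint u ->
  {ae mu, forall x, moll (rhos n) u 0 x @[n --> \oo] --> u x}.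
Proof.
move=> s0 scv mr lu.
apply: ae_mono (lebesgue_differentiation (locally_integrable_locint lu)) => x lx.
apply: (@cvg_moll _ (fun n => s n ^+ 2)) => //.
  by move=> n; rewrite exprn_gt0//; case/andP: (s0 n).
exact: cvgr0_sqr.
Qed.

(** Both candidates have the same mollifications, namely the derivatives of the mollifications of
    [u]; let the scale vanish. *)
Lemma weak_derivative_unique u g1 g2 : L2 u -> L2 g1 -> L2 g2 ->
  is_weak_derivative u g1 -> is_weak_derivative u g2 ->
  {ae mu, forall x, g1 x = g2 x}.
Proof.
move=> u2 g12 g22 w1 w2.
have [s [rhos [s0 scv mr]]] := mollifier_sequence.
have lu := L2_locint u2.
have c1 := ae_cvg_moll s0 scv mr (L2_locint g12).
have c2 := ae_cvg_moll s0 scv mr (L2_locint g22).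
apply: ae_mono (ae_and c1 c2) => x [h1 h2].
apply: (cvg_unique _ h1) => //.
have -> : (fun n => moll (rhos n) g1 0 x) = (fun n => moll (rhos n) g2 0 x).
  apply/funext => n; have [t _ _ _ _] := mr n.
  by rewrite -(moll_weak 0 x t lu w1) -(moll_weak 0 x t lu w2).
exact: h2.
Qed.

(** Young's inequality [|w| <= s w^2 / 2 + 1 / (2 s)] under the integral stands in for
    Cauchy-Schwarz; the free [s] is later matched with the distance. *)
Lemma morrey_smooth v w (s y z : R) : 0 < s ->
  (forall x : R, is_derive x 1 v (w x)) -> continuous w ->
  mu.-integrable setT (EFin \o (fun x => w x ^+ 2)) -> z <= y ->
  `|v y - v z| <= s / 2 * (\int[mu]_x (w x ^+ 2)) + (y - z) / (2 * s).
Proof.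
move=> s0 dv cw iw zy; rewrite -(Rintegral_FTC2 zy dv cw).
have icw : mu.-integrable `[z, y] (EFin \o w).
  apply: continuous_compact_integrable; first exact: segment_compact.
  exact: continuous_subspaceT.
have i1 : mu.-integrable `[z, y] (EFin \o (fun x => s / 2 * w x ^+ 2)).
  apply: (@integrableZl _ _ _ mu `[z, y] (measurable_itv _) (s / 2)
    (EFin \o (fun x => w x ^+ 2))).
  by apply: integrableS iw.
have i2 := @integrable_cst_itv R z y (1 / (2 * s)).
rewrite (le_trans (le_normr_Rintegral _ icw))//.
apply: (@le_trans _ _ (\int[mu]_(x in `[z, y]) (s / 2 * w x ^+ 2 + 1 / (2 * s)))).
  apply: le_Rintegral => //.
  - exact: (integrable_norm icw).
  - exact: (@integrableD _ _ _ mu `[z, y] (measurable_itv _) _ _ i1 i2).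
  - move=> x _.
    have H : 0 <= (s * `|w x| - 1) ^+ 2 by rewrite sqr_ge0.
    rewrite -[w x ^+ 2](@real_normK) ?num_real//.
    rewrite -(ler_pM2l (_ : 0 < 2 * s)); last lra.
    have -> : 2 * s * (s / 2 * `|w x| ^+ 2 + 1 / (2 * s)) = s ^+ 2 * `|w x| ^+ 2 + 1.
      by field; rewrite gt_eqF.
    by move: H; move: `|w x| => q; nra.
rewrite RintegralD// lerD//.
  rewrite -RintegralZl//; last first.
  rewrite [leRHS]Rintegral_mkcond patch_setT /Rintegral fine_le//.
  - apply: integrable_fin_num => //.
  - apply: integrable_fin_num => //.
    exact: (integrableZl measurableT (s/2) iw).
  - apply: ge0_subset_integral => //.
    + apply/measurable_EFinP; apply: measurable_funM => //.
      apply: measurable_funX; exact: continuous_measurable_fun.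
    + by move=> x _; rewrite lee_fin mulr_ge0 ?sqr_ge0// divr_ge0// ltW.
rewrite Rintegral_cst//= lebesgue_measure_itv/= lte_fin.
case: ltP => [zy'|yz]; last by rewrite mulr0 divr_ge0 ?subr_ge0// mulr_ge0// ltW.
by rewrite -EFinD/= mulrC mul1r.
Qed.

(** The bound passes from mollifications to [u] itself at Lebesgue points, so no continuous
    representative has to be chosen. The distance [2 s^2] is the diameter of a mollifier's
    support. *)
Lemma morrey u u' (s y z : R) : 0 < s -> L2 u -> L2 u' ->
  is_weak_derivative u u' -> lebesgue_pt u y -> lebesgue_pt u z ->
  `|y - z| <= 2 * s ^+ 2 ->
  `|u y - u z| <= s * (1 + \int[mu]_x (u' x ^+ 2)).
Proof.
move=> s0 u2 u'2 wu ly lz.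
wlog zy : y z ly lz / z <= y => [H|].
  have [zy|/ltW yz] := leP z y; first exact: (H y z ly lz zy).
  by rewrite distrC (distrC (u y)); exact: (H z y lz ly yz).
rewrite ger0_norm ?subr_ge0// => yz.
have [t [rhos [t0 tcv mr]]] := mollifier_sequence.
have lu := L2_locint u2.
have t20 n : 0 < t n ^+ 2 by rewrite exprn_gt0//; case/andP: (t0 n).
have t2cv : t n ^+ 2 @[n --> \oo] --> (0 : R).
  exact: cvgr0_sqr.
have cy := cvg_moll t20 t2cv mr lu ly.
have cz := cvg_moll t20 t2cv mr lu lz.
have cyz : `|moll (rhos n) u 0 y - moll (rhos n) u 0 z| @[n --> \oo] --> `|u y - u z|.
  by have := cvg_norm (cvgB cy cz); exact.
apply: (cvgr_to_le cyz).
near=> n; have [trho _ _ _ _] := mr n.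
have dv x := is_derive_moll 0 x trho lu.
have w1 : moll (rhos n) u 1 = moll (rhos n) u' 0.
  by apply/funext => x; rewrite (moll_weak 0 x trho lu wu).
have dv' (x : R) : is_derive x 1 (moll (rhos n) u 0) (moll (rhos n) u' 0 x).
  by rewrite -w1; exact: dv.
have cw : continuous (moll (rhos n) u' 0).
  exact: derivable_continuous (fun x => is_derive_moll 0 x trho (L2_locint u'2)).
have := morrey_smooth s0 dv' cw (integrable_moll_sqr (mr n) u'2) zy.
move/le_trans; apply.
have := Rintegral_moll_sqr (mr n) u'2.
have : (y - z) / (2 * s) <= s.
  by rewrite ler_pdivrMr ?mulr_gt0// (le_trans yz)//; nra.
have : 0 <= \int[mu]_x (u' x ^+ 2) by apply: Rintegral_ge0 => x _; rewrite sqr_ge0.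
move: (\int[mu]_x (u' x ^+ 2)) (\int[mu]_x (moll _ _ _ x ^+ 2)) ((y - z) / (2 * s)).
move=> A B C; nra.
Unshelve. all: by end_near. Qed.

(** [v(x)^2] is the integral over the half-line from [x] of the derivative of
    [- exp(-(y - x)) v(y)^2]; the exponential kills the boundary term at infinity even though [v] is
    only known to be bounded. *)
Lemma sobolev_smooth v w (C x : R) :
  (forall x : R, is_derive x 1 v (w x)) -> continuous w ->
  (forall x, `|v x| <= C) ->
  mu.-integrable setT (EFin \o (fun x => v x ^+ 2)) ->
  mu.-integrable setT (EFin \o (fun x => w x ^+ 2)) ->
  v x ^+ 2 <= 2 * (\int[mu]_x (v x ^+ 2)) + \int[mu]_x (w x ^+ 2).
Proof.
move=> dv cw vC iv iw.
have cv := derivable_continuous dv.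
have dF (y : R) : is_derive y 1 (fun y => - (v y ^+ 2 * expR (- (y - x))))
    (expR (- (y - x)) * (v y ^+ 2 - 2 * (v y * w y))).
  have d1 := dv y.
  apply: is_derive_eq; rewrite /GRing.scale/=; ring.
have ce : continuous (fun y => expR (- (y - x))).
  have de (y : R) : is_derive y 1 (fun y => expR (- (y - x))) (- expR (- (y - x))).
    by apply: is_derive_eq; rewrite /GRing.scale/=; ring.
  exact: derivable_continuous de.
have cf : continuous (fun y => expR (- (y - x)) * (v y ^+ 2 - 2 * (v y * w y))).
  move=> y; apply: cvgM; first exact: ce.
  apply: cvgB; first by apply: cvgM; exact: cv.
  by apply: cvgM; [exact: cvg_cst|apply: cvgM; [exact: cv|exact: cw]].
have i2v : mu.-integrable setT (EFin \o (fun x => 2 * v x ^+ 2)).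
  exact: (integrableZl measurableT 2 iv).
have iD : mu.-integrable setT (EFin \o (fun x => 2 * v x ^+ 2 + w x ^+ 2)).
  exact: (integrableD measurableT i2v iw).
have bnd y : x <= y -> `|expR (- (y - x)) * (v y ^+ 2 - 2 * (v y * w y))| <=
    2 * v y ^+ 2 + w y ^+ 2.
  move=> xy; rewrite normrM ger0_norm ?expR_ge0//.
  have e1 : expR (- (y - x)) <= 1.
    by rewrite -expR0 ler_expR oppr_le0 subr_ge0.
  apply: (@le_trans _ _ `|v y ^+ 2 - 2 * (v y * w y)|).
    by rewrite -[leRHS]mul1r ler_wpM2r.
  have := sqr_ge0 (v y - w y); have := sqr_ge0 (v y + w y); have := sqr_ge0 (v y).
  by rewrite ler_norml => h1 h2 h3; apply/andP; split; nra.
have ify : mu.-integrable `[x, +oo[ (EFin \o (fun y => expR (- (y - x)) * (v y ^+ 2 - 2 * (v y * w y)))).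
  apply: (@integrable_dominated _ _ _ (fun x => 2 * v x ^+ 2 + w x ^+ 2)) => //.
  - by apply: measurable_funTS; exact: continuous_measurable_fun.
  - by apply: integrableS iD.
  - by move=> y /=; rewrite in_itv/= andbT; exact: bnd.
have := @Rintegral_derive_itvy _ 1 (C ^+ 2) x _ _ ltr01 dF cf _ ify.
rewrite subrr oppr0 expR0 mulr1 opprK => <-; last first.
  move=> y _; rewrite normrN normrM (ger0_norm (expR_ge0 _)) mul1r ler_wpM2r ?expR_ge0//.
  by rewrite normrX lerXn2r ?nnegrE// (le_trans _ (vC y)).
apply: (@le_trans _ _ (\int[mu]_(y in `[x, +oo[) (2 * v y ^+ 2 + w y ^+ 2))).
  apply: le_Rintegral => //; first by apply: integrableS iD.
  by move=> y /=; rewrite in_itv/= andbT => /bnd; apply: le_trans; exact: ler_norm.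
rewrite -RintegralZl// -RintegralD// /Rintegral fine_le//.
- by apply: integrable_fin_num => //; apply: integrableS iD.
- exact: integrable_fin_num.
- apply: ge0_subset_integral => //.
  + by apply/measurable_EFinP; have /integrableP[/measurable_EFinP] := iD.
  + by move=> y _; rewrite lee_fin; have := sqr_ge0 (v y); have := sqr_ge0 (w y); lra.
Qed.

Lemma moll_sobolev h rho u u' x : mollifier h rho -> L2 u -> L2 u' ->
  is_weak_derivative u u' ->
  (moll rho u 0 x) ^+ 2 <= 2 * (\int[mu]_x (u x ^+ 2)) + \int[mu]_x (u' x ^+ 2).
Proof.
move=> mr u2 u'2 wu; have [trho _ _ _ _] := mr.
have lu := L2_locint u2.
have dv x := is_derive_moll 0 x trho lu.
have w1 : moll rho u 1 = moll rho u' 0.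
  by apply/funext => y; rewrite (moll_weak 0 y trho lu wu).
have dv' (y : R) : is_derive y 1 (moll rho u 0) (moll rho u' 0 y).
  by rewrite -w1; exact: dv.
have cw : continuous (moll rho u' 0).
  exact: derivable_continuous (fun x => is_derive_moll 0 x trho (L2_locint u'2)).
have [C _ HC] := moll_bound_L2 0 trho.
have := sobolev_smooth x dv' cw (fun x => HC u x u2) (integrable_moll_sqr mr u2)
  (integrable_moll_sqr mr u'2).
move/le_trans; apply; rewrite lerD// ?(Rintegral_moll_sqr mr)//.
by rewrite ler_wpM2l// (Rintegral_moll_sqr mr).
Qed.


Lemma locintD u v : locint u -> locint v -> locint (fun x => u x + v x).
Proof.
move=> [mu_ iu] [mv iv]; split; first exact: measurable_funD.
by move=> a b; exact: (@integrableD _ _ _ mu `[a, b] (measurable_itv _) _ _ (iu a b) (iv a b)).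
Qed.

Lemma locintZ c u : locint u -> locint (fun x => c * u x).
Proof.
move=> [mu_ iu]; split; first exact: measurable_funM.
by move=> a b; exact: (@integrableZl _ _ _ mu `[a, b] (measurable_itv _) c _ (iu a b)).
Qed.

Lemma locint_cst c : locint (fun=> c : R).
Proof. by split; [exact: measurable_cst|move=> a b; exact: integrable_cst_itv]. Qed.

Lemma mollD rho u v k x : test_function rho -> locint u -> locint v ->
  moll rho (fun x => u x + v x) k x = moll rho u k x + moll rho v k x.
Proof.
move=> t lu lv; rewrite /moll -RintegralD//; [|exact: moll_integrable..].
by apply: eq_Rintegral => y _; rewrite mulrDl.
Qed.

Lemma mollZ rho u c k x : test_function rho -> locint u ->
  moll rho (fun x => c * u x) k x = c * moll rho u k x.
Proof.
move=> t lu; rewrite /moll -RintegralZl//; last exact: moll_integrable.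
by apply: eq_Rintegral => y _; rewrite mulrA.
Qed.

Lemma moll_cst h rho c x : mollifier h rho -> moll rho (fun=> c) 0 x = c.
Proof.
move=> mr; apply/eqP; rewrite -subr_eq0; apply/eqP.
rewrite (moll_sub_cst c x mr (locint_cst c)).
rewrite /Rintegral; under eq_integral do rewrite subrr mul0r.
by rewrite integral0.
Qed.

Lemma moll_ae_bound h rho u K x : mollifier h rho -> locint u -> 0 <= K ->
  {ae mu, forall y, `|x - y| < h -> `|u y| <= K} -> `|moll rho u 0 x| <= K.
Proof.
move=> mr lu K0 uK; have [trho r0 rh rN r1] := mr.
have iu := moll_integrable 0 x trho lu.
have mrho : measurable_fun setT (fun y : R => rho (x - y)).
  exact: measurable_reflect (test_measurable 0 trho).
rewrite -lee_fin EFin_normr_Rintegral//.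
apply: (@le_trans _ _ (\int[mu]_y (`|u y * rho (x - y)|)%:E)%E).
  by apply: le_abse_integral => //; case/integrableP: iu.
have r0' z : 0 <= rho z by case/andP: (r0 z).
apply: (@le_trans _ _ (\int[mu]_y (K * rho (x - y))%:E)%E).
  apply: ae_ge0_le_integral => //.
  - by have /integrableP[] := integrable_norm iu.
  - by move=> y _; rewrite lee_fin mulr_ge0.
  - by apply/measurable_EFinP; exact: measurable_funM.
  - apply: ae_mono uK => y Hy _; rewrite lee_fin normrM (ger0_norm (r0' _)).
    have [hxy|hxy] := lerP h `|x - y|; first by rewrite rh// !mulr0.
    by rewrite ler_wpM2r// Hy.
under eq_integral do rewrite EFinM.
rewrite ge0_integralZl//.
- by rewrite (integral_mollifier x trho)// mule1.
- exact/measurable_EFinP.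
- by move=> y _; rewrite lee_fin.
Qed.

(* [J (u v) - J u * J v = J ((u - a) (v - b)) - (J u - a) (J v - b)] for any
   constants [a] and [b]; take the values of [u] and [v] near [x]. *)
Lemma moll_commutator s rho u u' v v' x : 0 < s -> mollifier (s ^+ 2) rho ->
  L2 u -> L2 u' -> is_weak_derivative u u' ->
  L2 v -> L2 v' -> is_weak_derivative v v' ->
  `|moll rho (fun y => u y * v y) 0 x - moll rho u 0 x * moll rho v 0 x| <=
  2 * s ^+ 2 * (1 + \int[mu]_y (u' y ^+ 2)) * (1 + \int[mu]_y (v' y ^+ 2)).
Proof.
move=> s0 mr u2 u'2 wu v2 v'2 wv; have [trho r0 rh rN r1] := mr.
have lu := L2_locint u2; have lv := L2_locint v2.
have luv := integrable_locint (L2_integrable_mul u2 v2).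
have aeuv := ae_and (lebesgue_differentiation (locally_integrable_locint lu))
  (lebesgue_differentiation (locally_integrable_locint lv)).
have s20 : 0 < s ^+ 2 by rewrite exprn_gt0.
(* The centre [x] may fail to be a Lebesgue point; almost every point is one for both functions, and
   the ball has positive measure. *)
have [z [zx [lzu lzv]]] : exists z, `|x - z| < s ^+ 2 /\
    (lebesgue_pt u z /\ lebesgue_pt v z).
  apply: contrapT => nex; have [N [mN N0 sN]] := aeuv.
  have : (mu (ball x (s ^+ 2)) <= mu N)%E.
    apply: le_measure; rewrite ?inE//; first exact: measurable_ball.
    by move=> z xz; apply: sN => /= H; apply: nex; exists z.
  by rewrite N0 lebesgue_measure_ball ?(ltW s20)// leNgt lte_fin pmulrn_lgt0// s20.
set U := 1 + \int[mu]_y (u' y ^+ 2); set V := 1 + \int[mu]_y (v' y ^+ 2).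
have U0 : 0 <= U by rewrite addr_ge0// Rintegral_ge0// => y _; rewrite sqr_ge0.
have V0 : 0 <= V by rewrite addr_ge0// Rintegral_ge0// => y _; rewrite sqr_ge0.
have near_z y : `|x - y| < s ^+ 2 -> `|y - z| <= 2 * s ^+ 2.
  move=> xy; have -> : y - z = (x - z) - (x - y) by ring.
  rewrite (le_trans (ler_normB _ _))//; lra.
have bu : {ae mu, forall y, `|x - y| < s ^+ 2 -> `|u y - u z| <= s * U}.
  by apply: ae_mono aeuv => y [ly _] /near_z; exact: morrey.
have bv : {ae mu, forall y, `|x - y| < s ^+ 2 -> `|v y - v z| <= s * V}.
  by apply: ae_mono aeuv => y [_ ly] /near_z; exact: morrey.
have lu1 : locint (fun y => u y + - u z) by apply: locintD => //; exact: locint_cst.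
have lv1 : locint (fun y => v y + - v z) by apply: locintD => //; exact: locint_cst.
have E1 : moll rho (fun y => u y + - u z) 0 x = moll rho u 0 x - u z.
  by rewrite mollD//; [rewrite (moll_cst _ _ mr)|exact: locint_cst].
have E2 : moll rho (fun y => v y + - v z) 0 x = moll rho v 0 x - v z.
  by rewrite mollD//; [rewrite (moll_cst _ _ mr)|exact: locint_cst].
pose G := fun y => (u y * v y + - v z * u y) + (- u z * v y + u z * v z).
have lG1 : locint (fun y => u y * v y + - v z * u y).
  by apply: locintD => //; exact: locintZ.
have lG2 : locint (fun y => - u z * v y + u z * v z).
  by apply: locintD; [exact: locintZ|exact: locint_cst].
have lG : locint G by exact: locintD.
have E3 : moll rho G 0 x = moll rho (fun y => u y * v y) 0 x
   - v z * moll rho u 0 x - u z * moll rho v 0 x + u z * v z.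
  rewrite /G mollD// mollD//; last exact: locintZ.
  rewrite mollZ// mollD//; [|exact: locintZ|exact: locint_cst].
  by rewrite (mollZ (- u z))// (moll_cst _ _ mr); ring.
have -> : moll rho (fun y => u y * v y) 0 x - moll rho u 0 x * moll rho v 0 x =
   moll rho G 0 x - moll rho (fun y => u y + - u z) 0 x * moll rho (fun y => v y + - v z) 0 x.
  by rewrite E1 E2 E3; ring.
have H1 : `|moll rho (fun y => u y + - u z) 0 x| <= s * U.
  by apply: (moll_ae_bound mr) => //; rewrite mulr_ge0// ltW.
have H2 : `|moll rho (fun y => v y + - v z) 0 x| <= s * V.
  by apply: (moll_ae_bound mr) => //; rewrite mulr_ge0// ltW.
have H3 : `|moll rho G 0 x| <= s * U * (s * V).
  apply: (moll_ae_bound mr) => //; first by rewrite !mulr_ge0// ltW.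
  apply: ae_mono (ae_and bu bv) => y [h1 h2] xy.
  have -> : G y = (u y - u z) * (v y - v z) by rewrite /G; ring.
  by rewrite normrM ler_pM// ?h1 ?h2.
rewrite (le_trans (ler_normB _ _))// normrM.
have : `|moll rho (fun y => u y + - u z) 0 x| * `|moll rho (fun y => v y + - v z) 0 x| <= s * U * (s * V).
  by rewrite ler_pM.
move: H3; move: `|moll rho G 0 x| (`|_| * `|_|) => A B; lra.
Qed.

End Sobolev.

(** * The resolvent *)

Section Resolvent.
Context {R : realType}.
Notation mu := (@lebesgue_measure R).
Implicit Types (f g u v w : R -> R) (r x z C c : R).

(* [resolvent r] inverts [1 - r^-2 d^2] on bounded functions: it is the
   convolution with [r / 2 * exp (- r |x|)]. *)
Definition resolvent r v x : R :=
  r / 2 * \int[mu]_(z in `[0, +oo[) (expR (- (r * z)) * (v (x - z) + v (x + z))).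

Lemma Rintegral_expRN r : 0 < r -> \int[mu]_(z in `[0, +oo[) expR (- (r * z)) = r^-1.
Proof.
move=> r0.
have dF (x : R) : is_derive x 1 (fun x => - r^-1 * expR (- (r * x))) (expR (- (r * x))).
  by apply: is_derive_eq; rewrite /GRing.scale/=; field; rewrite gt_eqF.
have dG (x : R) : is_derive x 1 (fun x => expR (- (r * x))) (- (r * expR (- (r * x)))).
  by apply: is_derive_eq; rewrite /GRing.scale/=; ring.
rewrite (@Rintegral_derive_itvy _ r r^-1 0 _ _ r0 dF)//.
- by rewrite mulr0 oppr0 expR0; ring.
- exact: derivable_continuous dG.
- move=> x _; rewrite subr0 normrM normrN !ger0_norm ?expR_ge0// invr_ge0 ltW//.
- exact: integrable_expRN_ge0.
Qed.

Lemma continuous_expRM r : continuous (fun z => expR (- (r * z))).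
Proof.
have dG (y : R) : is_derive y 1 (fun y => expR (- (r * y))) (- (r * expR (- (r * y)))).
  by apply: is_derive_eq; rewrite /GRing.scale/=; ring.
exact: derivable_continuous dG.
Qed.

Lemma continuous_shifts v x : continuous v ->
  continuous (fun z => v (x - z) + v (x + z)).
Proof.
move=> cv z; apply: cvgD.
  apply: (@continuous_comp _ _ _ (fun z => x - z) v); last exact: cv.
  by apply: cvgB; [exact: cvg_cst|exact: cvg_id].
apply: (@continuous_comp _ _ _ (fun z => x + z) v); last exact: cv.
by apply: cvgD; [exact: cvg_cst|exact: cvg_id].
Qed.

Lemma measurable_resolvent_kernel r v x D : continuous v ->
  measurable_fun D (fun z => expR (- (r * z)) * (v (x - z) + v (x + z))).
Proof.
move=> cv; apply: measurable_funTS; apply: continuous_measurable_fun => z.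
apply: cvgM; last exact: continuous_shifts.
exact: continuous_expRM.
Qed.

Lemma resolvent_kernel_le r v C x z : (forall x, `|v x| <= C) ->
  `|expR (- (r * z)) * (v (x - z) + v (x + z))| <= 2 * C * expR (- (r * z)).
Proof.
move=> vC; rewrite normrM ger0_norm ?expR_ge0// mulrC ler_wpM2r ?expR_ge0//.
rewrite (le_trans (ler_normD _ _))//; have := vC (x - z); have := vC (x + z); lra.
Qed.

Lemma integrable_cexpRN r C : 0 < r ->
  mu.-integrable `[0, +oo[ (EFin \o (fun z => C * expR (- (r * z)))).
Proof.
move=> r0.
exact: (@integrableZl _ _ _ mu `[0, +oo[ (measurable_itv _) C _ (integrable_expRN_ge0 r0)).
Qed.

Lemma integrable_resolvent r v C x : 0 < r -> continuous v ->
  (forall x, `|v x| <= C) ->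
  mu.-integrable `[0, +oo[
    (EFin \o (fun z => expR (- (r * z)) * (v (x - z) + v (x + z)))).
Proof.
move=> r0 cv vC.
apply: (@integrable_dominated _ _ _ (fun z => 2 * C * expR (- (r * z)))) => //.
- exact: measurable_resolvent_kernel.
- exact: integrable_cexpRN.
- by move=> z _; exact: resolvent_kernel_le.
Qed.

Lemma resolvent_bound r v C x : 0 < r -> continuous v ->
  (forall x, `|v x| <= C) -> `|resolvent r v x| <= C.
Proof.
move=> r0 cv vC; rewrite /resolvent normrM ger0_norm; last by rewrite divr_ge0// ltW.
have iv := integrable_resolvent x r0 cv vC.
have H : `|\int[mu]_(z in `[0, +oo[) (expR (- (r * z)) * (v (x - z) + v (x + z)))| <=
   2 * C * r^-1.
  rewrite (le_trans (le_normr_Rintegral _ iv))//.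
  rewrite -Rintegral_expRN// -RintegralZl//; last exact: integrable_expRN_ge0.
  apply: le_Rintegral => //.
  - exact: (integrable_norm iv).
  - exact: integrable_cexpRN.
  - by move=> z _; exact: resolvent_kernel_le.
apply: le_trans (ler_wpM2l _ H) _; first by rewrite divr_ge0// ltW.
by rewrite le_eqVlt; apply/orP; left; apply/eqP; field; rewrite gt_eqF.
Qed.

Lemma resolventD r v w C C' x : 0 < r -> continuous v -> continuous w ->
  (forall x, `|v x| <= C) -> (forall x, `|w x| <= C') ->
  resolvent r (fun y => v y + w y) x = resolvent r v x + resolvent r w x.
Proof.
move=> r0 cv cw vC wC; rewrite /resolvent -mulrDr -RintegralD//.
- by congr (_ * _); apply: eq_Rintegral => z _; ring.
- exact: integrable_resolvent vC.
- exact: integrable_resolvent wC.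
Qed.

Lemma resolventZ r v C c x : 0 < r -> continuous v -> (forall x, `|v x| <= C) ->
  resolvent r (fun y => c * v y) x = c * resolvent r v x.
Proof.
move=> r0 cv vC; rewrite /resolvent [RHS]mulrCA; congr (_ * _).
rewrite -RintegralZl//; last exact: integrable_resolvent vC.
by apply: eq_Rintegral => z _; ring.
Qed.

Lemma is_derive_resolvent_param r (V W : R -> R -> R) C C' t0 e x : 0 < r -> 0 < e ->
  (forall t, `|t - t0| < e -> continuous (V t)) ->
  (forall t y, `|t - t0| < e -> `|V t y| <= C) ->
  (forall t y, `|t - t0| < e -> is_derive t 1 (V ^~ y) (W t y)) ->
  (forall t y, `|t - t0| < e -> `|W t y| <= C') ->
  is_derive t0 1 (fun t => resolvent r (V t) x) (resolvent r (W t0) x).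
Proof.
move=> r0 e0 cV VC dV WC; rewrite /resolvent.
have := @is_derive_integral _ `[0, +oo[
  (fun t z => expR (- (r * z)) * (V t (x - z) + V t (x + z)))
  (fun t z => expR (- (r * z)) * (W t (x - z) + W t (x + z))) t0 e
  (fun z => 2 * C' * expR (- (r * z))) (measurable_itv _) e0.
move=> H; have {}H := H _ _ (integrable_cexpRN _ r0) _.
have d : is_derive t0 1 (fun t => \int[mu]_(z in `[0, +oo[)
     (expR (- (r * z)) * (V t (x - z) + V t (x + z))))
    (\int[mu]_(z in `[0, +oo[) (expR (- (r * z)) * (W t0 (x - z) + W t0 (x + z)))).
  apply: H.
  - by move=> t te; apply: (@integrable_resolvent _ _ C) => // [|y];
      [exact: cV|exact: VC].
  - move=> t z te _.
    have d1 := dV t (x - z) te; have d2 := dV t (x + z) te.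
    by apply: is_derive_eq; rewrite /GRing.scale/=; ring.
  - by move=> t z te _; apply: resolvent_kernel_le => y; exact: WC.
exact: is_deriveZ.
Qed.

Lemma is_derive_resolvent r v v' C C' x : 0 < r ->
  (forall x, is_derive x 1 v (v' x)) -> (forall x, `|v x| <= C) ->
  (forall x, `|v' x| <= C') ->
  is_derive x 1 (resolvent r v) (resolvent r v' x).
Proof.
move=> r0 dv vC v'C; have cv := derivable_continuous dv.
(* The resolvent commutes with translations, so a derivative in [x] is a derivative in the parameter
   of the translates [v (t + y)]. *)
have := @is_derive_resolvent_param r (fun t y => v (t + y)) (fun t y => v' (t + y)) C C' 0 1 x r0 ltr01.
have dt (t y : R) : is_derive t 1 (fun t => v (t + y)) (v' (t + y)).
  have d1 : is_derive t 1 (fun t : R => t + y) 1.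
    by apply: is_derive_eq; rewrite /GRing.scale/=; ring.
  by have := @is_derive1_comp _ v (fun t => t + y) t _ _ (dv (t + y)) d1; rewrite mulr1.
have ct (t : R) : continuous (fun y => v (t + y)).
  move=> y; apply: (@continuous_comp _ _ _ (fun z => t + z) v); last exact: cv.
  by apply: cvgD; [exact: cvg_cst|exact: cvg_id].
move=> /(_ (fun t _ => ct t) (fun t y _ => vC _) (fun t y _ => dt t y) (fun t y _ => v'C _)).
have E (w : R -> R) t : resolvent r (fun y => w (t + y)) x = resolvent r w (t + x).
  rewrite /resolvent; congr (_ * _); apply: eq_Rintegral => z _.
  by rewrite !addrA.
have -> : (fun t => resolvent r (fun y => v (t + y)) x) = (fun t => resolvent r v (t + x)).
  by apply/funext => t; exact: E.
rewrite E add0r => d.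
have d2 : is_derive x 1 (fun y : R => y - x) 1.
  by apply: is_derive_eq; rewrite /GRing.scale/=; ring.
have d' : is_derive (x - x) 1 (fun t => resolvent r v (t + x)) (resolvent r v' x) by rewrite subrr.
have := @is_derive1_comp _ (fun t => resolvent r v (t + x)) (fun y => y - x) x _ _ d' d2.
rewrite mulr1; have -> // : (fun t => resolvent r v (t + x)) \o (fun y => y - x) = resolvent r v.
by apply/funext => y /=; rewrite subrK.
Qed.

Lemma resolventK r v v1 v2 C0 C1 C2 x : 0 < r ->
  (forall x, is_derive x 1 v (v1 x)) -> (forall x, is_derive x 1 v1 (v2 x)) ->
  continuous v2 -> (forall x, `|v x| <= C0) -> (forall x, `|v1 x| <= C1) ->
  (forall x, `|v2 x| <= C2) ->
  resolvent r (fun y => v y - r ^- 2 * v2 y) x = v x.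
Proof.
move=> r0 dv dv1 cv2 vC vC1 vC2.
have cv := derivable_continuous dv.
have r00 : r != 0 by rewrite gt_eqF.
(* Two integrations by parts in one antiderivative: [F] is chosen so that its derivative is the
   kernel applied to [v - r^-2 v''], and [F 0 = - (2 / r) v(x)]. *)
pose F (z : R) : R := expR (- (r * z)) *
  (- r^-1 * (v (x - z) + v (x + z)) - r ^- 2 * (v1 (x + z) - v1 (x - z))).
have dF (z : R) : is_derive z 1 F (expR (- (r * z)) *
    ((v (x - z) - r ^- 2 * v2 (x - z)) + (v (x + z) - r ^- 2 * v2 (x + z)))).
  have dp : is_derive z 1 (fun z : R => x + z) 1.
    by apply: is_derive_eq; rewrite /GRing.scale/=; ring.
  have dm : is_derive z 1 (fun z : R => x - z) (-1).
    by apply: is_derive_eq; rewrite /GRing.scale/=; ring.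
  have e1 : is_derive z 1 (fun z => v (x + z)) (v1 (x + z) * 1).
    exact: (@is_derive1_comp _ v (fun z => x + z) z).
  have e2 : is_derive z 1 (fun z => v (x - z)) (v1 (x - z) * (-1)).
    exact: (@is_derive1_comp _ v (fun z => x - z) z).
  have e3 : is_derive z 1 (fun z => v1 (x + z)) (v2 (x + z) * 1).
    exact: (@is_derive1_comp _ v1 (fun z => x + z) z).
  have e4 : is_derive z 1 (fun z => v1 (x - z)) (v2 (x - z) * (-1)).
    exact: (@is_derive1_comp _ v1 (fun z => x - z) z).
  rewrite /F; apply: is_derive_eq; rewrite /GRing.scale/=; by field.
have cw : continuous (fun y => v y - r ^- 2 * v2 y).
  move=> y; apply: cvgB; first exact: cv.
  by apply: cvgM; [exact: cvg_cst|exact: cv2].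
have rV0 : 0 <= r ^- 2 by rewrite invr_ge0 exprn_ge0// ltW.
have wC y : `|v y - r ^- 2 * v2 y| <= C0 + r ^- 2 * C2.
  rewrite (le_trans (ler_normB _ _))// lerD//.
  by rewrite normrM (ger0_norm rV0) ler_wpM2l.
rewrite /resolvent (@Rintegral_derive_itvy _ r (r^-1 * (2 * C0) + r ^- 2 * (2 * C1)) 0 _ F r0)//.
- by rewrite /F !subr0 !addr0 mulr0 oppr0 expR0; field.
- move=> z; apply: cvgM; last exact: (continuous_shifts cw).
exact: continuous_expRM.
- move=> z _; rewrite subr0 /F normrM ger0_norm ?expR_ge0// mulrC ler_wpM2r ?expR_ge0//.
  rewrite (le_trans (ler_normB _ _))// lerD// normrM.
    have r10 : 0 <= r^-1 by rewrite invr_ge0 ltW.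
    rewrite normrN (ger0_norm r10); apply: ler_wpM2l => //.
    rewrite (le_trans (ler_normD _ _))//; have := vC (x - z); have := vC (x + z); lra.
  rewrite (ger0_norm rV0); apply: ler_wpM2l => //.
  rewrite (le_trans (ler_normB _ _))//; have := vC1 (x - z); have := vC1 (x + z); lra.
- exact: integrable_resolvent wC.
Qed.

End Resolvent.

(** * The energy identity *)

Section Algebra.
Context {R : realType}.
Implicit Types (a b c x y A C N : R).

(** Young's inequality in discriminant form: without square roots of the coefficients, the
    conditions on [(a, b, c)] stay polynomial. *)
Lemma young_le A C N x y : 0 <= A -> 0 <= C -> N ^+ 2 <= A * C ->
  `|N * (x * y)| <= (A * x ^+ 2 + C * y ^+ 2) / 2.
Proof.
move=> A0 C0 NAC.
have h0 : 0 <= (A * x ^+ 2 + C * y ^+ 2) / 2.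
  by rewrite divr_ge0// addr_ge0// mulr_ge0// sqr_ge0.
rewrite -ler_sqr ?nnegrE// real_normK ?num_real//.
have h1 : N ^+ 2 * (x * y) ^+ 2 <= A * C * (x * y) ^+ 2 by rewrite ler_wpM2r// sqr_ge0.
have h2 := sqr_ge0 (A * x ^+ 2 - C * y ^+ 2).
rewrite exprMn; nra.
Qed.

Lemma young_eps (nu x y : R) : 0 < nu -> `|x * y| <= (nu * x ^+ 2 + nu^-1 * y ^+ 2) / 2.
Proof.
move=> n0; rewrite -[x * y]mul1r; apply: young_le.
- exact: ltW.
- by rewrite invr_ge0 ltW.
- by rewrite mulfV ?gt_eqF// expr1n.
Qed.

Lemma abcd_param_facts a b c : abcd_parameters a b c ->
  [/\ 6^-1 < b, a + c = 3^-1 - 2 * b & a * c <= (b - 6^-1) ^+ 2].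
Proof.
move=> [b0 a0 c0 [th [_ ha hc]]]; split; [lra|lra|].
have s : a + c = 3^-1 - 2 * b by lra.
(* The sum being [2 (1/6 - b)], the product is at most the square of [1/6 - b]. *)
have := sqr_ge0 (a - c); have -> : c = 3^-1 - 2 * b - a by lra.
nra.
Qed.

(* These are the squared coefficientwise comparisons between the flux and the
   energy in the variables [f = (1 - b dx^2)^-1 u], [g = (1 - b dx^2)^-1 eta]. *)
Lemma abcd_speed_le1 a b c : abcd_parameters a b c ->
  [/\ (2 * a + 2 * c + b) ^+ 2 <= (2 * b - a) * (2 * b - c),
      (3 * (a * c)) ^+ 2 <= (b ^+ 2 - 2 * a * b) * (b ^+ 2 - 2 * c * b) &
      (a * b * c) ^+ 2 <= (- a * b ^+ 2) * (- c * b ^+ 2)].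
Proof.
move=> abc; have [b6 s m] := abcd_param_facts abc.
move: (abc) => [b0 a0 c0 [th [/andP[t0 t1] ha hc]]].
have mp : 0 < a * c by nra.
have -> : (2 * a + 2 * c + b) ^+ 2 = (3 * b - 2 / 3) ^+ 2.
  by rewrite -sqrrN; congr (_ ^+ 2); lra.
have E1 : (2 * b - a) * (2 * b - c) = 8 * b ^+ 2 - 2 / 3 * b + a * c.
  have -> : (2 * b - a) * (2 * b - c) = 4 * b ^+ 2 - 2 * b * (a + c) + a * c by ring.
  by rewrite s; field.
have E2 : (b ^+ 2 - 2 * a * b) * (b ^+ 2 - 2 * c * b) =
    b ^+ 2 * (5 * b ^+ 2 - 2 / 3 * b + 4 * (a * c)).
  have -> : (b ^+ 2 - 2 * a * b) * (b ^+ 2 - 2 * c * b) =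
    b ^+ 2 * (b ^+ 2 - 2 * b * (a + c) + 4 * (a * c)) by ring.
  by rewrite s; field.
split.
(* The claim is [b^2 - 10 b / 3 + 4/9 <= a c]. For [b <= 1/2] the left side is negative; beyond that
   [a c] needs a lower bound, which only the range of [theta^2] provides. *)
- rewrite E1; have [b12|b12] := leP b (1/2); first by nra.
  have th2 : th ^+ 2 <= 1 by nra.
  have th20 : 0 <= th ^+ 2 by rewrite sqr_ge0.
  have aE : a = 2^-1 * (th ^+ 2 - 3^-1) - b by lra.
  have cE : c = 2^-1 * (1 - th ^+ 2) - b by lra.
  rewrite aE cE; move: (th ^+ 2) th2 th20 => w w1 w0; nra.
- rewrite E2; move: (a * c) m mp => M mM M0.
  (* One factor [a c] is replaced by its upper bound. The rest is linear in [a c], hence decided at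
     0 or at [(b - 1/6)^2] according to the sign of the slope. *)
  have h : 9 * M * M <= 9 * M * (b - 6^-1) ^+ 2 by rewrite ler_wpM2l// mulr_ge0// ltW.
  have h2 : 9 * M * (b - 6^-1) ^+ 2 <= b ^+ 2 * (5 * b ^+ 2 - 2 / 3 * b + 4 * M).
    have h3 : M * (9 * (b - 6^-1) ^+ 2 - 4 * b ^+ 2) <= b ^+ 2 * (5 * b ^+ 2 - 2 / 3 * b).
      have [neg|pos] := leP (9 * (b - 6^-1) ^+ 2 - 4 * b ^+ 2) 0.
        have : M * (9 * (b - 6^-1) ^+ 2 - 4 * b ^+ 2) <= 0 by rewrite mulr_ge0_le0// ltW.
        have : 0 <= b ^+ 2 * (5 * b ^+ 2 - 2 / 3 * b).
          by rewrite mulr_ge0 ?sqr_ge0//; nra.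
        lra.
      have : M * (9 * (b - 6^-1) ^+ 2 - 4 * b ^+ 2) <=
          (b - 6^-1) ^+ 2 * (9 * (b - 6^-1) ^+ 2 - 4 * b ^+ 2) by rewrite ler_wpM2r// ltW.
      have : 3 * (b - 6^-1) ^+ 2 <= 3 * b ^+ 2 - 3^-1 * b by nra.
      move: (b - 6^-1) => z.
      have : 0 <= 3 * z ^+ 2 by rewrite mulr_ge0 ?sqr_ge0.
      nra.
    lra.
  nra.
- have M1 : a * c <= b ^+ 2 by nra.
  have -> : (a * b * c) ^+ 2 = b ^+ 2 * (a * c) * (a * c) by ring.
  have -> : (- a * b ^+ 2) * (- c * b ^+ 2) = b ^+ 2 * (a * c) * b ^+ 2 by ring.
  by rewrite ler_wpM2l// mulr_ge0 ?sqr_ge0// ltW.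
Qed.

(** Expand [(f - b f'')^2 - a (f' - b f''')^2] and replace the cross terms [f f''], [f' f'''] by
    [- f'^2], [- f''^2], to which they are equal up to exact derivatives; likewise for [g] with
    [c]. *)
Definition ediag a b c (f0 f1 f2 f3 g0 g1 g2 g3 : R) : R :=
  (f0 ^+ 2 + (2 * b - a) * f1 ^+ 2 + (b ^+ 2 - 2 * a * b) * f2 ^+ 2
     + (- a * b ^+ 2) * f3 ^+ 2 +
   (g0 ^+ 2 + (2 * b - c) * g1 ^+ 2 + (b ^+ 2 - 2 * c * b) * g2 ^+ 2
     + (- c * b ^+ 2) * g3 ^+ 2)) / 2.

Lemma flux_le_ediag a b c f0 f1 f2 f3 g0 g1 g2 g3 : abcd_parameters a b c ->
  `|f0 * g0 + - (2 * a + 2 * c + b) * (f1 * g1) + 3 * (a * c) * (f2 * g2)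
     + a * b * c * (f3 * g3)| <= ediag a b c f0 f1 f2 f3 g0 g1 g2 g3.
Proof.
move=> abc; have [h1 h2 h3] := abcd_speed_le1 abc.
move: (abc) => [b0 a0 c0 _].
have e0 : `|1 * (f0 * g0)| <= (1 * f0 ^+ 2 + 1 * g0 ^+ 2) / 2.
  by apply: young_le => //; rewrite expr1n mulr1.
have e1 := @young_le (2 * b - a) (2 * b - c) (- (2 * a + 2 * c + b)) f1 g1.
have e2 := @young_le (b ^+ 2 - 2 * a * b) (b ^+ 2 - 2 * c * b) (3 * (a * c)) f2 g2.
have e3 := @young_le (- a * b ^+ 2) (- c * b ^+ 2) (a * b * c) f3 g3.
rewrite sqrrN in e1.
have {}e1 := e1 ltac:(nra) ltac:(nra) h1.
have {}e2 := e2 ltac:(nra) ltac:(nra) h2.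
have {}e3 := e3 ltac:(nra) ltac:(nra) h3.
rewrite mul1r in e0.
rewrite (le_trans (ler_normD _ _))// /ediag.
have := ler_normD (f0 * g0 + - (2 * a + 2 * c + b) * (f1 * g1)) (3 * (a * c) * (f2 * g2)).
have := ler_normD (f0 * g0) (- (2 * a + 2 * c + b) * (f1 * g1)).
lra.
Qed.

Lemma ediag_coercive a b c : abcd_parameters a b c ->
  exists2 K : R, 1 <= K & forall f0 f1 f2 f3 g0 g1 g2 g3,
  f0 ^+ 2 + f1 ^+ 2 + f2 ^+ 2 + f3 ^+ 2 + (g0 ^+ 2 + g1 ^+ 2 + g2 ^+ 2 + g3 ^+ 2)
    <= K * ediag a b c f0 f1 f2 f3 g0 g1 g2 g3.
Proof.
move=> [b0 a0 c0 _].
have sum_le (A1 A2 A3 : R) : 0 < A1 -> 0 < A2 -> 0 < A3 ->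
    forall x0 x1 x2 x3 : R, x0 ^+ 2 + x1 ^+ 2 + x2 ^+ 2 + x3 ^+ 2 <=
    (1 + A1^-1 + A2^-1 + A3^-1) *
      (x0 ^+ 2 + A1 * x1 ^+ 2 + A2 * x2 ^+ 2 + A3 * x3 ^+ 2).
  move=> p1 p2 p3 x0 x1 x2 x3.
  have i1 : 0 < A1^-1 by rewrite invr_gt0.
  have i2 : 0 < A2^-1 by rewrite invr_gt0.
  have i3 : 0 < A3^-1 by rewrite invr_gt0.
  set S := x0 ^+ 2 + A1 * x1 ^+ 2 + A2 * x2 ^+ 2 + A3 * x3 ^+ 2.
  have q0 := sqr_ge0 x0.
  have q1 : 0 <= A1 * x1 ^+ 2 by rewrite mulr_ge0 ?sqr_ge0// ltW.
  have q2 : 0 <= A2 * x2 ^+ 2 by rewrite mulr_ge0 ?sqr_ge0// ltW.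
  have q3 : 0 <= A3 * x3 ^+ 2 by rewrite mulr_ge0 ?sqr_ge0// ltW.
  have r1 : x1 ^+ 2 <= A1^-1 * S by rewrite ler_pdivlMl// /S; lra.
  have r2 : x2 ^+ 2 <= A2^-1 * S by rewrite ler_pdivlMl// /S; lra.
  have r3 : x3 ^+ 2 <= A3^-1 * S by rewrite ler_pdivlMl// /S; lra.
  have r0 : x0 ^+ 2 <= S by rewrite /S; lra.
  rewrite !mulrDl mul1r; lra.
have a1 : 0 < 2 * b - a by lra.
have a2 : 0 < b ^+ 2 - 2 * a * b by nra.
have a3 : 0 < - a * b ^+ 2 by rewrite mulr_gt0 ?oppr_gt0 ?exprn_gt0.
have c1 : 0 < 2 * b - c by lra.
have c2 : 0 < b ^+ 2 - 2 * c * b by nra.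
have c3 : 0 < - c * b ^+ 2 by rewrite mulr_gt0 ?oppr_gt0 ?exprn_gt0.
have sa := sum_le _ _ _ a1 a2 a3; have sc := sum_le _ _ _ c1 c2 c3.
pose KA := 1 + (2 * b - a)^-1 + (b ^+ 2 - 2 * a * b)^-1 + (- a * b ^+ 2)^-1.
pose KC := 1 + (2 * b - c)^-1 + (b ^+ 2 - 2 * c * b)^-1 + (- c * b ^+ 2)^-1.
rewrite -/KA in sa; rewrite -/KC in sc.
have KA1 : 1 <= KA by rewrite /KA -!addrA lerDl !addr_ge0// invr_ge0 ltW.
have KC1 : 1 <= KC by rewrite /KC -!addrA lerDl !addr_ge0// invr_ge0 ltW.
exists (2 * (KA + KC)); first lra.
move=> f0 f1 f2 f3 g0 g1 g2 g3.
have := sa f0 f1 f2 f3; have := sc g0 g1 g2 g3; rewrite /ediag.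
set SA := f0 ^+ 2 + (2 * b - a) * f1 ^+ 2 + _ + _.
set SC := g0 ^+ 2 + (2 * b - c) * g1 ^+ 2 + _ + _.
have A0 : 0 <= SA by rewrite !addr_ge0 ?sqr_ge0// mulr_ge0 ?sqr_ge0// ltW.
have C0 : 0 <= SC by rewrite !addr_ge0 ?sqr_ge0// mulr_ge0 ?sqr_ge0// ltW.
move: (f0 ^+ 2 + _) (g0 ^+ 2 + _) => FF GG; nra.
Qed.


(* The energy density is [ediag] plus the derivative of [energy_corr]; the
   linear flux is the quadratic form of [flux_le_ediag] plus the derivative of
   [flux_corr]. *)
Definition energy_corr a b c (f0 f1 f2 g0 g1 g2 : R) : R :=
  - b * (f0 * f1) + a * b * (f1 * f2) - b * (g0 * g1) + b * c * (g1 * g2).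

Definition flux_corr a c (f0 f1 f2 g0 g1 g2 : R) : R :=
  c * (f0 * g1) + a * (f1 * g0) - a * c * (f1 * g2 + f2 * g1).

(* The bounds under which the lower order terms of the energy identity are absorbed by [ediag]. *)
Definition ediag_dominates a b c K := forall f0 f1 f2 f3 g0 g1 g2 g3,
  let E := ediag a b c f0 f1 f2 f3 g0 g1 g2 g3 in
  [/\ 0 <= E, `|energy_corr a b c f0 f1 f2 g0 g1 g2| <= K * E,
    `|flux_corr a c f0 f1 f2 g0 g1 g2| <= K * E,
    (f0 - b * f2) ^+ 2 <= K * E /\ (g0 - b * g2) ^+ 2 <= K * E &
    [/\ (f1 - b * f3) ^+ 2 <= K * E, (g1 - b * g3) ^+ 2 <= K * E,
    (f0 + a * f2) ^+ 2 <= K * E /\ (f1 + a * f3) ^+ 2 <= K * E &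
    (g0 + c * g2) ^+ 2 <= K * E /\ (g1 + c * g3) ^+ 2 <= K * E]].

Lemma ediag_bounds a b c : abcd_parameters a b c ->
  exists2 K : R, 1 <= K & ediag_dominates a b c K.
Proof.
move=> abc; have [K K1 HK] := ediag_coercive abc; move: abc => [b0 a0 c0 _].
(* A sum of nonnegative terms that exceeds the constant required by each of the bounds
   separately. *)
pose w := 2 + 2 * b ^+ 2 + 2 * a ^+ 2 + 2 * c ^+ 2 + 2 * (b - a * b - b * c) + 2 * (a * c - a - c).
have ab : a * b <= 0 by rewrite mulr_le0_ge0// ltW.
have bc : b * c <= 0 by rewrite mulr_ge0_le0// ltW.
have ac : 0 <= a * c by rewrite mulr_le0// ltW.
have a2 := sqr_ge0 a; have b2 := sqr_ge0 b; have c2 := sqr_ge0 c.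
have wa : 2 + 2 * a ^+ 2 <= w by rewrite /w; lra.
have wb : 2 + 2 * b ^+ 2 <= w by rewrite /w; lra.
have wc : 2 + 2 * c ^+ 2 <= w by rewrite /w; lra.
have kY : 0 <= b - a * b - b * c + b by lra.
have wY : b - a * b - b * c + b <= w by rewrite /w; lra.
have kX : 0 <= 2 * (a * c) - a - c by lra.
have wX : 2 * (a * c) - a - c <= w by rewrite /w; lra.
have w1 : 1 <= w by lra.
have ab' : 0 <= - (a * b) by rewrite oppr_ge0.
have bc' : 0 <= - (b * c) by rewrite oppr_ge0.
have a' : 0 <= - a by rewrite oppr_ge0 ltW.
have c' : 0 <= - c by rewrite oppr_ge0 ltW.
exists (w * K); first exact: mulr_ege1.
clearbody w.
move=> f0 f1 f2 f3 g0 g1 g2 g3 E.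
have := HK f0 f1 f2 f3 g0 g1 g2 g3; rewrite -/E.
set S := (X in X <= _) => SE.
have f00 := sqr_ge0 f0; have f10 := sqr_ge0 f1; have f20 := sqr_ge0 f2.
have f30 := sqr_ge0 f3; have g00 := sqr_ge0 g0; have g10 := sqr_ge0 g1.
have g20 := sqr_ge0 g2; have g30 := sqr_ge0 g3.
have S0 : 0 <= S by rewrite /S; lra.
have E0 : 0 <= E by rewrite -(pmulr_rge0 _ (lt_le_trans ltr01 K1)) (le_trans S0).
have y (x z : R) : `|x * z| <= (x ^+ 2 + z ^+ 2) / 2.
  by have := @young_le 1 1 1 x z; rewrite !mul1r expr1n; apply; rewrite ?ler01.
have xz (x z : R) : x ^+ 2 + z ^+ 2 <= S -> `|x * z| <= S.
  by move=> H; apply: le_trans (y x z) _; have := sqr_ge0 x; have := sqr_ge0 z; lra.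
have big (k X : R) : X <= k * S -> 0 <= k -> k <= w -> X <= w * K * E.
  move=> Xk k0 kw; apply: (le_trans Xk); rewrite -mulrA.
  by apply: ler_pM => //; rewrite ltW.
have sq (k x z : R) : x ^+ 2 + z ^+ 2 <= S -> 2 + 2 * k ^+ 2 <= w ->
    (x + k * z) ^+ 2 <= w * K * E.
  move=> H kw; apply: (big (2 + 2 * k ^+ 2)) => //; last first.
    by have := sqr_ge0 k; lra.
  have h1 := sqr_ge0 (x - k * z); have h2 := sqr_ge0 x; have h3 := sqr_ge0 z.
  have h4 := sqr_ge0 k.
  have : (x + k * z) ^+ 2 <= 2 * x ^+ 2 + 2 * k ^+ 2 * z ^+ 2 by nra.
  have : 2 * x ^+ 2 <= 2 * S by lra.
  have : 2 * k ^+ 2 * z ^+ 2 <= 2 * k ^+ 2 * S.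
    by apply: ler_wpM2l; [rewrite mulr_ge0|move: H h2; clear; lra].
  lra.
have nM (k x : R) : `|k * x| = `|k| * `|x| by rewrite normrM.
have tri4 (x1 x2 x3 x4 : R) : `|x1 + x2 + x3 + x4| <= `|x1| + `|x2| + `|x3| + `|x4|.
  rewrite (le_trans (ler_normD _ _))// lerD2r (le_trans (ler_normD _ _))// lerD2r.
  exact: ler_normD.
split => //.
- apply: (big (b - a * b - b * c + b)) => //.
  rewrite /energy_corr (le_trans (tri4 _ _ (- (b * (g0 * g1))) _))//.
  rewrite (nM (- b)) (nM (a * b)) (nM (b * c)) (normrN (b * _)) (nM b).
  rewrite (ler0_norm ab) (ler0_norm bc) normrN (gtr0_norm b0).
  have h1 : `|f0 * f1| <= S by apply: xz; (rewrite /S; move: f00 f10 f20 f30 g00 g10 g20 g30; clear; lra).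
  have h2 : `|f1 * f2| <= S by apply: xz; (rewrite /S; move: f00 f10 f20 f30 g00 g10 g20 g30; clear; lra).
  have h3 : `|g0 * g1| <= S by apply: xz; (rewrite /S; move: f00 f10 f20 f30 g00 g10 g20 g30; clear; lra).
  have h4 : `|g1 * g2| <= S by apply: xz; (rewrite /S; move: f00 f10 f20 f30 g00 g10 g20 g30; clear; lra).
  have := ler_wpM2l (ltW b0) h1; have := ler_wpM2l (ltW b0) h3.
  have := ler_wpM2l ab' h2; have := ler_wpM2l bc' h4.
  by clear; lra.
- apply: (big (2 * (a * c) - a - c)) => //.
  have -> : flux_corr a c f0 f1 f2 g0 g1 g2 =
    c * (f0 * g1) + a * (f1 * g0) + - (a * c) * (f1 * g2) + - (a * c) * (f2 * g1).
    by rewrite /flux_corr; ring.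
  rewrite (le_trans (tri4 _ _ _ _))// (nM c) (nM a) !(nM (- (a * c))).
  rewrite normrN (ger0_norm ac) (ltr0_norm a0) (ltr0_norm c0).
  have h1 : `|f0 * g1| <= S by apply: xz; (rewrite /S; move: f00 f10 f20 f30 g00 g10 g20 g30; clear; lra).
  have h2 : `|f1 * g0| <= S by apply: xz; (rewrite /S; move: f00 f10 f20 f30 g00 g10 g20 g30; clear; lra).
  have h3 : `|f1 * g2| <= S by apply: xz; (rewrite /S; move: f00 f10 f20 f30 g00 g10 g20 g30; clear; lra).
  have h4 : `|f2 * g1| <= S by apply: xz; (rewrite /S; move: f00 f10 f20 f30 g00 g10 g20 g30; clear; lra).
  have := ler_wpM2l c' h1; have := ler_wpM2l a' h2.
  have := ler_wpM2l ac h3; have := ler_wpM2l ac h4.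
  by clear; lra.
- by split; rewrite -mulNr; apply: sq; rewrite ?sqrrN//; (rewrite /S; move: f00 f10 f20 f30 g00 g10 g20 g30; clear; lra).
- by split; [rewrite -mulNr; apply: sq; rewrite ?sqrrN//; (rewrite /S; move: f00 f10 f20 f30 g00 g10 g20 g30; clear; lra)..
    |split; apply: sq => //; (rewrite /S; move: f00 f10 f20 f30 g00 g10 g20 g30; clear; lra)|split; apply: sq => //; (rewrite /S; move: f00 f10 f20 f30 g00 g10 g20 g30; clear; lra)].
Qed.

End Algebra.

(** * The pointwise inequality between flux and energy *)

Section EnergyFlux.
Context {R : realType}.
Implicit Types (a b c : R).

(** Expand [(n - b n'')^2] with [n n'' = (n n')' - n'^2]. The last term on the right is the exact
    derivative of [4 b tau n n']; the part with [taux] is absorbed because [tau] varies on the scale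
    [L]. *)
Lemma resolvent_weight b L (tau taux n0 n1 n2 : R) : 0 < b -> 0 <= tau ->
  6 * b + 3 <= L -> `|taux| <= 3 * tau / L ->
  tau * (n0 ^+ 2 + 2 * b * n1 ^+ 2) <= 2 * tau * (n0 - b * n2) ^+ 2 +
    4 * b * (taux * (n0 * n1) + tau * (n1 ^+ 2 + n0 * n2)).
Proof.
move=> b0 t0 L0 tx.
have Lp : 0 < L by apply: lt_le_trans L0; rewrite addr_gt0// mulr_gt0.
have txL : `|taux| * L <= 3 * tau by rewrite -ler_pdivlMr.
have h : - (4 * b * (taux * (n0 * n1))) <= tau * (n0 ^+ 2 + 2 * b * n1 ^+ 2).
  have : `|4 * b * (taux * (n0 * n1))| <= tau * (n0 ^+ 2 + 2 * b * n1 ^+ 2); last first.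
    by rewrite ler_norml => /andP[+ _]; lra.
  rewrite !normrM (ger0_norm (ltW b0)) ger0_norm//.
  (* [12 b |n0 n1| <= 6 b n0^2 + 6 b n1^2]: the first term is paid by the [6 b] in [L], the second
     by [3] times [2 b n1^2]. *)
  have y0 : `|n0| * `|n1| * (4 * b * 3) <= L * (n0 ^+ 2 + 2 * b * n1 ^+ 2).
    have := sqr_ge0 (`|n0| - `|n1|).
    have e0 : `|n0| ^+ 2 = n0 ^+ 2 by rewrite real_normK// num_real.
    have e1 : `|n1| ^+ 2 = n1 ^+ 2 by rewrite real_normK// num_real.
    rewrite -e0 -e1; have := sqr_ge0 `|n0|; have := sqr_ge0 `|n1|.
    move: `|n0| `|n1| => x y y0 x0 xy {e0 e1 txL tx}.
    have S0 : 0 <= x ^+ 2 + 2 * b * y ^+ 2 by rewrite addr_ge0// mulr_ge0//; lra.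
    have k1 := ler_wpM2r S0 L0.
    have k2 : 0 <= 6 * b * (x - y) ^+ 2 by rewrite mulr_ge0//; lra.
    have k3 : 0 <= 12 * b ^+ 2 * y ^+ 2 by rewrite mulr_ge0// mulr_ge0// sqr_ge0.
    lra.
  have nn0 : 0 <= `|n0| * `|n1| by rewrite mulr_ge0.
  rewrite -(ler_pM2l Lp).
  have : 4 * b * (`|n0| * `|n1|) * (`|taux| * L) <= 4 * b * (`|n0| * `|n1|) * (3 * tau).
    by rewrite ler_wpM2l// mulr_ge0//; lra.
  have : tau * (`|n0| * `|n1| * (4 * b * 3)) <= tau * (L * (n0 ^+ 2 + 2 * b * n1 ^+ 2)).
    by rewrite ler_wpM2l.
  lra.
have h2 : 0 <= tau * b ^+ 2 * n2 ^+ 2 by rewrite mulr_ge0 ?sqr_ge0// mulr_ge0// sqr_ge0.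
lra.
Qed.

(** Every product has a factor [n] or [m]. Young's inequality with parameter [nu] keeps the linear
    factor at cost [nu * E] and puts [nu^-1] on the nonlinear one, which is quadratically small in
    the solution. *)
Lemma nonlinear_flux a b c nu (E p0 p1 q0 q1 U1 H1 n0 n1 m0 m1 : R) :
  a < 0 -> 0 < b -> c < 0 -> 0 < nu <= 1 -> 0 <= E ->
  p0 ^+ 2 <= E -> p1 ^+ 2 <= E -> q0 ^+ 2 <= E -> q1 ^+ 2 <= E ->
  U1 ^+ 2 <= E -> H1 ^+ 2 <= E ->
  `|p0 * m0 + n0 * q0 + n0 * m0 - b * (p1 * m1 + n1 * q1 + n1 * m1)
     - a * (U1 * m1) - c * (H1 * n1)| <=
  (1 + b - a - c) * (nu * E + nu^-1 * (n0 ^+ 2 + n1 ^+ 2 + m0 ^+ 2 + m1 ^+ 2)).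
Proof.
move=> a0 b0 c0 /andP[nu0 nu1] E0 hp0 hp1 hq0 hq1 hU hH.
have nV : 1 <= nu^-1 by rewrite invf_ge1.
set N := n0 ^+ 2 + _ + _ + _.
have sn0 := sqr_ge0 n0; have sn1 := sqr_ge0 n1.
have sm0 := sqr_ge0 m0; have sm1 := sqr_ge0 m1.
have yl (x z : R) : x ^+ 2 <= E -> `|x * z| <= (nu * E + nu^-1 * z ^+ 2) / 2.
  move=> xE; apply: (le_trans (young_eps x z nu0)).
  by have := ler_wpM2l (ltW nu0) xE; lra.
have yn (x z : R) : `|x * z| <= nu^-1 * (x ^+ 2 + z ^+ 2) / 2.
  have h := young_eps x z (@ltr01 R); rewrite invr1 !mul1r in h.
  apply: (le_trans h); have := sqr_ge0 x; have := sqr_ge0 z => hz hx.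
  have := ler_wpM2r (addr_ge0 hx hz) nV; lra.
have nE : 0 <= nu * E by rewrite mulr_ge0// ltW.
have nN (x : R) : 0 <= x ^+ 2 -> 0 <= nu^-1 * x ^+ 2 by move=> hx; rewrite mulr_ge0//; lra.
have i1 := yl p0 m0 hp0; have i2 := yl q0 n0 hq0; have i3 := yn n0 m0.
have i4 := yl p1 m1 hp1; have i5 := yl q1 n1 hq1; have i6 := yn n1 m1.
have i7 := yl U1 m1 hU; have i8 := yl H1 n1 hH.
have j1 := nN n0 sn0; have j2 := nN n1 sn1; have j3 := nN m0 sm0; have j4 := nN m1 sm1.
have A1 : `|p0 * m0 + n0 * q0 + n0 * m0| <= nu * E + nu^-1 * N.
  rewrite (le_trans (ler_normD _ _))// (mulrC n0 q0).
  have := ler_normD (p0 * m0) (q0 * n0); rewrite /N; lra.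
have A2 : `|p1 * m1 + n1 * q1 + n1 * m1| <= nu * E + nu^-1 * N.
  rewrite (le_trans (ler_normD _ _))// (mulrC n1 q1).
  have := ler_normD (p1 * m1) (q1 * n1); rewrite /N; lra.
have A3 : `|U1 * m1| <= nu * E + nu^-1 * N by rewrite /N; lra.
have A4 : `|H1 * n1| <= nu * E + nu^-1 * N by rewrite /N; lra.
move: A1 A2 A3 A4; move: (nu * E + nu^-1 * N) => M.
move: (p0 * m0 + _ + _) (p1 * m1 + _ + _) (U1 * m1) (H1 * n1) => x1 x2 x3 x4 A1 A2 A3 A4.
have -> : x1 - b * x2 - a * x3 - c * x4 = x1 + (- b * x2 + (- a * x3 + - c * x4)) by ring.
rewrite (le_trans (ler_normD _ _))//.
have := ler_normD (- b * x2) (- a * x3 + - c * x4).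
have := ler_normD (- a * x3) (- c * x4).
have a0' : 0 <= - a by rewrite oppr_ge0 ltW.
have c0' : 0 <= - c by rewrite oppr_ge0 ltW.
rewrite !normrM (normrN b) (gtr0_norm b0) (ger0_norm a0') (ger0_norm c0').
have := ler_wpM2l (ltW b0) A2; have := ler_wpM2l a0' A3; have := ler_wpM2l c0' A4.
by move: A1; clear; lra.
Qed.

Definition energy_density a c (U U1 H H1 : R) : R :=
  (U ^+ 2 + H ^+ 2 - a * U1 ^+ 2 - c * H1 ^+ 2 + U ^+ 2 * H) / 2.

(** The flux with reversed sign: without mollification the time derivative of [energy_density] is
    the x-derivative of this. Since [p0], [q0] already contain the nonlinear potentials, no cubic
    term has to be added. *)
Definition energy_flux a b c (p0 p1 q0 q1 U1 H1 : R) : R :=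
  - (p0 * q0) + b * (p1 * q1) + a * (U1 * q1) + c * (H1 * p1).

(** With indices read as derivatives, the right-hand side is the exact x-derivative of [psi * flux +
    psix * X - sigma * tau * Y + 4 b kappa tau (n n' + m m')], plus two error terms due to the
    commutators [r1], [r2]. The budget [sigma] in the hypothesis on the coefficients pays, in order,
    for the linear flux, the flux terms with a nonlinear factor, the cubic part of the energy, the
    slope of the weight against [X] and [Y], and the squares of the nonlinear terms. *)
Lemma energy_pointwise a b c (K sigma L eps nu rho : R)
   (psi psit psix psixx tau taux f0 f1 f2 f3 f4 g0 g1 g2 g3 g4 n0 n1 n2 m0 m1 m2 : R) :
  abcd_parameters a b c ->
  let E := ediag a b c f0 f1 f2 f3 g0 g1 g2 g3 in
  let Y := energy_corr a b c f0 f1 f2 g0 g1 g2 in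
  let X := flux_corr a c f0 f1 f2 g0 g1 g2 in
  let U := f0 - b * f2 in let U1 := f1 - b * f3 in let U2 := f2 - b * f4 in
  let H := g0 - b * g2 in let H1 := g1 - b * g3 in let H2 := g2 - b * g4 in
  let p0 := f0 + a * f2 + n0 in let p1 := f1 + a * f3 + n1 in
  let p2 := f2 + a * f4 + n2 in
  let q0 := g0 + c * g2 + m0 in let q1 := g1 + c * g3 + m1 in
  let q2 := g2 + c * g4 + m2 in
  let r1 := n0 - b * n2 - U * H in let r2 := m0 - b * m2 - U ^+ 2 / 2 in
  let kappa := (1 + b - a - c) / nu * (1 + (2 * b)^-1) in
  0 <= E -> `|Y| <= K * E -> `|X| <= K * E -> U ^+ 2 <= K * E ->
  U1 ^+ 2 <= K * E -> H1 ^+ 2 <= K * E ->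
  (f0 + a * f2) ^+ 2 <= K * E -> (f1 + a * f3) ^+ 2 <= K * E ->
  (g0 + c * g2) ^+ 2 <= K * E -> (g1 + c * g3) ^+ 2 <= K * E ->
  1 <= K -> 0 <= sigma -> 0 < eps -> 0 < nu <= 1 -> 6 * b + 3 <= L ->
  1 + (1 + b - a - c) * nu * K + sigma * eps * K / 2 + 3 * (1 + sigma) * K / L +
    5 * kappa * eps ^+ 2 * K <= sigma ->
  0 <= psi -> 0 <= tau -> psit = - (sigma * tau) -> `|psix| <= tau ->
  `|psixx| <= 3 * tau / L -> `|taux| <= 3 * tau / L ->
  `|U| <= eps -> `|H| <= eps -> `|r1| <= rho -> `|r2| <= rho ->
  psit * energy_density a c U U1 H H1 +
  psi * (- (U * q1) - H * p1 + a * (U1 * q2) + c * (H1 * p2) - U * H * q1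
         - U ^+ 2 / 2 * p1) <=
  (psix * energy_flux a b c p0 p1 q0 q1 U1 H1 +
   psi * (- (p1 * q0 + p0 * q1) + b * (p2 * q1 + p1 * q2) + a * (U2 * q1 + U1 * q2)
          + c * (H2 * p1 + H1 * p2))) +
  (psixx * X + psix * (c * (f1 * g1 + f0 * g2) + a * (f2 * g0 + f1 * g1)
      - a * c * (f2 * g2 + f1 * g3 + (f3 * g1 + f2 * g2)))) -
  sigma * (taux * Y + tau * (- b * (f1 * f1 + f0 * f2) + a * b * (f2 * f2 + f1 * f3)
      - b * (g1 * g1 + g0 * g2) + b * c * (g2 * g2 + g1 * g3))) +
  4 * b * kappa * (taux * (n0 * n1 + m0 * m1) +
      tau * (n1 ^+ 2 + n0 * n2 + (m1 ^+ 2 + m0 * m2))) +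
  8 * kappa * tau * rho ^+ 2 + psi * rho * (`|p1| + `|q1|).
Proof.
move=> abc E Y X U U1 U2 H H1 H2 p0 p1 p2 q0 q1 q2 r1 r2 kappa.
move=> E0 hY hX hU hU1 hH1 hp0 hp1 hq0 hq1 K1 s0 e0 nu01 L0 coef.
move=> psi0 tau0 psitE hpx hpxx htx Ue He hr1 hr2.
have [b0 a0 c0 _] := abc; have /andP[nu0 nu1] := nu01.
have Lp : 0 < L by apply: lt_le_trans L0; rewrite addr_gt0// mulr_gt0.
have KE0 : 0 <= K * E by rewrite mulr_ge0// (le_trans ler01).
pose F0 := f0 * g0 + - (2 * a + 2 * c + b) * (f1 * g1) + 3 * (a * c) * (f2 * g2)
     + a * b * c * (f3 * g3).
pose Fn := (f0 + a * f2) * m0 + n0 * (g0 + c * g2) + n0 * m0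
   - b * ((f1 + a * f3) * m1 + n1 * (g1 + c * g3) + n1 * m1) - a * (U1 * m1) - c * (H1 * n1).
pose N := n0 ^+ 2 + n1 ^+ 2 + m0 ^+ 2 + m1 ^+ 2.
pose w := 1 + b - a - c.
have w0 : 0 <= w by rewrite /w; move: b0 a0 c0; clear; lra.
have hF0 : `|F0| <= E by exact: flux_le_ediag.
have hFn : `|Fn| <= w * (nu * (K * E) + nu^-1 * N).
  exact: (nonlinear_flux n0 n1 m0 m1 a0 b0 c0 nu01 KE0 hp0 hp1 hq0 hq1 hU1 hH1).
have nV0 : 0 <= nu^-1 by rewrite invr_ge0 ltW.
have bV0 : 0 <= (2 * b)^-1 by rewrite invr_ge0 mulr_ge0// ltW.
have kap0 : 0 <= kappa by apply: mulr_ge0; [exact: mulr_ge0 w0 nV0|exact: addr_ge0].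
have mulle (x y z : R) : `|x| <= y -> `|z| <= tau -> z * x <= tau * y.
  move=> xy zt; rewrite (le_trans (ler_norm _))// normrM ler_pM//.
have B2 : psix * F0 <= tau * E by exact: mulle.
have B3 : psix * Fn <= tau * (w * (nu * (K * E) + nu^-1 * N)) by exact: mulle.
have mulle3 (x z : R) : `|x| <= K * E -> `|z| <= 3 * tau / L ->
    `|z * x| <= 3 * K / L * (tau * E).
  move=> xy zt; rewrite normrM.
  have -> : 3 * K / L * (tau * E) = 3 * tau / L * (K * E) by ring.
  by rewrite ler_pM.
have B4 : `|psixx * X| <= 3 * K / L * (tau * E) by exact: mulle3.
have B5 : `|taux * Y| <= 3 * K / L * (tau * E) by exact: mulle3.
have B1 : - (sigma * tau * (U ^+ 2 * H) / 2) <= sigma * eps * K / 2 * (tau * E).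
  have : - (U ^+ 2 * H) <= K * E * eps.
    rewrite -mulrN; apply: (@le_trans _ _ (U ^+ 2 * eps)).
      rewrite ler_wpM2l ?sqr_ge0// (le_trans _ He)// -normrN ler_norm//.
    by rewrite ler_wpM2r// ltW.
  have st : 0 <= sigma * tau by rewrite mulr_ge0.
  move=> /(ler_wpM2l st); clear; lra.
(* [resolvent_weight] exchanges the squares of the potentials for those of [n - b n''] and
   [m - b m''], which are [U H] and [U^2 / 2] up to commutators. *)
have B6 : tau * (w * (nu^-1 * N)) <= 2 * kappa * tau * ((n0 - b * n2) ^+ 2 + (m0 - b * m2) ^+ 2)
   + 4 * b * kappa * (taux * (n0 * n1 + m0 * m1) +
      tau * (n1 ^+ 2 + n0 * n2 + (m1 ^+ 2 + m0 * m2))).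
  have W1 := resolvent_weight n0 n1 n2 b0 tau0 L0 htx.
  have W2 := resolvent_weight m0 m1 m2 b0 tau0 L0 htx.
  have NK : N <= (1 + (2 * b)^-1) * ((n0 ^+ 2 + 2 * b * n1 ^+ 2) + (m0 ^+ 2 + 2 * b * m1 ^+ 2)).
    have k1 (x y : R) : x ^+ 2 + y ^+ 2 <= (1 + (2 * b)^-1) * (x ^+ 2 + 2 * b * y ^+ 2).
      have -> : (1 + (2 * b)^-1) * (x ^+ 2 + 2 * b * y ^+ 2) =
         x ^+ 2 + y ^+ 2 + (2 * b * y ^+ 2 + (2 * b)^-1 * x ^+ 2).
        by field; rewrite gt_eqF.
      by rewrite lerDl addr_ge0// mulr_ge0 ?sqr_ge0// mulr_ge0// ltW.
    have := k1 n0 n1; have := k1 m0 m1; rewrite /N; clear; lra.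
  have wt0 : 0 <= tau * (w * nu^-1) by rewrite !mulr_ge0.
  have := ler_wpM2l wt0 NK; have := ler_wpM2l kap0 W1; have := ler_wpM2l kap0 W2.
  rewrite /kappa -/w; clear; lra.
(* By [(x + y)^2 <= 2 x^2 + 2 y^2], the products contribute [2 + 1/2] times [eps^2 K E]; multiplied
   by [2 kappa] this is the coefficient [5 kappa] of the budget, and [4 rho^2] becomes
   [8 kappa rho^2]. *)
have S12 : (n0 - b * n2) ^+ 2 + (m0 - b * m2) ^+ 2 <= 4 * rho ^+ 2 + 5 / 2 * eps ^+ 2 * (K * E).
  have s1E : n0 - b * n2 = r1 + U * H by rewrite /r1; ring.
  have s2E : m0 - b * m2 = r2 + U ^+ 2 / 2 by rewrite /r2; ring.
  rewrite s1E s2E.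
  have sq (x y : R) : `|x| <= y -> x ^+ 2 <= y ^+ 2.
    by move=> xy; rewrite -(real_normK (num_real x)) lerXn2r ?nnegrE// (le_trans _ xy).
  have k1 := sq _ _ hr1; have k2 := sq _ _ hr2; have k3 := sq _ _ Ue; have k4 := sq _ _ He.
  have U0 := sqr_ge0 U.
  have k5 : U ^+ 2 * H ^+ 2 <= K * E * eps ^+ 2 by rewrite ler_pM ?sqr_ge0.
  have k6 : U ^+ 2 * U ^+ 2 <= K * E * eps ^+ 2 by rewrite ler_pM ?sqr_ge0.
  have k7 := sqr_ge0 (r1 - U * H); have k8 := sqr_ge0 (r2 - U ^+ 2 / 2).
  move: k1 k2 k3 k4 U0 k5 k6 k7 k8; clear; lra.
have err : psi * (r1 * q1 + r2 * p1) <= psi * rho * (`|p1| + `|q1|).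
  rewrite -mulrA ler_wpM2l//.
  have h1 : r1 * q1 <= rho * `|q1|.
    by rewrite (le_trans (ler_norm _))// normrM ler_wpM2r.
  have h2 : r2 * p1 <= rho * `|p1|.
    by rewrite (le_trans (ler_norm _))// normrM ler_wpM2r.
  move: h1 h2; clear; lra.
have coefE := ler_wpM2r (mulr_ge0 tau0 E0) coef.
have kS := ler_wpM2l (mulr_ge0 (mulr_ge0 (ler0n R 2) kap0) tau0) S12.
have B4' : - (psixx * X) <= 3 * K / L * (tau * E) by rewrite (le_trans _ B4)// -normrN ler_norm.
have B5' : sigma * (taux * Y) <= sigma * (3 * K / L * (tau * E)).
  by rewrite ler_wpM2l// (le_trans _ B5)// ler_norm.
rewrite psitE.
rewrite -subr_ge0.
have -> : forall l r : R, r - l = r - l by [].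
set R0 := 8 * kappa * tau * rho ^+ 2.
set R1 := psi * rho * _.
set Gd := 4 * b * kappa * _.
(* What is left once all exact derivatives of the right-hand side are moved to the left. *)
pose total := - (sigma * tau * E) - sigma * tau * (U ^+ 2 * H) / 2 + psix * F0 + psix * Fn
   - psixx * X + sigma * (taux * Y) + psi * (r1 * q1 + r2 * p1) - Gd.
suff T : total <= R0 + R1.
  rewrite [X in 0 <= X](_ : _ = R0 + R1 - total) ?subr_ge0//.
  rewrite /total /F0 /Fn /energy_density /energy_flux /r1 /r2 /q0 /q1 /q2 /p0 /p1 /p2
    /X /Y /E /U /U1 /U2 /H /H1 /H2 /ediag /energy_corr /flux_corr.
  by field.
rewrite /total.
move: B1 B2 B3 B4' B5' B6 err coefE kS; rewrite -/Gd -/R1.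
have -> : tau * (w * (nu * (K * E) + nu^-1 * N)) = w * nu * K * (tau * E) + tau * (w * (nu^-1 * N)) by ring.
rewrite -/w /R0; clear; lra.
Qed.

End EnergyFlux.

(** * The weight *)

Section Weight.
Context {R : realType}.
Notation mu := (@lebesgue_measure R).
Implicit Types (k s y z t x : R).

Lemma is_derive_inv (f : R -> R) (x f' : R) : f x != 0 -> is_derive x 1 f f' ->
  is_derive x 1 (fun z => (f z)^-1) (- f' * (f x)^-1 ^+ 2).
Proof.
move=> fx [df <-]; apply: DeriveDef; first exact: derivableV.
by rewrite deriveV// /GRing.scale/= exprVn mulrC mulrN mulNr.
Qed.

Variables (k s y z : R).
Hypotheses (k0 : 0 < k) (s0 : 0 <= s).

Let A t x := expR (k * (y + s * t - x)).
Let C t x := expR (k * (x - z + s * t)).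

(* Decreasing in time along both of its fronts [x = y + s t], [x = z - s t]. *)
Definition weight t x : R :=
  (1 + expR (k * (y + s * t - x)) + expR (k * (x - z + s * t)))^-1.
Definition weight_x t x : R := k * weight t x ^+ 2 *
  (expR (k * (y + s * t - x)) - expR (k * (x - z + s * t))).
(** Minus the time derivative of the weight divided by [s]. It differs from [weight_x] only in the
    sign between the exponentials and therefore dominates it; it plays the role of [tau] in
    [energy_pointwise]. *)
Definition weight_front t x : R := k * weight t x ^+ 2 *
  (expR (k * (y + s * t - x)) + expR (k * (x - z + s * t))).
Definition weight_xx t x : R := k ^+ 2 * weight t x ^+ 2 *
  (2 * weight t x * (A t x - C t x) ^+ 2 - (A t x + C t x)).
Definition weight_front_x t x : R := k ^+ 2 * weight t x ^+ 2 *
  (A t x - C t x) * (2 * weight t x * (A t x + C t x) - 1).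

Let A0 t x : 0 < A t x. Proof. exact: expR_gt0. Qed.
Let C0 t x : 0 < C t x. Proof. exact: expR_gt0. Qed.
Let den_gt0 t x : 0 < 1 + A t x + C t x.
Proof. by rewrite !addr_gt0. Qed.
Let den_neq0 t x : 1 + A t x + C t x != 0.
Proof. by rewrite gt_eqF. Qed.

Lemma weight_gt0 t x : 0 < weight t x.
Proof. by rewrite invr_gt0. Qed.

Let wE t x : weight t x * (1 + A t x + C t x) = 1.
Proof. by rewrite mulVf. Qed.

Let wAC t x : weight t x * (A t x + C t x) <= 1.
Proof.
by rewrite -(wE t x) ler_wpM2l ?(ltW (weight_gt0 _ _))// -addrA lerDr.
Qed.

Let kw2 t x : 0 <= k * weight t x ^+ 2.
Proof. exact: mulr_ge0 (ltW k0) (sqr_ge0 _). Qed.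

Let kkw2 t x : 0 <= k * (k * weight t x ^+ 2).
Proof. exact: mulr_ge0 (ltW k0) (kw2 _ _). Qed.

Lemma weight_le1 t x : weight t x <= 1.
Proof. by rewrite invf_le1 // -addrA lerDl addr_ge0// ltW. Qed.

Lemma weight_front_ge0 t x : 0 <= weight_front t x.
Proof. by apply: mulr_ge0 (kw2 _ _) _; rewrite addr_ge0 ?expR_ge0. Qed.

Lemma weight_front_le t x : weight_front t x <= k * weight t x.
Proof.
have -> : weight_front t x = k * weight t x * (weight t x * (A t x + C t x)).
  by rewrite /weight_front /A /C; ring.
by rewrite -[leRHS]mulr1 ler_wpM2l ?wAC// mulr_ge0// ltW// weight_gt0.
Qed.

Lemma weight_x_le t x : `|weight_x t x| <= weight_front t x.
Proof.
rewrite /weight_x /weight_front -/(A t x) -/(C t x) normrM.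
rewrite (ger0_norm (kw2 _ _)); apply: ler_wpM2l (kw2 _ _) _ _ _.
have := A0 t x; have := C0 t x; rewrite ler_norml => *; apply/andP; split; lra.
Qed.

Lemma weight_xx_le t x : `|weight_xx t x| <= 3 * k * weight_front t x.
Proof.
have w0 := weight_gt0 t x; have a0 := A0 t x; have c0 := C0 t x.
have wac := wAC t x.
have -> : weight_xx t x = k * (k * weight t x ^+ 2) *
   (2 * weight t x * (A t x - C t x) ^+ 2 - (A t x + C t x)) by rewrite /weight_xx; ring.
have -> : 3 * k * weight_front t x = k * (k * weight t x ^+ 2) * (3 * (A t x + C t x)).
  by rewrite /weight_front /A /C; ring.
rewrite normrM (ger0_norm (kkw2 _ _)); apply: ler_wpM2l (kkw2 _ _) _ _ _.
(* The weight times [A + C] is at most 1, so the quadratic term is no worse than the linear one;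
   each further derivative costs only a factor of order [k]. *)
have h : weight t x * (A t x - C t x) ^+ 2 <= A t x + C t x.
  have h1 : (A t x - C t x) ^+ 2 <= (A t x + C t x) ^+ 2.
    by have := mulr_gt0 a0 c0; nra.
  apply: le_trans (ler_wpM2l (ltW w0) h1) _.
  rewrite expr2 mulrA -[leRHS]mul1r ler_wpM2r// addr_ge0// ltW//.
have h' : 0 <= weight t x * (A t x - C t x) ^+ 2 by rewrite mulr_ge0 ?sqr_ge0// ltW.
by rewrite ler_norml; apply/andP; split; lra.
Qed.

Lemma weight_front_x_le t x : `|weight_front_x t x| <= 3 * k * weight_front t x.
Proof.
have w0 := weight_gt0 t x; have a0 := A0 t x; have c0 := C0 t x.
have wac := wAC t x.
have -> : weight_front_x t x = k * (k * weight t x ^+ 2) *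
   ((A t x - C t x) * (2 * weight t x * (A t x + C t x) - 1)) by rewrite /weight_front_x; ring.
have -> : 3 * k * weight_front t x = k * (k * weight t x ^+ 2) * ((A t x + C t x) * 3).
  by rewrite /weight_front /A /C; ring.
rewrite normrM (ger0_norm (kkw2 _ _)); apply: ler_wpM2l (kkw2 _ _) _ _ _; rewrite normrM ler_pM//.
  by rewrite ler_norml; apply/andP; split; lra.
have : 0 <= weight t x * (A t x + C t x) by rewrite mulr_ge0 ?addr_ge0 ?(ltW w0) ?(ltW a0) ?(ltW c0).
by rewrite ler_norml => ?; apply/andP; split; lra.
Qed.

Lemma is_derive_weight_t t x : is_derive t 1 (weight ^~ x) (- (s * weight_front t x)).
Proof.
have d : is_derive t 1 (fun t => 1 + A t x + C t x) (k * s * (A t x + C t x)).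
  by rewrite /A /C; apply: is_derive_eq; rewrite /GRing.scale/=; ring.
apply: (is_derive_eq (@is_derive_inv (fun t => 1 + A t x + C t x) t _ (den_neq0 t x) d)).
by rewrite /weight_front /weight /A /C; ring.
Qed.

Lemma is_derive_weight_x t x : is_derive x 1 (weight t) (weight_x t x).
Proof.
have d : is_derive x 1 (fun x => 1 + A t x + C t x) (k * (C t x - A t x)).
  by rewrite /A /C; apply: is_derive_eq; rewrite /GRing.scale/=; ring.
apply: (is_derive_eq (@is_derive_inv (fun x => 1 + A t x + C t x) x _ (den_neq0 t x) d)).
by rewrite /weight_x /weight /A /C; ring.
Qed.

Lemma is_derive_weight_xx t x : is_derive x 1 (weight_x t) (weight_xx t x).
Proof.
have d := is_derive_weight_x t x.
rewrite /weight_x; apply: is_derive_eq; rewrite /GRing.scale/= /weight_x /weight_xx /A /C; ring.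
Qed.

Lemma is_derive_weight_front t x : is_derive x 1 (weight_front t) (weight_front_x t x).
Proof.
have d := is_derive_weight_x t x.
rewrite /weight_front; apply: is_derive_eq; rewrite /GRing.scale/= /weight_x /weight_front_x /A /C; ring.
Qed.

Lemma weight_expR_le t x : weight t x <= expR (k * (`|y| + `|z| + s * `|t|)) * expR (- (k * `|x|)).
Proof.
have hyp (q : R) : expR q <= 1 + A t x + C t x -> weight t x <= expR (- q).
  by move=> h; rewrite expRN /weight lef_pV2// posrE// expR_gt0.
have n1 := ler_norm (- y); have n2 := ler_norm z; have n3 := ler_norm (- (s * t)).
rewrite !normrN normrM (ger0_norm s0) in n1 n3.
have y0 := normr_ge0 y; have z0 := normr_ge0 z.
rewrite -expRD; have [x0|x0] := ger0P x.
  apply: (le_trans (hyp (k * (x - z + s * t)) _)).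
    by rewrite -/(C t x); have := A0 t x; lra.
  by rewrite ler_expR -!mulrN -mulrDr ler_wpM2l ?(ltW k0)//; lra.
apply: (le_trans (hyp (k * (y + s * t - x)) _)).
  by rewrite -/(A t x); have := C0 t x; lra.
by rewrite ler_expR -!mulrN -mulrDr ler_wpM2l ?(ltW k0)//; lra.
Qed.

(** A shift by [h] changes each exponential by a factor at most [expR (k * h)]. This is the slow
    variation asked for by [moll_weighted]. *)
Lemma weight_slow h t x x' : 0 <= h -> `|x - x'| <= h ->
  weight t x <= expR (k * h) * weight t x'.
Proof.
move=> h0 xx.
have [x1 x2] : x - x' <= h /\ x' - x <= h.
  by move: xx; rewrite ler_norml => /andP[? ?]; split; lra.
rewrite /weight -/(A t x) -/(C t x) -/(A t x') -/(C t x').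
rewrite -[X in X / _]invrK -expRN -invfM lef_pV2 ?posrE ?mulr_gt0 ?expR_gt0//.
have e1 : expR (- (k * h)) <= 1 by rewrite -expR0 ler_expR oppr_le0 mulr_ge0// ltW.
have eA : expR (- (k * h)) * A t x' <= A t x.
  by rewrite /A -expRD ler_expR -mulrN -mulrDr ler_wpM2l ?(ltW k0)//; lra.
have eC : expR (- (k * h)) * C t x' <= C t x.
  by rewrite /C -expRD ler_expR -mulrN -mulrDr ler_wpM2l ?(ltW k0)//; lra.
rewrite !mulrDr mulr1; lra.
Qed.

(** Between the fronts both exponentials are at most 1. *)
Lemma weight_ge t x : y + s * t <= x <= z - s * t -> 3^-1 <= weight t x.
Proof.
move=> /andP[h1 h2]; rewrite /weight lef_pV2 ?posrE//.
have : A t x <= 1 by rewrite -expR0 ler_expR pmulr_rle0//; lra.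
have : C t x <= 1 by rewrite -expR0 ler_expR pmulr_rle0//; lra.
rewrite /A /C; lra.
Qed.

Lemma weight_le_left t x : weight t x <= expR (k * (x - y - s * t)).
Proof.
have -> : k * (x - y - s * t) = - (k * (y + s * t - x)) by ring.
rewrite expRN /weight lef_pV2 ?posrE ?expR_gt0//.
by rewrite -/(A t x) -/(C t x); have := C0 t x; lra.
Qed.

Lemma weight_le_right t x : weight t x <= expR (k * (z - s * t - x)).
Proof.
have -> : k * (z - s * t - x) = - (k * (x - z + s * t)) by ring.
rewrite expRN /weight lef_pV2 ?posrE ?expR_gt0//.
by rewrite -/(A t x) -/(C t x); have := A0 t x; lra.
Qed.

End Weight.

(** * Towers of bounded derivatives *)

Section Towers.
Context {R : realType}.
Notation mu := (@lebesgue_measure R).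
Implicit Types (F G U : nat -> R -> R) (f g u v w phi rho : R -> R) (r k x C c : R) (n : nat).

Definition cbounded g := continuous g /\ exists C, forall x, `|g x| <= C.
Definition cdecay k g := continuous g /\ exists C, forall x, `|g x| <= C * expR (- (k * `|x|)).

Lemma cbounded_cst c : cbounded (fun=> c).
Proof. by split; [move=> x; exact: cvg_cst|exists `|c|]. Qed.

Lemma cboundedD f g : cbounded f -> cbounded g -> cbounded (fun x => f x + g x).
Proof.
move=> [cf [C hC]] [cg [D hD]]; split; first by move=> x; apply: cvgD; [exact: cf|exact: cg].
by exists (C + D) => x; rewrite (le_trans (ler_normD _ _))// lerD.
Qed.

Lemma cboundedN f : cbounded f -> cbounded (fun x => - f x).
Proof.
move=> [cf [C hC]]; split; first by move=> x; apply: cvgN; exact: cf.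
by exists C => x; rewrite normrN.
Qed.

Lemma cboundedM f g : cbounded f -> cbounded g -> cbounded (fun x => f x * g x).
Proof.
move=> [cf [C hC]] [cg [D hD]]; split; first by move=> x; apply: cvgM; [exact: cf|exact: cg].
by exists (C * D) => x; rewrite normrM ler_pM.
Qed.

Lemma cboundedX f n : cbounded f -> cbounded (fun x => f x ^+ n).
Proof.
move=> bf; elim: n => [|n IH]; first exact: cbounded_cst.
have -> : (fun x => f x ^+ n.+1) = (fun x => f x * f x ^+ n).
  by apply/funext => x; rewrite exprS.
exact: cboundedM.
Qed.

Lemma cdecayD k f g : cdecay k f -> cdecay k g -> cdecay k (fun x => f x + g x).
Proof.
move=> [cf [C hC]] [cg [D hD]]; split; first by move=> x; apply: cvgD; [exact: cf|exact: cg].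
by exists (C + D) => x; rewrite mulrDl (le_trans (ler_normD _ _))// lerD.
Qed.

Lemma cdecayN k f : cdecay k f -> cdecay k (fun x => - f x).
Proof.
move=> [cf [C hC]]; split; first by move=> x; apply: cvgN; exact: cf.
by exists C => x; rewrite normrN.
Qed.

Lemma cdecayM k f g : cdecay k f -> cbounded g -> cdecay k (fun x => f x * g x).
Proof.
move=> [cf [C hC]] [cg [D hD]]; split; first by move=> x; apply: cvgM; [exact: cf|exact: cg].
by exists (C * D) => x; rewrite normrM mulrAC ler_pM.
Qed.

Lemma cdecayMl k f g : cbounded f -> cdecay k g -> cdecay k (fun x => f x * g x).
Proof.
move=> bf dg; have := cdecayM dg bf.
by have -> : (fun x => g x * f x) = (fun x => f x * g x) by apply/funext => x; rewrite mulrC.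
Qed.

Lemma cdecayZ k c g : cdecay k g -> cdecay k (fun x => c * g x).
Proof. by apply: cdecayMl; exact: cbounded_cst. Qed.

Lemma integrable_cdecay k f : 0 < k -> cdecay k f -> mu.-integrable setT (EFin \o f).
Proof.
move=> k0 [cf [C hC]].
apply: (@integrable_dominated _ _ _ (fun x => C * expR (- (k * `|x|)))) => //.
- exact: continuous_measurable_fun.
- exact: (integrableZl measurableT C (integrable_expRN_abs k0)).
Qed.

(** A smooth function with all derivatives bounded, carried as the sequence of its derivatives
    rather than through an iterated derivative operator. *)
Definition tower F := (forall n x, is_derive x 1 (F n) (F n.+1 x)) /\
  forall n, exists C, forall x, `|F n x| <= C.

Lemma tower_cbounded F n : tower F -> cbounded (F n).
Proof. by move=> [dF bF]; split; [exact: derivable_continuous (dF n)|exact: bF]. Qed.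

Lemma tower_resolvent r F : 0 < r -> tower F -> tower (fun n => resolvent r (F n)).
Proof.
move=> r0 [dF bF]; split=> [n x|n].
  have [C hC] := bF n; have [D hD] := bF n.+1.
  exact: (is_derive_resolvent x r0 (dF n) hC hD).
have [C hC] := bF n; exists C => x; apply: resolvent_bound => //.
exact: derivable_continuous (dF n).
Qed.

(** The relation [(1 - r^-2 d^2) B = 1], where the second derivative of [B F] has been moved onto
    [F]. *)
Lemma tower_resolvent_eq r F n x : 0 < r -> tower F ->
  resolvent r (F n) x - r ^- 2 * resolvent r (F n.+2) x = F n x.
Proof.
move=> r0 tF; have [dF bF] := tF.
have [C0 h0] := bF n; have [C1 h1] := bF n.+1; have [C2 h2] := bF n.+2.
have c m : continuous (F m) by exact: derivable_continuous (dF m).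
rewrite -[RHS](resolventK x r0 (dF n) (dF n.+1) (c n.+2) h0 h1 h2).
have h3 y : `|- r ^- 2 * F n.+2 y| <= `|- r ^- 2| * C2 by rewrite normrM ler_wpM2l.
have c3 : continuous (fun y => - r ^- 2 * F n.+2 y).
  by move=> y; apply: cvgM; [exact: cvg_cst|exact: c].
rewrite -mulNr.
have -> : (fun y => F n y - r ^- 2 * F n.+2 y) = (fun y => F n y + - r ^- 2 * F n.+2 y).
  by apply/funext => y; rewrite mulNr.
by rewrite (resolventD x r0 (c n) c3 h0 h3) (resolventZ _ x r0 (c _) h2).
Qed.

Lemma tower_moll_L2 rho u : test_function rho -> L2 u -> tower (moll rho u).
Proof.
move=> t u2; split=> [n x|n]; first exact: is_derive_moll (L2_locint u2).
have [C _ hC] := moll_bound_L2 n t.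
by exists (C * (1 + \int[mu]_y (u y ^+ 2))) => x; exact: hC.
Qed.

Lemma tower_moll_L1 rho u : test_function rho -> mu.-integrable setT (EFin \o u) ->
  tower (moll rho u).
Proof.
move=> t u1; split=> [n x|n]; first exact: is_derive_moll (integrable_locint u1).
have [C _ hC] := moll_bound_L1 n t.
by exists (C * (\int[mu]_y `|u y|)) => x; exact: hC.
Qed.

End Towers.

(** Both tactics recurse on the shape of the function. In a product, [cdc] takes the left factor as
    the decaying one unless it is constant, so expressions are written with the weight first. *)
Ltac cbd := lazymatch goal with
  | |- cbounded (fun _ => ?c0) => exact: (cbounded_cst c0)
  | |- cbounded (fun x => @?F1 x + @?F2 x) => refine (@cboundedD _ F1 F2 _ _); cbd
  | |- cbounded (fun x => @?F1 x * @?F2 x) => refine (@cboundedM _ F1 F2 _ _); cbd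
  | |- cbounded (fun x => - @?F1 x) => refine (@cboundedN _ F1 _); cbd
  | |- cbounded (fun x => @?F1 x ^+ ?n0) => refine (@cboundedX _ F1 n0 _); cbd
  | |- _ => assumption
  end.
Ltac cdc := lazymatch goal with
  | |- cdecay ?k0 (fun x => @?F1 x + @?F2 x) => refine (@cdecayD _ k0 F1 F2 _ _); cdc
  | |- cdecay ?k0 (fun x => - @?F1 x) => refine (@cdecayN _ k0 F1 _); cdc
  | |- cdecay ?k0 (fun x => @?F1 x * @?F2 x) =>
      lazymatch F1 with
      | fun _ => ?c0 => refine (@cdecayZ _ k0 c0 F2 _); cdc
      | _ => refine (@cdecayM _ k0 F1 F2 _ _); [cdc | cbd]
      end
  | |- _ => assumption
  end.

(** * Decay of the weight and the flux potentials *)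

Section EnergyRate.
Context {R : realType}.
Notation mu := (@lebesgue_measure R).
Implicit Types (F G U H S T : nat -> R -> R).

Lemma weight_cdecay (k s y z t : R) : 0 < k -> 0 <= s ->
  [/\ cdecay k (weight k s y z t), cdecay k (weight_x k s y z t),
      cdecay k (weight_xx k s y z t), cdecay k (weight_front k s y z t) &
      cdecay k (weight_front_x k s y z t)].
Proof.
move=> k0 s0.
have ce (c : R) : continuous (fun x : R => expR (k * (c - x))).
  have de (x : R) : is_derive x 1 (fun x => expR (k * (c - x))) (- k * expR (k * (c - x))).
    by apply: is_derive_eq; rewrite /GRing.scale/=; ring.
  exact: derivable_continuous de.
have ce' (c d : R) : continuous (fun x : R => expR (k * (x - c + d))).
  have de (x : R) : is_derive x 1 (fun x => expR (k * (x - c + d))) (k * expR (k * (x - c + d))).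
    by apply: is_derive_eq; rewrite /GRing.scale/=; ring.
  exact: derivable_continuous de.
have cw := derivable_continuous (is_derive_weight_x k s y z t).
have cwx := derivable_continuous (is_derive_weight_xx k s y z t).
have cwf := derivable_continuous (is_derive_weight_front k s y z t).
pose M := expR (k * (`|y| + `|z| + s * `|t|)).
have w0 x : 0 <= weight k s y z t x by rewrite ltW// weight_gt0.
have wM x : weight k s y z t x <= M * expR (- (k * `|x|)) by exact: weight_expR_le.
have fM x : weight_front k s y z t x <= k * M * expR (- (k * `|x|)).
  by rewrite (le_trans (weight_front_le _ _ _ _ _ _))// -mulrA ler_wpM2l// ltW.
have f3M x : 3 * k * weight_front k s y z t x <= 3 * k * (k * M) * expR (- (k * `|x|)).
  rewrite -[leRHS]mulrA; apply: ler_wpM2l; [by rewrite mulr_ge0// ltW|exact: fM].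
split; split.
- exact: cw.
- by exists M => x; rewrite ger0_norm.
- exact: cwx.
- exists (k * M) => x; apply: le_trans (fM x); exact: weight_x_le.
- move=> x; rewrite /weight_xx.
  apply: cvgM; first by apply: cvgM; [exact: cvg_cst|apply: cvgM; exact: cw].
  apply: cvgB.
    apply: cvgM; first by apply: cvgM; [exact: cvg_cst|exact: cw].
    by apply: cvgM; apply: cvgB; [exact: ce|exact: ce'|exact: ce|exact: ce'].
  by apply: cvgD; [exact: ce|exact: ce'].
- exists (3 * k * (k * M)) => x; apply: le_trans (f3M x); exact: weight_xx_le.
- exact: cwf.
- exists (k * M) => x; have Hx := fM x; rewrite ger0_norm//.
  exact: weight_front_ge0.
- move=> x; rewrite /weight_front_x.
  apply: cvgM; first apply: cvgM.
  + by apply: cvgM; [exact: cvg_cst|apply: cvgM; exact: cw].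
  + by apply: cvgB; [exact: ce|exact: ce'].
  + apply: cvgB; last exact: cvg_cst.
    apply: cvgM; first by apply: cvgM; [exact: cvg_cst|exact: cw].
    by apply: cvgD; [exact: ce|exact: ce'].
- exists (3 * k * (k * M)) => x; apply: le_trans (f3M x); exact: weight_front_x_le.
Qed.


(** With [f = B u] and [n = B (u eta)] this is the [k]-th derivative of [p = B (u + a u'' + u eta)],
    for which [eta_t = - p']. With [c], [B eta] and [B (u^2 / 2)] it is [q], for which
    [u_t = - q']. *)
Definition fluxp (a : R) (f n : nat -> R -> R) k x : R := f k x + a * f k.+2 x + n k x.

Lemma tower_fluxp a (f n : nat -> R -> R) : tower f -> tower n -> tower (fluxp a f n).
Proof.
move=> tf tn; split=> [i x|i].
  have [df _] := tf; have [dn _] := tn.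
  have d0 := df i x; have d2 := df i.+2 x; have d3 := dn i x.
  rewrite /fluxp; apply: is_derive_eq; rewrite /GRing.scale/=; ring.
have : cbounded (fluxp a f n i).
  rewrite /fluxp; have h0 := tower_cbounded i tf.
  by have h2 := tower_cbounded i.+2 tf; have h3 := tower_cbounded i tn; cbd.
by case.
Qed.

End EnergyRate.

(** * The integrated energy inequality *)

Section EnergyRate.
Context {R : realType}.
Notation mu := (@lebesgue_measure R).
Implicit Types (F G U H S T : nat -> R -> R).

Lemma energy_rate_le (a b c K sigma eps nu rho k y z t r Q : R) U H S T :
  abcd_parameters a b c -> 0 < r -> r ^- 2 = b ->
  ediag_dominates a b c K ->
  1 <= K -> 0 <= sigma -> 0 < eps -> 0 < nu <= 1 -> 0 < k -> 6 * b + 3 <= k^-1 ->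
  let kappa := (1 + b - a - c) / nu * (1 + (2 * b)^-1) in
  1 + (1 + b - a - c) * nu * K + sigma * eps * K / 2 + 3 * (1 + sigma) * K / k^-1 +
    5 * kappa * eps ^+ 2 * K <= sigma ->
  tower U -> tower H -> tower S -> tower T ->
  let f n := resolvent r (U n) in let g n := resolvent r (H n) in
  let p := fluxp a f (fun n => resolvent r (S n)) in
  let q := fluxp c g (fun n => resolvent r (T n)) in
  (forall x, `|U 0 x| <= eps) -> (forall x, `|H 0 x| <= eps) ->
  (forall x, `|S 0 x - U 0 x * H 0 x| <= rho) ->
  (forall x, `|T 0 x - U 0 x ^+ 2 / 2| <= rho) ->
  (forall x, `|p 1 x| <= Q) -> (forall x, `|q 1 x| <= Q) ->
  \int[mu]_x (- (sigma * weight_front k sigma y z t x) *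
      energy_density a c (U 0 x) (U 1 x) (H 0 x) (H 1 x) +
    weight k sigma y z t x * (- (U 0 x * q 1 x) - H 0 x * p 1 x + a * (U 1 x * q 2 x)
      + c * (H 1 x * p 2 x) - U 0 x * H 0 x * q 1 x - U 0 x ^+ 2 / 2 * p 1 x)) <=
  (8 * kappa * k * rho ^+ 2 + 2 * rho * Q) * \int[mu]_x weight k sigma y z t x.
Proof.
move=> abc r0 rb HK K1 s0 e0 nu01 k0 kb kappa coef tU tH tS tT f g p q.
move=> Ue He r1 r2 pQ qQ.
pose w := weight k sigma y z t.
have [b0 a0 c0 _] := abc; have /andP[nu0 nu1] := nu01.
pose n i := resolvent r (S i); pose m i := resolvent r (T i).
have tf : tower f by exact: tower_resolvent.
have tg : tower g by exact: tower_resolvent.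
have tn : tower n by exact: tower_resolvent.
have tm : tower m by exact: tower_resolvent.
have fE i x : U i x = f i x - b * f i.+2 x by rewrite -rb tower_resolvent_eq.
have gE i x : H i x = g i x - b * g i.+2 x by rewrite -rb tower_resolvent_eq.
have nE i x : S i x = n i x - b * n i.+2 x by rewrite -rb tower_resolvent_eq.
have mE i x : T i x = m i x - b * m i.+2 x by rewrite -rb tower_resolvent_eq.
have rho0 : 0 <= rho by apply: le_trans (r1 0).
have Q0 : 0 <= Q by apply: le_trans (pQ 0).
have kap0 : 0 <= kappa.
  rewrite /kappa !mulr_ge0//; last 2 first.
  - by rewrite invr_ge0 ltW.
  - by rewrite addr_ge0// invr_ge0 mulr_ge0// ltW.
  lra.
set fr := weight_front k sigma y z t; pose wx := weight_x k sigma y z t.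
pose wxx := weight_xx k sigma y z t; pose frx := weight_front_x k sigma y z t.
have [dw0 dwx0 dwxx0 dfr0 dfrx0] := weight_cdecay y z t k0 s0.
have dw : cdecay k w by []. have dwx : cdecay k wx by []. have dwxx : cdecay k wxx by [].
have dfr : cdecay k fr by []. have dfrx : cdecay k frx by [].
have [bU0 bU1] := (tower_cbounded 0 tU, tower_cbounded 1 tU).
have [bH0 bH1] := (tower_cbounded 0 tH, tower_cbounded 1 tH).
have [bf0 bf1] := (tower_cbounded 0 tf, tower_cbounded 1 tf).
have [bf2 bf3] := (tower_cbounded 2 tf, tower_cbounded 3 tf).
have [bg0 bg1] := (tower_cbounded 0 tg, tower_cbounded 1 tg).
have [bg2 bg3] := (tower_cbounded 2 tg, tower_cbounded 3 tg).
have [bn0 bn1] := (tower_cbounded 0 tn, tower_cbounded 1 tn).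
have [bn2 bm2] := (tower_cbounded 2 tn, tower_cbounded 2 tm).
have [bm0 bm1] := (tower_cbounded 0 tm, tower_cbounded 1 tm).
have [bf4 bg4] := (tower_cbounded 4 tf, tower_cbounded 4 tg).
have tp : tower p by exact: tower_fluxp.
have tq : tower q by exact: tower_fluxp.
have [bp0 bp1] := (tower_cbounded 0 tp, tower_cbounded 1 tp).
have [bq0 bq1] := (tower_cbounded 0 tq, tower_cbounded 1 tq).
have [bp2 bq2] := (tower_cbounded 2 tp, tower_cbounded 2 tq).
(* The primitive behind [energy_pointwise]: weighted flux, the two corrections, and the term that
   controls the potentials [n] and [m]. *)
pose Xi x : R := w x * energy_flux a b c (p 0 x) (p 1 x) (q 0 x) (q 1 x)
     (f 1 x - b * f 3 x) (g 1 x - b * g 3 x) +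
   wx x * flux_corr a c (f 0 x) (f 1 x) (f 2 x) (g 0 x) (g 1 x) (g 2 x) -
   sigma * (fr x * energy_corr a b c (f 0 x) (f 1 x) (f 2 x) (g 0 x) (g 1 x) (g 2 x)) +
   4 * b * kappa * (fr x * (n 0 x * n 1 x + m 0 x * m 1 x)).
pose dXi x : R :=
  (wx x * energy_flux a b c (p 0 x) (p 1 x) (q 0 x) (q 1 x)
     (f 1 x - b * f 3 x) (g 1 x - b * g 3 x) +
   w x * (- (p 1 x * q 0 x + p 0 x * q 1 x) + b * (p 2 x * q 1 x + p 1 x * q 2 x)
      + a * ((f 2 x - b * f 4 x) * q 1 x + (f 1 x - b * f 3 x) * q 2 x)
      + c * ((g 2 x - b * g 4 x) * p 1 x + (g 1 x - b * g 3 x) * p 2 x))) +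
  (wxx x * flux_corr a c (f 0 x) (f 1 x) (f 2 x) (g 0 x) (g 1 x) (g 2 x) +
   wx x * (c * (f 1 x * g 1 x + f 0 x * g 2 x) + a * (f 2 x * g 0 x + f 1 x * g 1 x)
      - a * c * (f 2 x * g 2 x + f 1 x * g 3 x + (f 3 x * g 1 x + f 2 x * g 2 x)))) -
  sigma * (frx x * energy_corr a b c (f 0 x) (f 1 x) (f 2 x) (g 0 x) (g 1 x) (g 2 x) +
   fr x * (- b * (f 1 x * f 1 x + f 0 x * f 2 x) + a * b * (f 2 x * f 2 x + f 1 x * f 3 x)
      - b * (g 1 x * g 1 x + g 0 x * g 2 x) + b * c * (g 2 x * g 2 x + g 1 x * g 3 x))) +
  4 * b * kappa * (frx x * (n 0 x * n 1 x + m 0 x * m 1 x) +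
      fr x * (n 1 x ^+ 2 + n 0 x * n 2 x + (m 1 x ^+ 2 + m 0 x * m 2 x))).
have dXiP (x : R) : is_derive x 1 Xi (dXi x).
  have h1 : is_derive x 1 w (wx x) := is_derive_weight_x k sigma y z t x.
  have h2 : is_derive x 1 wx (wxx x) := is_derive_weight_xx k sigma y z t x.
  have h3 : is_derive x 1 fr (frx x) := is_derive_weight_front k sigma y z t x.
  have [df _] := tf; have [dg _] := tg; have [dn _] := tn; have [dm _] := tm.
  have f0' := df 0 x; have f1' := df 1 x; have f2' := df 2 x; have f3' := df 3 x.
  have g0' := dg 0 x; have g1' := dg 1 x; have g2' := dg 2 x; have g3' := dg 3 x.
  have n0' := dn 0 x; have n1' := dn 1 x; have m0' := dm 0 x; have m1' := dm 1 x.
  have [dp _] := tp; have [dq _] := tq.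
  have p0' := dp 0 x; have p1' := dp 1 x; have q0' := dq 0 x; have q1' := dq 1 x.
  rewrite /Xi /energy_flux /flux_corr /energy_corr.
  apply: is_derive_eq; rewrite /GRing.scale/= /dXi /energy_flux /flux_corr /energy_corr.
  ring.
have dXi_decay : cdecay k dXi.
  rewrite /dXi /energy_flux /flux_corr /energy_corr.
  by clearbody w wx wxx fr frx p q f g n m; cdc.
have Xi_decay : cdecay k Xi.
  rewrite /Xi /energy_flux /flux_corr /energy_corr.
  by clearbody w wx wxx fr frx p q f g n m; cdc.
have iXi : \int[mu]_x dXi x = 0.
  have [cXi [C1 h1]] := Xi_decay; have [cdXi [C2 h2]] := dXi_decay.
  have le_max (C D : R) (x : R) : C * expR (- (k * `|x|)) <= (`|C| + `|D|) * expR (- (k * `|x|)).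
    by rewrite ler_wpM2r ?expR_ge0// (le_trans (ler_norm C))// lerDl.
  apply: (@Rintegral_derive_eq0 _ k (`|C1| + `|C2|) _ Xi) => // x.
    exact: le_trans (h1 x) (le_max _ _ _).
  by apply: le_trans (h2 x) _; rewrite addrC; exact: le_max.
set G := fun x : R => - (sigma * weight_front k sigma y z t x) * _ + _.
rewrite -/w.
have dG : cdecay k G.
  by rewrite /G /energy_density; cdc.
set B := 8 * kappa * k * rho ^+ 2 + _.
have iw := integrable_cdecay k0 dw.
have iB : mu.-integrable setT (EFin \o (fun x => B * w x)).
  exact: (integrableZl measurableT B iw).
have idXi := integrable_cdecay k0 dXi_decay.
rewrite -RintegralZl// -[leRHS]add0r -iXi -RintegralD//.
apply: le_Rintegral => //.
- exact: integrable_cdecay dG.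
- exact: (integrableD measurableT idXi iB).
move=> x _.
have [E0 hY hX [hU hH] [hU1 hH1 [hp0 hp1] [hq0 hq1]]] :=
  HK (f 0 x) (f 1 x) (f 2 x) (f 3 x) (g 0 x) (g 1 x) (g 2 x) (g 3 x).
have w0 : 0 <= w x by rewrite ltW// weight_gt0.
have fr0 : 0 <= fr x by exact: weight_front_ge0.
have frk : fr x <= k * w x by exact: weight_front_le.
(* The length [L] of [energy_pointwise] is taken to be [k^-1]. *)
have h3 (v : R) : `|v| <= 3 * k * fr x -> `|v| <= 3 * fr x / k^-1.
  by rewrite invrK => /le_trans; apply; rewrite le_eqVlt; apply/orP; left; apply/eqP; ring.
have hwx : `|wx x| <= fr x by exact: weight_x_le.
have hwxx : `|wxx x| <= 3 * fr x / k^-1 by apply: h3; exact: weight_xx_le.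
have hfrx : `|frx x| <= 3 * fr x / k^-1 by apply: h3; exact: weight_front_x_le.
have Ux : `|f 0 x - b * f 2 x| <= eps by rewrite -(fE 0 x).
have Hx : `|g 0 x - b * g 2 x| <= eps by rewrite -(gE 0 x).
have rx1 : `|n 0 x - b * n 2 x - (f 0 x - b * f 2 x) * (g 0 x - b * g 2 x)| <= rho.
  by rewrite -(nE 0 x) -(fE 0 x) -(gE 0 x).
have rx2 : `|m 0 x - b * m 2 x - (f 0 x - b * f 2 x) ^+ 2 / 2| <= rho.
  by rewrite -(mE 0 x) -(fE 0 x).
have main := @energy_pointwise _ a b c K sigma k^-1 eps nu rho (w x) (- (sigma * fr x)) (wx x)
  (wxx x) (fr x) (frx x) (f 0 x) (f 1 x) (f 2 x) (f 3 x) (f 4 x)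
  (g 0 x) (g 1 x) (g 2 x) (g 3 x) (g 4 x) (n 0 x) (n 1 x) (n 2 x) (m 0 x) (m 1 x) (m 2 x)
  abc E0 hY hX hU hU1 hH1 hp0 hp1 hq0 hq1 K1 s0 e0 nu01 kb coef w0 fr0 erefl
  hwx hwxx hfrx Ux Hx rx1 rx2.
rewrite /G (fE 0 x) (fE 1 x) (gE 0 x) (gE 1 x).
apply: (le_trans main).
change (dXi x + 8 * kappa * fr x * rho ^+ 2 + w x * rho * (`|p 1 x| + `|q 1 x|) <=
  dXi x + B * w x).
rewrite -addrA lerD2l.
have -> : B * w x = 8 * kappa * k * rho ^+ 2 * w x + 2 * rho * Q * w x.
  by rewrite /B mulrDl.
rewrite lerD//.
  have -> : 8 * kappa * k * rho ^+ 2 * w x = 8 * kappa * rho ^+ 2 * (k * w x) by ring.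
  have -> : 8 * kappa * fr x * rho ^+ 2 = 8 * kappa * rho ^+ 2 * fr x by ring.
  by rewrite ler_wpM2l// mulr_ge0 ?sqr_ge0// mulr_ge0.
have -> : 2 * rho * Q * w x = w x * rho * (Q + Q) by ring.
by rewrite ler_wpM2l ?mulr_ge0// lerD.
Qed.

End EnergyRate.

(** * The H^1 norm *)

Section H1Norm.
Context {R : realType}.
Notation mu := (@lebesgue_measure R).
Implicit Types (f g u v : R -> R) (I : set R).

Lemma integrableDT f g : mu.-integrable setT (EFin \o f) -> mu.-integrable setT (EFin \o g) ->
  mu.-integrable setT (EFin \o (fun x => f x + g x)).
Proof. exact: integrableD. Qed.

Lemma integrableZT (c : R) f : mu.-integrable setT (EFin \o f) ->
  mu.-integrable setT (EFin \o (fun x => c * f x)).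
Proof. exact: (integrableZl measurableT c). Qed.

Lemma RintegralDT f g : mu.-integrable setT (EFin \o f) -> mu.-integrable setT (EFin \o g) ->
  \int[mu]_x (f x + g x) = \int[mu]_x f x + \int[mu]_x g x.
Proof. exact: RintegralD. Qed.

Lemma RintegralZT (c : R) f : mu.-integrable setT (EFin \o f) ->
  \int[mu]_x (c * f x) = c * \int[mu]_x f x.
Proof. exact: RintegralZl. Qed.

Lemma weak_derivativeP f : H1 f ->
  L2 (weak_derivative f) /\ is_weak_derivative f (weak_derivative f).
Proof.
move=> [f2 [g g2 fg]].
by have := @getPex _ [set g : R -> R | L2 g /\ is_weak_derivative f g] (ex_intro _ g (conj g2 fg)).
Qed.

Definition H1density f g x : R :=
  f x ^+ 2 + weak_derivative f x ^+ 2 + g x ^+ 2 + weak_derivative g x ^+ 2.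

Definition H1sqnorm f g : R := \int[mu]_x H1density f g x.

Lemma H1density_ge0 f g x : 0 <= H1density f g x.
Proof. by rewrite !addr_ge0 ?sqr_ge0. Qed.

Lemma integrable_H1density f g : H1 f -> H1 g ->
  mu.-integrable setT (EFin \o H1density f g).
Proof.
move=> Hf Hg; have [f1 _] := weak_derivativeP Hf; have [g1 _] := weak_derivativeP Hg.
have [f0 _] := Hf; have [g0 _] := Hg.
have i1 := integrableD measurableT (L2_integrable_sqr f0) (L2_integrable_sqr f1).
have i2 := integrableD measurableT i1 (L2_integrable_sqr g0).
exact: (integrableD measurableT i2 (L2_integrable_sqr g1)).
Qed.

Lemma H1norm_sqrt I f g : measurable I -> H1 f -> H1 g ->
  H1norm I f g = (Num.sqrt (\int[mu]_(x in I) H1density f g x))%:E.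
Proof.
move=> mI Hf Hg; rewrite /H1norm.
have iI : mu.-integrable I (EFin \o H1density f g).
  by apply: integrableS (integrable_H1density Hf Hg).
have -> : (\int[mu]_(x in I)
      ((f x) ^+ 2 + (weak_derivative f x) ^+ 2 +
       (g x) ^+ 2 + (weak_derivative g x) ^+ 2)%:E)%E =
  (\int[mu]_(x in I) H1density f g x)%:E.
  by rewrite /Rintegral fineK//; exact: integrable_fin_num iI.
by rewrite poweR_EFin powR12_sqrt// Rintegral_ge0// => x _; exact: H1density_ge0.
Qed.

Lemma integrable_test_mul f phi : L2 f -> test_function phi ->
  mu.-integrable setT (EFin \o (fun x => f x * phi x)).
Proof.
move=> f2 tphi.
have -> : (fun x => f x * phi x) = (fun y => f y * ((fun z => phi (- z))^`(0))%classic (0 - y)).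
  by apply/funext => y; rewrite derive1n0 sub0r opprK.
apply: moll_integrable (L2_locint f2).
have -> : (fun z => phi (- z)) = (fun z => phi (0 - z)) by apply/funext => z; rewrite sub0r.
exact: test_function_reflect.
Qed.

Lemma is_weak_derivativeB f f' g g' : L2 f -> L2 f' -> L2 g -> L2 g' ->
  is_weak_derivative f f' -> is_weak_derivative g g' ->
  is_weak_derivative (f \- g) (f' \- g').
Proof.
move=> f2 f2' g2 g2' wf wg phi tphi.
have tphi' := test_function_derive1n 1 tphi; rewrite derive1n1 in tphi'.
have -> : (fun x => (f \- g) x * (phi^`())%classic x) =
  (fun x => f x * (phi^`())%classic x - g x * (phi^`())%classic x).
  by apply/funext => x; rewrite /= mulrBl.
have -> : (fun x => (f' \- g') x * phi x) = (fun x => f' x * phi x - g' x * phi x).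
  by apply/funext => x; rewrite /= mulrBl.
rewrite RintegralB//; try exact: integrable_test_mul.
rewrite RintegralB//; try exact: integrable_test_mul.
by rewrite wf// wg//; ring.
Qed.

Lemma L2B f g : L2 f -> L2 g -> L2 (f \- g).
Proof. by move=> f2 g2; apply: L2D => //; exact: L2N. Qed.

Lemma H1B f g : H1 f -> H1 g -> H1 (f \- g).
Proof.
move=> Hf Hg; have [f1 wf] := weak_derivativeP Hf; have [g1 wg] := weak_derivativeP Hg.
have [f0 _] := Hf; have [g0 _] := Hg.
split; first exact: L2B.
exists (weak_derivative f \- weak_derivative g); first exact: L2B.
exact: is_weak_derivativeB.
Qed.

(** [weak_derivative] picks a representative, so it is additive only almost everywhere; comparisons
    of H^1 norms below go through this. *)
Lemma weak_derivativeB_ae f g : H1 f -> H1 g ->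
  {ae mu, forall x, weak_derivative (f \- g) x = weak_derivative f x - weak_derivative g x}.
Proof.
move=> Hf Hg; have [f1 wf] := weak_derivativeP Hf; have [g1 wg] := weak_derivativeP Hg.
have [f0 _] := Hf; have [g0 _] := Hg; have [fg1 wfg] := weak_derivativeP (H1B Hf Hg).
apply: (weak_derivative_unique _ fg1 _ wfg); [exact: L2B|exact: L2B|].
exact: is_weak_derivativeB.
Qed.

Lemma H1sqnorm_ae_le f g (G : R -> R) : H1 f -> H1 g ->
  mu.-integrable setT (EFin \o G) -> (forall x, 0 <= G x) ->
  {ae mu, forall x, H1density f g x <= G x} -> H1sqnorm f g <= \int[mu]_x G x.
Proof.
move=> Hf Hg iG G0 fgG; have i1 := integrable_H1density Hf Hg.
rewrite -lee_fin /H1sqnorm /Rintegral !fineK; last 2 first.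
- exact: integrable_fin_num iG.
- exact: integrable_fin_num i1.
apply: ae_ge0_le_integral => //.
- by move=> x _; rewrite lee_fin H1density_ge0.
- by case/integrableP : i1.
- by move=> x _; rewrite lee_fin.
- by case/integrableP : iG.
by apply: ae_mono fgG => x h _; rewrite lee_fin.
Qed.

Lemma sqr_le_sqrB (p q : R) : p ^+ 2 <= 2 * q ^+ 2 + 2 * (p - q) ^+ 2.
Proof. by have := sqr_ge0 (p - 2 * q); rewrite -subr_ge0; lra. Qed.

(** A quadratic substitute for the triangle inequality; its factors 2 fix the constants of the
    continuation argument. *)
Lemma H1sqnorm_le f g u v : H1 f -> H1 g -> H1 u -> H1 v ->
  H1sqnorm f g <= 2 * H1sqnorm u v + 2 * H1sqnorm (f \- u) (g \- v).
Proof.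
move=> Hf Hg Hu Hv.
have i2 := integrable_H1density Hu Hv.
have i3 := integrable_H1density (H1B Hf Hu) (H1B Hg Hv).
have i4 := integrableZT 2 i2; have i5 := integrableZT 2 i3.
have -> : 2 * H1sqnorm u v + 2 * H1sqnorm (f \- u) (g \- v) =
    \int[mu]_x (2 * H1density u v x + 2 * H1density (f \- u) (g \- v) x).
  by rewrite RintegralDT// !RintegralZT.
apply: H1sqnorm_ae_le => //; first exact: integrableDT.
  by move=> x; rewrite addr_ge0// mulr_ge0// H1density_ge0.
apply: ae_mono (ae_and (weak_derivativeB_ae Hf Hu) (weak_derivativeB_ae Hg Hv)) => x [e1 e2].
rewrite /H1density e1 e2 /=.
have := sqr_le_sqrB (f x) (u x); have := sqr_le_sqrB (g x) (v x).
have := sqr_le_sqrB (weak_derivative f x) (weak_derivative u x).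
have := sqr_le_sqrB (weak_derivative g x) (weak_derivative v x).
clear; lra.
Qed.

(** The chosen derivatives of [f - u] and [u - f] are opposite only almost everywhere, so even this
    symmetry needs an argument. *)
Lemma H1sqnorm_subC_le f g u v : H1 f -> H1 g -> H1 u -> H1 v ->
  H1sqnorm (f \- u) (g \- v) <= H1sqnorm (u \- f) (v \- g).
Proof.
move=> Hf Hg Hu Hv; apply: H1sqnorm_ae_le (integrable_H1density _ _) (H1density_ge0 _ _) _;
  do ?exact: H1B.
apply: ae_mono (ae_and
  (ae_and (weak_derivativeB_ae Hf Hu) (weak_derivativeB_ae Hg Hv))
  (ae_and (weak_derivativeB_ae Hu Hf) (weak_derivativeB_ae Hv Hg))) => x [[e1 e2] [e3 e4]].
have sw (p q : R) : (p - q) ^+ 2 = (q - p) ^+ 2 by ring.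
by rewrite /H1density e1 e2 e3 e4 /= (sw (f x)) (sw (g x)) (sw (weak_derivative f x))
  (sw (weak_derivative g x)).
Qed.

Lemma H1sqnorm_parts f g : H1 f -> H1 g -> H1sqnorm f g =
  \int[mu]_x (f x ^+ 2) + \int[mu]_x (weak_derivative f x ^+ 2) +
  \int[mu]_x (g x ^+ 2) + \int[mu]_x (weak_derivative g x ^+ 2).
Proof.
move=> Hf Hg; have [f1 _] := weak_derivativeP Hf; have [g1 _] := weak_derivativeP Hg.
have [f0 _] := Hf; have [g0 _] := Hg.
have j1 := L2_integrable_sqr f0; have j2 := L2_integrable_sqr f1.
have j3 := L2_integrable_sqr g0; have j4 := L2_integrable_sqr g1.
have i1 := integrableDT j1 j2; have i2 := integrableDT i1 j3.
by rewrite /H1sqnorm /H1density (RintegralDT i2 j4) (RintegralDT i1 j3) (RintegralDT j1 j2).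
Qed.

(** The last two bounds have the shape of the right-hand side of [moll_sobolev]. *)
Lemma H1sqnorm_ge f g : H1 f -> H1 g ->
  \int[mu]_x (f x ^+ 2) <= H1sqnorm f g /\ \int[mu]_x (g x ^+ 2) <= H1sqnorm f g /\
  \int[mu]_x (weak_derivative f x ^+ 2) <= H1sqnorm f g /\
  \int[mu]_x (weak_derivative g x ^+ 2) <= H1sqnorm f g /\
  2 * \int[mu]_x (f x ^+ 2) + \int[mu]_x (weak_derivative f x ^+ 2) <= 2 * H1sqnorm f g /\
  2 * \int[mu]_x (g x ^+ 2) + \int[mu]_x (weak_derivative g x ^+ 2) <= 2 * H1sqnorm f g.
Proof.
move=> Hf Hg; have pos (h : R -> R) : 0 <= \int[mu]_x (h x ^+ 2).
  by apply: Rintegral_ge0 => x _; exact: sqr_ge0.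
have alg (a b c d : R) : 0 <= a -> 0 <= b -> 0 <= c -> 0 <= d -> let N := a + b + c + d in
    a <= N /\ c <= N /\ b <= N /\ d <= N /\ 2 * a + b <= 2 * N /\ 2 * c + d <= 2 * N.
  by move=> a0 b0 c0 d0 N; rewrite /N; clear -a0 b0 c0 d0; do !split; lra.
rewrite (H1sqnorm_parts Hf Hg); exact: alg.
Qed.

Lemma H1sqnorm_cvg (u eta : R -> R -> R) (t0 e : R) : H1_continuous u eta -> 0 < e ->
  exists2 d : R, 0 < d &
  forall t, `|t - t0| < d -> H1sqnorm (u t \- u t0) (eta t \- eta t0) < e.
Proof.
move=> [H /(_ t0) /fine_cvg cv] e0; have [Hu0 He0] := H t0.
have : \forall t \near t0, fine (H1norm setT (u t \- u t0) (eta t \- eta t0)) < Num.sqrt e.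
  by apply: (cvgr_lt (0 : R) cv); rewrite sqrtr_gt0.
move=> /nbhs_ballP[d /= d0 hd]; exists d => // t td; have [Hu He] := H t.
have := hd t; rewrite /ball/= distrC => /(_ td).
by rewrite (H1norm_sqrt _ (H1B Hu Hu0) (H1B He He0))//= ltr_sqrt.
Qed.

End H1Norm.

(** * The mollified system *)

Section MollifiedSystem.
Context {R : realType}.
Notation mu := (@lebesgue_measure R).
Implicit Types (rho phi : R -> R) (t x : R) (i : nat).

Lemma derive1n_add phi m n : ((phi^`(m))^`(n))%classic = (phi^`(n + m))%classic.
Proof. by rewrite /derive1n iterD. Qed.

(** The equations differentiate only [V - r^-2 V''] in time. [V] is the resolvent of this
    combination, and the time derivative passes under its integral. *)
Lemma is_derive_resolvent_eq (V : R -> nat -> R -> R) (W : R -> R -> R) (r e C C' t0 : R) i x :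
  0 < r -> 0 < e -> (forall t, tower (V t)) ->
  (forall t y, `|t - t0| < e -> `|V t i y - r ^- 2 * V t i.+2 y| <= C) ->
  (forall t y, `|t - t0| < e ->
    is_derive t 1 (fun s => V s i y - r ^- 2 * V s i.+2 y) (W t y)) ->
  (forall t y, `|t - t0| < e -> `|W t y| <= C') ->
  is_derive t0 1 (fun t => V t i x) (resolvent r (W t0) x).
Proof.
move=> r0 e0 tV VC dV WC.
have -> : (fun t => V t i x) = (fun t => resolvent r (fun y => V t i y - r ^- 2 * V t i.+2 y) x).
  apply/funext => t; have [dVt bVt] := tV t.
  have [C0 h0] := bVt i; have [C1 h1] := bVt i.+1; have [C2 h2] := bVt i.+2.
  have c2 := derivable_continuous (dVt i.+2).
  by rewrite (resolventK x r0 (dVt i) (dVt i.+1) c2 h0 h1 h2).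
apply: (is_derive_resolvent_param x r0 e0 _ VC dV WC) => t _ y.
have c0 := derivable_continuous ((tV t).1 i); have c2 := derivable_continuous ((tV t).1 i.+2).
by apply: cvgB; [exact: c0|apply: cvgM; [exact: cvg_cst|exact: c2]].
Qed.

Lemma resolvent_comb (r al C0 C1 C2 x : R) (v0 v1 v2 : R -> R) : 0 < r ->
  continuous v0 -> continuous v1 -> continuous v2 ->
  (forall y, `|v0 y| <= C0) -> (forall y, `|v1 y| <= C1) -> (forall y, `|v2 y| <= C2) ->
  resolvent r (fun y => - (al * v0 y + v1 y + v2 y)) x =
  - (al * resolvent r v0 x + resolvent r v1 x + resolvent r v2 x).
Proof.
move=> r0 c0 c1 c2 h0 h1 h2.
have ca : continuous (fun y => al * v0 y) by move=> y; apply: cvgM; [exact: cvg_cst|exact: c0].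
have ha y : `|al * v0 y| <= `|al| * C0 by rewrite normrM ler_wpM2l.
have cb : continuous (fun y => al * v0 y + v1 y) by move=> y; apply: cvgD; [exact: ca|exact: c1].
have hb y : `|al * v0 y + v1 y| <= `|al| * C0 + C1 by rewrite (le_trans (ler_normD _ _))// lerD.
have cc : continuous (fun y => al * v0 y + v1 y + v2 y).
  by move=> y; apply: cvgD; [exact: cb|exact: c2].
have hc y : `|al * v0 y + v1 y + v2 y| <= `|al| * C0 + C1 + C2.
  by rewrite (le_trans (ler_normD _ _))// lerD.
have -> : (fun y => - (al * v0 y + v1 y + v2 y)) = (fun y => -1 * (al * v0 y + v1 y + v2 y)).
  by apply/funext => y; rewrite mulN1r.
by rewrite (resolventZ _ _ r0 cc hc) (resolventD _ r0 cb c2 hb h2) (resolventD _ r0 ca c1 ha h1)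
  (resolventZ _ _ r0 c0 h0) mulN1r.
Qed.

Variables (a b c : R) (u eta : R -> R -> R) (rho : R -> R).
Hypotheses (b0 : 0 < b) (sol : global_H1_solution a b c u eta) (trho : test_function rho).

Definition mU t := moll rho (u t).
Definition mH t := moll rho (eta t).
Definition mS t := moll rho (fun y => u t y * eta t y).
Definition mT t := moll rho (fun y => u t y ^+ 2 / 2).

Let Hu t : H1 (u t). Proof. by have [[/(_ t)[]]] := sol. Qed.
Let He t : H1 (eta t). Proof. by have [[/(_ t)[]]] := sol. Qed.
Let u2 t : L2 (u t). Proof. by have [] := Hu t. Qed.
Let e2 t : L2 (eta t). Proof. by have [] := He t. Qed.

Let ue1 t : mu.-integrable setT (EFin \o (fun y => u t y * eta t y)).
Proof. exact: L2_integrable_mul. Qed.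
Let uu1 t : mu.-integrable setT (EFin \o (fun y => u t y ^+ 2 / 2)).
Proof.
have := integrableZT 2^-1 (L2_integrable_sqr (u2 t)).
by under [X in EFin \o X]eq_fun do rewrite mulrC.
Qed.

Lemma tower_mU t : tower (mU t). Proof. exact: tower_moll_L2. Qed.
Lemma tower_mH t : tower (mH t). Proof. exact: tower_moll_L2. Qed.
Lemma tower_mS t : tower (mS t). Proof. exact: tower_moll_L1. Qed.
Lemma tower_mT t : tower (mT t). Proof. exact: tower_moll_L1. Qed.

(** Pairing with this test function evaluates the [i]-th derivative of the mollification at [x]. *)
Let phi i x y := (rho^`(i))%classic (x - y).

Let tphi i x : test_function (phi i x).
Proof. exact: test_function_reflect (test_function_derive1n i trho). Qed.

Let phin i x n : ((phi i x)^`(n))%classic = (fun y => (-1) ^+ n * phi (i + n) x y).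
Proof.
rewrite derive1n_reflect; last exact: test_function_derive1n.
by rewrite derive1n_add addnC.
Qed.

Lemma is_derive_mH_sub t i x :
  is_derive t 1 (fun s => mH s i x - b * mH s i.+2 x)
    (- (a * mU t i.+3 x + mU t i.+1 x + mS t i.+1 x)).
Proof.
have [_ /(_ _ t (tphi i x)) [+ _]] := sol.
have p1 := phin i x 1; rewrite derive1n1 in p1.
rewrite p1 !phin !(addn1, addn2, addn3).
have -> : (fun s => \int[mu]_y (eta s y * (phi i x y - b * ((-1) ^+ 2 * phi i.+2 x y)))) =
    (fun s => mH s i x - b * mH s i.+2 x).
  apply/funext => s; rewrite /mH /moll.
  have j0 := moll_integrable i x trho (L2_locint (e2 s)).
  have j2 := moll_integrable i.+2 x trho (L2_locint (e2 s)).
  have j := integrableZT (- b) j2.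
  rewrite -mulNr -(RintegralZT (- b) j2) -(RintegralDT j0 j).
  by congr Rintegral; apply/funext => y; rewrite /phi; ring.
have -> // : \int[mu]_y (a * u t y * ((-1) ^+ 3 * phi i.+3 x y) +
   (u t y + u t y * eta t y) * ((-1) ^+ 1 * phi i.+1 x y)) =
   - (a * mU t i.+3 x + mU t i.+1 x + mS t i.+1 x).
rewrite /mU /mS /moll.
have j3 := moll_integrable i.+3 x trho (L2_locint (u2 t)).
have j1 := moll_integrable i.+1 x trho (L2_locint (u2 t)).
have js := moll_integrable i.+1 x trho (integrable_locint (ue1 t)).
have k3 := integrableZT a j3; have k31 := integrableDT k3 j1.
have k := integrableDT k31 js.
rewrite -(RintegralZT a j3) -(RintegralDT k3 j1) -(RintegralDT k31 js) -[RHS]mulN1r.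
rewrite -(RintegralZT (-1) k).
by congr Rintegral; apply/funext => y; rewrite /phi; ring.
Qed.

Lemma is_derive_mU_sub t i x :
  is_derive t 1 (fun s => mU s i x - b * mU s i.+2 x)
    (- (c * mH t i.+3 x + mH t i.+1 x + mT t i.+1 x)).
Proof.
have [_ /(_ _ t (tphi i x)) [_ +]] := sol.
have p1 := phin i x 1; rewrite derive1n1 in p1.
rewrite p1 !phin !(addn1, addn2, addn3).
have -> : (fun s => \int[mu]_y (u s y * (phi i x y - b * ((-1) ^+ 2 * phi i.+2 x y)))) =
    (fun s => mU s i x - b * mU s i.+2 x).
  apply/funext => s; rewrite /mU /moll.
  have j0 := moll_integrable i x trho (L2_locint (u2 s)).
  have j2 := moll_integrable i.+2 x trho (L2_locint (u2 s)).
  have j := integrableZT (- b) j2.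
  rewrite -mulNr -(RintegralZT (- b) j2) -(RintegralDT j0 j).
  by congr Rintegral; apply/funext => y; rewrite /phi; ring.
have -> // : \int[mu]_y (c * eta t y * ((-1) ^+ 3 * phi i.+3 x y) +
   (eta t y + 2^-1 * u t y ^+ 2) * ((-1) ^+ 1 * phi i.+1 x y)) =
   - (c * mH t i.+3 x + mH t i.+1 x + mT t i.+1 x).
rewrite /mH /mT /moll.
have j3 := moll_integrable i.+3 x trho (L2_locint (e2 t)).
have j1 := moll_integrable i.+1 x trho (L2_locint (e2 t)).
have js := moll_integrable i.+1 x trho (integrable_locint (uu1 t)).
have k3 := integrableZT c j3; have k31 := integrableDT k3 j1.
have k := integrableDT k31 js.
rewrite -(RintegralZT c j3) -(RintegralDT k3 j1) -(RintegralDT k31 js) -[RHS]mulN1r.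
rewrite -(RintegralZT (-1) k).
by congr Rintegral; apply/funext => y; rewrite /phi; ring.
Qed.

Notation N t := (H1sqnorm (u t) (eta t)).

Let int_le t := H1sqnorm_ge (Hu t) (He t).

(** Continuity in time enters here as the source of majorants for time differentiation. *)
Lemma H1sqnorm_locally_bounded t0 : exists2 e : R, 0 < e & exists2 M : R, 0 <= M &
  forall t, `|t - t0| < e -> N t <= M.
Proof.
have [d d0 hd] := H1sqnorm_cvg t0 sol.1 ltr01; exists d => //.
have pos (f g : R -> R) : 0 <= H1sqnorm f g by apply: Rintegral_ge0 => x _; exact: H1density_ge0.
exists (2 * N t0 + 2) => [|t td]; first by rewrite addr_ge0// mulr_ge0// pos.
apply: le_trans (H1sqnorm_le (Hu t) (He t) (Hu t0) (He t0)) _.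
by rewrite lerD2l; have := hd t td; lra.
Qed.

Definition lbounded e t0 (g : R -> R -> R) :=
  exists C, forall t x, `|t - t0| < e -> `|g t x| <= C.

Lemma moll_locally_bounded e t0 M : 0 <= M -> (forall t, `|t - t0| < e -> N t <= M) ->
  forall i, [/\ lbounded e t0 (fun t x => mU t i x), lbounded e t0 (fun t x => mH t i x),
    lbounded e t0 (fun t x => mS t i x) & lbounded e t0 (fun t x => mT t i x)].
Proof.
move=> M0 HM i.
have [C C0 hC] := moll_bound_L2 i trho; have [D D0 hD] := moll_bound_L1 i trho.
split.
- exists (C * (1 + M)) => t x te; apply: le_trans (hC _ _ (u2 t)) _.
  by rewrite ler_wpM2l// lerD2l; apply: le_trans (HM t te); have [] := int_le t.
- exists (C * (1 + M)) => t x te; apply: le_trans (hC _ _ (e2 t)) _.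
  by rewrite ler_wpM2l// lerD2l; apply: le_trans (HM t te); have [_ []] := int_le t.
- exists (D * M) => t x te; apply: le_trans (hD _ _ (ue1 t)) _.
  rewrite ler_wpM2l//; apply: le_trans (HM t te).
  have i1 := L2_integrable_sqr (u2 t); have i2 := L2_integrable_sqr (e2 t).
  have i3 := integrableZT 2^-1 (integrableDT i1 i2).
  have [h1 [h2 _]] := int_le t.
  apply: (@le_trans _ _ (\int[mu]_y (2^-1 * (u t y ^+ 2 + eta t y ^+ 2)))).
    apply: le_Rintegral => //; first exact: integrable_abse (ue1 t).
    move=> y _; rewrite normrM; have := sqr_ge0 (`|u t y| - `|eta t y|).
    by rewrite sqrrB !real_normK ?num_real//; lra.
  rewrite RintegralZT ?RintegralDT//; [lra|exact: integrableDT].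
- exists (D * M) => t x te; apply: le_trans (hD _ _ (uu1 t)) _.
  rewrite ler_wpM2l//; apply: le_trans (HM t te).
  have i1 := L2_integrable_sqr (u2 t).
  have [h1 _] := int_le t; apply: le_trans h1.
  apply: le_Rintegral => //; first exact: integrable_abse (uu1 t).
  move=> y _; rewrite ger0_norm; first by have := sqr_ge0 (u t y); lra.
  by rewrite divr_ge0// sqr_ge0.
Qed.

End MollifiedSystem.

(** * Bounds uniform in space and local in time *)

Section LocalBounds.
Context {R : realType}.
Implicit Types (g h : R -> R -> R) (e t k C : R).


Lemma lbounded_cst e t0 C : lbounded e t0 (fun _ _ : R => C).
Proof. by exists `|C|. Qed.

Lemma lboundedD e t0 g h : lbounded e t0 g -> lbounded e t0 h ->
  lbounded e t0 (fun t x => g t x + h t x).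
Proof.
move=> [C hC] [D hD]; exists (C + D) => t x te.
by rewrite (le_trans (ler_normD _ _))// lerD ?hC ?hD.
Qed.

Lemma lboundedN e t0 g : lbounded e t0 g -> lbounded e t0 (fun t x => - g t x).
Proof. by move=> [C hC]; exists C => t x te; rewrite normrN hC. Qed.

Lemma lboundedM e t0 g h : lbounded e t0 g -> lbounded e t0 h ->
  lbounded e t0 (fun t x => g t x * h t x).
Proof.
move=> [C hC] [D hD]; exists (C * D) => t x te.
by rewrite normrM ler_pM ?hC ?hD.
Qed.

Lemma lboundedX e t0 g n : lbounded e t0 g -> lbounded e t0 (fun t x => g t x ^+ n).
Proof.
move=> [C hC]; exists (C ^+ n) => t x te.
by rewrite normrX lerXn2r ?nnegrE ?hC// (le_trans _ (hC _ x te)).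
Qed.

Definition ldecay e t0 k g := exists C, forall t x, `|t - t0| < e ->
  `|g t x| <= C * expR (- (k * `|x|)).

Lemma ldecayD e t0 k g h : ldecay e t0 k g -> ldecay e t0 k h ->
  ldecay e t0 k (fun t x => g t x + h t x).
Proof.
move=> [C hC] [D hD]; exists (C + D) => t x te.
by rewrite mulrDl (le_trans (ler_normD _ _))// lerD ?hC ?hD.
Qed.

Lemma ldecayM e t0 k g h : ldecay e t0 k g -> lbounded e t0 h ->
  ldecay e t0 k (fun t x => g t x * h t x).
Proof.
move=> [C hC] [D hD]; exists (C * D) => t x te.
by rewrite normrM mulrAC ler_pM ?hC ?hD.
Qed.

Lemma weight_ldecay e t0 (k s y z : R) : 0 < k -> 0 <= s ->
  ldecay e t0 k (weight k s y z) /\ ldecay e t0 k (fun t x => - (s * weight_front k s y z t x)).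
Proof.
move=> k0 s0; set M := expR (k * (`|y| + `|z| + s * (`|t0| + e))).
have wM t x : `|t - t0| < e -> weight k s y z t x <= M * expR (- (k * `|x|)).
  move=> te; apply: le_trans (weight_expR_le y z k0 s0 t x) _.
  apply: ler_wpM2r; first exact: expR_ge0.
  rewrite ler_expR; apply: ler_wpM2l; first exact: ltW.
  rewrite lerD2l; apply: ler_wpM2l => //.
  by rewrite -[t](subrK t0) addrC (le_trans (ler_normD _ _))// lerD2l ltW.
split; first by exists M => t x te; rewrite ger0_norm ?wM// ltW// weight_gt0.
exists (s * (k * M)) => t x te; have fr0 : 0 <= weight_front k s y z t x by exact: weight_front_ge0.
rewrite normrN ger0_norm; last by apply: mulr_ge0.
rewrite -!mulrA; apply: ler_wpM2l => //; apply: (@le_trans _ _ (k * weight k s y z t x)).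
  exact: weight_front_le.
by rewrite ler_wpM2l ?wM// ltW.
Qed.

End LocalBounds.

Ltac lbd := lazymatch goal with
  | |- lbounded _ _ (fun _ _ => ?c0) => exact: (lbounded_cst _ _ c0)
  | |- lbounded ?e ?t0 (fun t x => @?F1 t x + @?F2 t x) => refine (@lboundedD _ e t0 F1 F2 _ _); lbd
  | |- lbounded ?e ?t0 (fun t x => @?F1 t x * @?F2 t x) => refine (@lboundedM _ e t0 F1 F2 _ _); lbd
  | |- lbounded ?e ?t0 (fun t x => - @?F1 t x) => refine (@lboundedN _ e t0 F1 _); lbd
  | |- lbounded ?e ?t0 (fun t x => @?F1 t x ^+ ?n0) => refine (@lboundedX _ e t0 F1 n0 _); lbd
  | |- _ => match goal with Hb : ?Q |- ?P => constr_eq P Q; exact Hb end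
  end.

(** * Time derivative of the mollified energy *)

Section EnergyDerivative.
Context {R : realType}.
Notation mu := (@lebesgue_measure R).
Implicit Types (t x : R) (i : nat).

Variables (a b c r : R) (u eta : R -> R -> R) (rho : R -> R).
Hypotheses (r0 : 0 < r) (rb : r ^- 2 = b).
Hypotheses (sol : global_H1_solution a b c u eta) (trho : test_function rho).

Local Opaque mU mH mS mT moll resolvent.
Local Notation U := (mU u rho).
Local Notation H := (mH eta rho).
Local Notation S := (mS u eta rho).
Local Notation T := (mT u rho).

Definition mp t := fluxp a (fun n => resolvent r (U t n)) (fun n => resolvent r (S t n)).
Definition mq t := fluxp c (fun n => resolvent r (H t n)) (fun n => resolvent r (T t n)).

Let tU t : tower (U t). Proof. exact: tower_mU sol trho t. Qed.
Let tH t : tower (H t). Proof. exact: tower_mH sol trho t. Qed.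
Let tS t : tower (S t). Proof. exact: tower_mS sol trho t. Qed.
Let tT t : tower (T t). Proof. exact: tower_mT sol trho t. Qed.

Lemma lbounded_resolvent e t0 (V : R -> nat -> R -> R) i : (forall t, tower (V t)) ->
  lbounded e t0 (fun t x => V t i x) -> lbounded e t0 (fun t x => resolvent r (V t i) x).
Proof.
move=> tV [C hC]; exists C => t x te; apply: resolvent_bound => //.
  exact: derivable_continuous ((tV t).1 i).
by move=> y; exact: hC.
Qed.

(** [B] applied to the mollified first equation: after mollification [eta_t = - p'] holds
    classically, at every order of differentiation in [x]. *)
Lemma is_derive_mH t0 i x : is_derive t0 1 (fun t => H t i x) (- mp t0 i.+1 x).
Proof.
have [e e0 [M M0 HM]] := H1sqnorm_locally_bounded sol t0.
have bd := moll_locally_bounded sol trho M0 HM.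
have [bU0 bH0 bS0 _] := bd i.+1; have [bU2 _ _ _] := bd i.+3.
have [_ bHi _ _] := bd i; have [_ bH2 _ _] := bd i.+2.
pose V t y := H t i y - b * H t i.+2 y.
pose W t y := - (a * U t i.+3 y + U t i.+1 y + S t i.+1 y).
have [C hC] : lbounded e t0 V by rewrite /V; lbd.
have [C' hC'] : lbounded e t0 W by rewrite /W; lbd.
have -> : - mp t0 i.+1 x = resolvent r (W t0) x.
  have [C0 h0] := (tU t0).2 i.+3; have [C1 h1] := (tU t0).2 i.+1.
  have [C2 h2] := (tS t0).2 i.+1.
  have c0 := derivable_continuous ((tU t0).1 i.+3).
  have c1 := derivable_continuous ((tU t0).1 i.+1).
  have c2 := derivable_continuous ((tS t0).1 i.+1).
  by rewrite (resolvent_comb _ _ r0 c0 c1 c2 h0 h1 h2) /mp /fluxp; congr (- (_ + _)); rewrite addrC.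
apply: (@is_derive_resolvent_eq _ H W r e C C' t0 i x r0 e0 tH) => // t y te.
  by rewrite rb; exact: hC.
by rewrite rb; have := is_derive_mH_sub sol trho t i y; apply.
Qed.

Lemma is_derive_mU t0 i x : is_derive t0 1 (fun t => U t i x) (- mq t0 i.+1 x).
Proof.
have [e e0 [M M0 HM]] := H1sqnorm_locally_bounded sol t0.
have bd := moll_locally_bounded sol trho M0 HM.
have [_ bH0 _ bT0] := bd i.+1; have [_ bH2 _ _] := bd i.+3.
have [bUi _ _ _] := bd i; have [bU2 _ _ _] := bd i.+2.
pose V t y := U t i y - b * U t i.+2 y.
pose W t y := - (c * H t i.+3 y + H t i.+1 y + T t i.+1 y).
have [C hC] : lbounded e t0 V by rewrite /V; lbd.
have [C' hC'] : lbounded e t0 W by rewrite /W; lbd.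
have -> : - mq t0 i.+1 x = resolvent r (W t0) x.
  have [C0 h0] := (tH t0).2 i.+3; have [C1 h1] := (tH t0).2 i.+1.
  have [C2 h2] := (tT t0).2 i.+1.
  have c0 := derivable_continuous ((tH t0).1 i.+3).
  have c1 := derivable_continuous ((tH t0).1 i.+1).
  have c2 := derivable_continuous ((tT t0).1 i.+1).
  by rewrite (resolvent_comb _ _ r0 c0 c1 c2 h0 h1 h2) /mq /fluxp; congr (- (_ + _)); rewrite addrC.
apply: (@is_derive_resolvent_eq _ U W r e C C' t0 i x r0 e0 tU) => // t y te.
  by rewrite rb; exact: hC.
by rewrite rb; have := is_derive_mU_sub sol trho t i y; apply.
Qed.

Variables (k sigma y z : R).
Hypotheses (k0 : 0 < k) (s0 : 0 <= sigma).

Definition menergy t := \int[mu]_x (weight k sigma y z t x *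
  energy_density a c (U t 0 x) (U t 1 x) (H t 0 x) (H t 1 x)).

Definition menergy_rate t x :=
  - (sigma * weight_front k sigma y z t x) *
      energy_density a c (U t 0 x) (U t 1 x) (H t 0 x) (H t 1 x) +
    weight k sigma y z t x * (- (U t 0 x * mq t 1 x) - H t 0 x * mp t 1 x
      + a * (U t 1 x * mq t 2 x) + c * (H t 1 x * mp t 2 x)
      - U t 0 x * H t 0 x * mq t 1 x - U t 0 x ^+ 2 / 2 * mp t 1 x).

Lemma cdecay_energy t : cdecay k (fun x => weight k sigma y z t x *
  energy_density a c (U t 0 x) (U t 1 x) (H t 0 x) (H t 1 x)).
Proof.
have [dw _ _ _ _] := weight_cdecay y z t k0 s0.
have h0 := tower_cbounded 0 (tU t); have h1 := tower_cbounded 1 (tU t).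
have h2 := tower_cbounded 0 (tH t); have h3 := tower_cbounded 1 (tH t).
by rewrite /energy_density; cdc.
Qed.

(** The majorant is a multiple of [expR (- (k * |x|))]: the weight supplies the decay, the
    mollification the boundedness of every other factor. *)
Lemma is_derive_menergy t0 : is_derive t0 1 menergy (\int[mu]_x menergy_rate t0 x).
Proof.
have [e e0 [M M0 HM]] := H1sqnorm_locally_bounded sol t0.
have bd := moll_locally_bounded sol trho M0 HM.
have [bU0 bH0 bS0 bT0] := bd 0%N; have [bU1 bH1 bS1 bT1] := bd 1%N.
have [bU2 bH2 bS2 bT2] := bd 2%N; have [bU3 bH3 _ _] := bd 3%N; have [bU4 bH4 _ _] := bd 4%N.
have [rU1 rU2] := (@lbounded_resolvent e t0 U 1 tU bU1, @lbounded_resolvent e t0 U 2 tU bU2).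
have [rU3 rU4] := (@lbounded_resolvent e t0 U 3 tU bU3, @lbounded_resolvent e t0 U 4 tU bU4).
have [rH1 rH2] := (@lbounded_resolvent e t0 H 1 tH bH1, @lbounded_resolvent e t0 H 2 tH bH2).
have [rH3 rH4] := (@lbounded_resolvent e t0 H 3 tH bH3, @lbounded_resolvent e t0 H 4 tH bH4).
have [rS1 rS2] := (@lbounded_resolvent e t0 S 1 tS bS1, @lbounded_resolvent e t0 S 2 tS bS2).
have [rT1 rT2] := (@lbounded_resolvent e t0 T 1 tT bT1, @lbounded_resolvent e t0 T 2 tT bT2).
have bp1 : lbounded e t0 (fun t x => mp t 1 x) by rewrite /mp /fluxp; cbv beta; lbd.
have bp2 : lbounded e t0 (fun t x => mp t 2 x) by rewrite /mp /fluxp; cbv beta; lbd.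
have bq1 : lbounded e t0 (fun t x => mq t 1 x) by rewrite /mq /fluxp; cbv beta; lbd.
have bq2 : lbounded e t0 (fun t x => mq t 2 x) by rewrite /mq /fluxp; cbv beta; lbd.
have [dw df] := weight_ldecay e t0 y z k0 s0.
have [C hC] : ldecay e t0 k menergy_rate.
  rewrite /menergy_rate; apply: ldecayD.
    by apply: ldecayM => //; rewrite /energy_density; lbd.
  by apply: ldecayM => //; lbd.
pose f t x := weight k sigma y z t x *
  energy_density a c (U t 0 x) (U t 1 x) (H t 0 x) (H t 1 x).
apply: (@is_derive_integral _ setT f menergy_rate t0 e
  (fun x => C * expR (- (k * `|x|)))) => //.
- by move=> t _; exact: integrable_cdecay (cdecay_energy t).
- move=> t x te _.
  have dwt := is_derive_weight_t k sigma y z t x.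
  have dU0 := is_derive_mU t 0 x; have dU1 := is_derive_mU t 1 x.
  have dH0 := is_derive_mH t 0 x; have dH1 := is_derive_mH t 1 x.
  rewrite /f /energy_density; apply: is_derive_eq; rewrite /GRing.scale/= /menergy_rate.
  rewrite /energy_density; clear.
  move: (U t 0 x) (U t 1 x) (H t 0 x) (H t 1 x) (mq t 1 x) (mq t 2 x) (mp t 1 x) (mp t 2 x).
  move: (weight k sigma y z t x) (weight_front k sigma y z t x) => *; by field.
- exact: (integrableZT C (integrable_expRN_abs k0)).
- by move=> t x te _; exact: hC.
Qed.

Lemma menergy_le (D : R) t : 0 <= t ->
  (forall s, 0 <= s <= t -> \int[mu]_x menergy_rate s x <= D) ->
  menergy t <= menergy 0 + D * t.
Proof.
move=> t0 hD.
have cm : {within `[0, t], continuous menergy}.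
  by apply: continuous_subspaceT; exact: derivable_continuous is_derive_menergy.
have [s st ms] := MVT_segment t0 (fun x _ => is_derive_menergy x) cm.
by rewrite -lerBlDl ms subr0 ler_wpM2r// hD.
Qed.

End EnergyDerivative.

(** * Growth of the weighted energy *)

Section EnergyGrowth.
Context {R : realType}.
Notation mu := (@lebesgue_measure R).
Implicit Types (t x : R) (i : nat).

(* Landau-Kolmogorov type interpolation, by two uses of the mean value theorem on [x, x + 1]. *)
Lemma tower_interpolation (V : nat -> R -> R) (A B : R) x : tower V ->
  (forall x, `|V 0 x| <= A) -> (forall x, `|V 2 x| <= B) -> `|V 1 x| <= 2 * A + B.
Proof.
move=> [dV _] hA hB.
have cV i : continuous (V i) by exact: derivable_continuous (dV i).
have x1 : x <= x + 1 by rewrite lerDl.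
have [xi] := MVT_segment x1 (fun y _ => dV 0 y) (continuous_subspaceT (cV 0)).
rewrite in_itv/= => /andP[xi1 xi2] e1.
have [ze _ e2] := MVT_segment xi1 (fun y _ => dV 1 y) (continuous_subspaceT (cV 1)).
have -> : V 1 x = V 0 (x + 1) - V 0 x - V 2 ze * (xi - x) by rewrite e1 -e2; ring.
apply: le_trans (ler_normB _ _) _; apply: lerD.
  by rewrite mulr2n mulrDl mul1r (le_trans (ler_normB _ _))// lerD.
rewrite normrM -[leRHS]mulr1 ler_pM// ger0_norm ?subr_ge0//.
by rewrite lerBlDl.
Qed.

Lemma commutator_le (s I J : R) : 0 <= I -> 0 <= J -> I <= 1 -> J <= 1 ->
  2 * s ^+ 2 * (1 + I) * (1 + J) <= 8 * s ^+ 2.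
Proof.
move=> I0 J0 I1 J1; have ss := sqr_ge0 s; have s2 : 0 <= 2 * s ^+ 2 by apply: mulr_ge0.
have -> : 8 * s ^+ 2 = 2 * s ^+ 2 * 2 * 2 by ring.
have h1 : 0 <= 1 + I by exact: addr_ge0.
have h2 : 0 <= 1 + J by exact: addr_ge0.
by apply: ler_pM; [exact: mulr_ge0|exact: h2|apply: ler_wpM2l => //; lra|lra].
Qed.

Lemma half_le (X Y : R) : 0 <= Y -> X <= 8 * Y -> 2^-1 * X <= 8 * Y.
Proof. lra. Qed.

Variables (a b c r : R).
Hypotheses (abc : abcd_parameters a b c) (r0 : 0 < r) (rb : r ^- 2 = b).

Let b0 : 0 < b. Proof. by have [] := abc. Qed.

Let E4 : R := expR 4.
Let E4_ge1 : 1 <= E4. Proof. by rewrite -expR0 ler_expR. Qed.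

(** Three contributions: [E4 / s] bounds [f']; [2 E4 / (b s)] bounds [f'''], which is
    [(f' - F') / b] with [F = f - b f'']; and [18 + 18 / b] bounds the first derivative of the
    nonlinear potential. *)
Definition flux_cst : R := E4 * (1 + 2 * (`|a| + `|c|) / b) + 18 + 18 / b.

(** The nonlinear part costs no power of [s]: the first derivative of its potential is interpolated
    between orders 0 and 2, so the mollified product is never differentiated. *)
Lemma flux_bound (al s : R) (F N : nat -> R -> R) x : 0 < s <= 1 -> `|al| <= `|a| + `|c| ->
  tower F -> tower N -> (forall x, `|F 1 x| <= E4 / s) -> (forall x, `|N 0 x| <= 9) ->
  `|fluxp al (fun n => resolvent r (F n)) (fun n => resolvent r (N n)) 1 x| <= flux_cst / s.
Proof.
move=> /andP[s0 s1] hal tF tN hF hN.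
have tf := tower_resolvent r0 tF; have tn := tower_resolvent r0 tN.
have f1 y : `|resolvent r (F 1) y| <= E4 / s.
  by apply: resolvent_bound => //; exact: derivable_continuous (tF.1 1).
have n0 y : `|resolvent r (N 0) y| <= 9.
  by apply: resolvent_bound => //; exact: derivable_continuous (tN.1 0).
have f3 y : `|resolvent r (F 3) y| <= 2 * (E4 / s) / b.
  have := tower_resolvent_eq 1 y r0 tF; rewrite rb => h.
  have -> : resolvent r (F 3) y = (resolvent r (F 1) y - F 1 y) / b.
    by rewrite -[in X in _ - X]h; field; rewrite gt_eqF.
  rewrite normrM [X in _ * X]gtr0_norm ?invr_gt0//; apply: ler_wpM2r; first by rewrite invr_ge0 ltW.
  by rewrite (le_trans (ler_normB _ _))// mulr2n mulrDl mul1r lerD.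
have n2 y : `|resolvent r (N 2) y| <= 18 / b.
  have := tower_resolvent_eq 0 y r0 tN; rewrite rb => h.
  have -> : resolvent r (N 2) y = (resolvent r (N 0) y - N 0 y) / b.
    by rewrite -[in X in _ - X]h; field; rewrite gt_eqF.
  rewrite normrM [X in _ * X]gtr0_norm ?invr_gt0//; apply: ler_wpM2r; first by rewrite invr_ge0 ltW.
  have -> : 18 = 9 + 9 :> R by ring.
  by rewrite (le_trans (ler_normB _ _))// lerD.
have n1 : `|resolvent r (N 1) x| <= 18 + 18 / b.
  have := tower_interpolation x tn n0 n2; by rewrite (_ : 2 * 9 = 18 :> R); [|ring].
have si : 1 <= s^-1 by rewrite invf_ge1.
rewrite /fluxp (le_trans (ler_normD _ _))//.
have -> : flux_cst / s = (E4 / s + (`|a| + `|c|) * (2 * (E4 / s) / b)) + (18 + 18 / b) / s.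
  by rewrite /flux_cst; field; rewrite !gt_eqF.
apply: lerD; last first.
  apply: le_trans n1 _; rewrite ler_peMr// addr_ge0// divr_ge0// ltW//.
by rewrite (le_trans (ler_normD _ _))// lerD// normrM ler_pM.
Qed.

Variables (u eta : R -> R -> R).
Hypothesis (sol : global_H1_solution a b c u eta).
Notation N t := (H1sqnorm (u t) (eta t)).

Let Hu t : H1 (u t). Proof. by have [[/(_ t)[]]] := sol. Qed.
Let He t : H1 (eta t). Proof. by have [[/(_ t)[]]] := sol. Qed.

(** Jensen's inequality and the kernel height [E4 / s^2]; since [1 <= E4], the square root of the
    height is at most [E4 / s]. *)
Lemma moll_L2_le (s : R) rho v x : 0 < s <= 1 -> mollifier (s ^+ 2) rho -> L2 v ->
  \int[mu]_x (v x ^+ 2) <= 1 -> `|moll rho v 0 x| <= E4 / s.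
Proof.
move=> /andP[s0 s1] mr v2 v1.
have E0 : 0 < E4 by rewrite expR_gt0.
rewrite -(@ler_pXn2r _ 2)// ?nnegrE//; last by rewrite divr_ge0 ?(ltW E0) ?(ltW s0).
rewrite real_normK ?num_real//; apply: le_trans (moll_sqr_le _ mr v2) _.
have [trho rle _ _ _] := mr.
have i2 := L2_integrable_sqr v2.
have mrho : measurable_fun setT (fun y : R => rho (x - y)).
  by apply: measurable_reflect; have := test_measurable 0 trho; rewrite derive1n0.
apply: (@le_trans _ _ (\int[mu]_y (E4 / s ^+ 2 * v y ^+ 2))).
  apply: le_Rintegral => //.
  - apply: (@integrable_dominated _ _ _ (fun y => E4 / s ^+ 2 * v y ^+ 2)) => //.
    + by apply: measurable_funM => //; apply: measurable_funX; exact: L2_measurable.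
    + exact: integrableZT.
    + move=> y _; have /andP[h1 h2] := rle (x - y).
      have vr : 0 <= v y ^+ 2 * rho (x - y) by apply: mulr_ge0 => //; exact: sqr_ge0.
      by rewrite ger0_norm// mulrC ler_wpM2r ?sqr_ge0.
  - exact: integrableZT.
  - by move=> y _; have /andP[_ h2] := rle (x - y); rewrite mulrC ler_wpM2r ?sqr_ge0.
rewrite RintegralZT// exprMn exprVn.
apply: (@le_trans _ _ (E4 / s ^+ 2)).
  by rewrite ler_piMr// divr_ge0 ?sqr_ge0// ltW.
by rewrite ler_wpM2r ?invr_ge0 ?sqr_ge0// expr2 ler_peMr// ltW.
Qed.

Variables (K sigma eps nu k y z : R).
Hypothesis HK : ediag_dominates a b c K.
Hypotheses (K1 : 1 <= K) (s0 : 0 <= sigma) (e0 : 0 < eps) (e1 : eps <= 1)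
  (nu01 : 0 < nu <= 1) (k0 : 0 < k) (kb : 6 * b + 3 <= k^-1).
Let kappa := (1 + b - a - c) / nu * (1 + (2 * b)^-1).
Hypothesis coef : 1 + (1 + b - a - c) * nu * K + sigma * eps * K / 2 +
  3 * (1 + sigma) * K / k^-1 + 5 * kappa * eps ^+ 2 * K <= sigma.

Lemma Rintegral_weight_le T t : 0 <= t <= T ->
  \int[mu]_x weight k sigma y z t x <=
  expR (k * (`|y| + `|z| + sigma * T)) * \int[mu]_x expR (- (k * `|x|)).
Proof.
move=> /andP[t0 tT]; have [dw _ _ _ _] := weight_cdecay y z t k0 s0.
have ie := integrable_expRN_abs k0.
rewrite -RintegralZT//; apply: le_Rintegral => //.
- exact: integrable_cdecay dw.
- exact: integrableZT.
move=> x _; apply: le_trans (weight_expR_le y z k0 s0 t x) _.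
rewrite ler_wpM2r ?expR_ge0// ler_expR; apply: ler_wpM2l; first exact: ltW.
by rewrite lerD2l ger0_norm// ler_wpM2l.
Qed.

Let kap0 : 0 <= kappa.
Proof.
have [_ a0 c0 _] := abc; have /andP[nu0 _] := nu01.
have h : 0 <= 1 + b - a - c by apply: addr_ge0; [apply: addr_ge0; [apply: addr_ge0 (ltW b0)|]|]; rewrite ?oppr_ge0 ?ltW.
rewrite /kappa; apply: mulr_ge0; first by apply: divr_ge0 => //; exact: ltW.
by apply: addr_ge0 => //; rewrite invr_ge0; apply: mulr_ge0 => //; exact: ltW.
Qed.

Lemma flux_cst_ge0 : 0 <= flux_cst.
Proof.
have b0' := ltW b0; have h0 : 0 <= 2 * (`|a| + `|c|) / b.
  by apply: divr_ge0 => //; apply: mulr_ge0 => //; apply: addr_ge0.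
apply: addr_ge0; last exact: divr_ge0.
by apply: addr_ge0 => //; apply: mulr_ge0; [exact: expR_ge0|exact: addr_ge0].
Qed.

(** The constant may depend on [T], [y] and [z], but neither on the scale [s] nor on the mollifier,
    so the error vanishes in the limit. *)
Lemma menergy_growth T : 0 <= T -> (forall t, 0 <= t <= T -> N t <= eps ^+ 2 / 2) ->
  exists2 C : R, 0 <= C & forall s rho, 0 < s <= 1 -> mollifier (s ^+ 2) rho ->
  menergy a c u eta rho k sigma y z T <= menergy a c u eta rho k sigma y z 0 + C * s.
Proof.
move=> T0 HN.
pose W := expR (k * (`|y| + `|z| + sigma * T)) * \int[mu]_x expR (- (k * `|x|)).
have W0 : 0 <= W.
  by rewrite mulr_ge0 ?expR_ge0//; apply: Rintegral_ge0 => x _; exact: expR_ge0.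
have F0 := flux_cst_ge0.
pose C := (8 * 64 * kappa * k + 16 * flux_cst) * W.
have C0 : 0 <= C.
  apply: mulr_ge0 W0; apply: addr_ge0; last exact: (mulr_ge0 (ler0n _ _) F0).
  exact: (mulr_ge0 (mulr_ge0 (mulr_ge0 (ler0n _ _) (ler0n _ _)) kap0) (ltW k0)).
exists (C * T) => [|s rho s01 mr]; first exact: mulr_ge0.
have [trho _ _ _ _] := mr.
rewrite mulrAC; apply: (menergy_le r0 rb sol trho k0 s0 T0) => t tT.
have /andP[sp s1] := s01.
have Nt := HN t tT; have [u1 [e1' [u1' [e1'' [us es]]]]] := H1sqnorm_ge (Hu t) (He t).
have eps2 : eps ^+ 2 <= 1 by rewrite exprn_ile1// ltW.
have N1 : N t <= 1 by rewrite (le_trans Nt)// ler_pdivrMr// mul1r (le_trans eps2)// ler1n.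
(* The right side of [moll_sobolev] is at most [2 * N t]; this is the reason for the threshold
   [eps^2 / 2]. *)
have N2 : 2 * N t <= eps ^+ 2 by rewrite mulrC -ler_pdivlMr.
have [ux2 wu] := weak_derivativeP (Hu t); have [ex2 we] := weak_derivativeP (He t).
have [[u2 _] [e2 _]] := (Hu t, He t).
have sq (v w : R) : v ^+ 2 <= w -> w <= eps ^+ 2 -> `|v| <= eps.
  by move=> h1 h2; rewrite -(@ler_pXn2r _ 2) ?nnegrE ?normr_ge0 ?(ltW e0)// real_normK ?num_real// (le_trans h1 h2).
have Ue x : `|mU u rho t 0 x| <= eps.
  by apply: sq (moll_sobolev x mr u2 ux2 wu) _; exact: le_trans us _.
have He' x : `|mH eta rho t 0 x| <= eps.
  by apply: sq (moll_sobolev x mr e2 ex2 we) _; exact: le_trans es _.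
have pos (h : R -> R) : 0 <= \int[mu]_x (h x ^+ 2).
  by apply: Rintegral_ge0 => x _; exact: sqr_ge0.
have hS x : `|mS u eta rho t 0 x - mU u rho t 0 x * mH eta rho t 0 x| <= 8 * s ^+ 2.
  apply: le_trans (moll_commutator x sp mr u2 ux2 wu e2 ex2 we) _.
  by apply: commutator_le => //; [exact: le_trans u1' _|exact: le_trans e1'' _].
have hT x : `|mT u rho t 0 x - mU u rho t 0 x ^+ 2 / 2| <= 8 * s ^+ 2.
  have i2 := integrable_locint (L2_integrable_mul u2 u2).
  have -> : mT u rho t 0 x = 2^-1 * moll rho (fun y => u t y * u t y) 0 x.
    by rewrite -mollZ// /mT; congr moll; apply/funext => w; rewrite expr2 mulrC.
  rewrite expr2 [_ / 2]mulrC -mulrBr normrM ger0_norm//.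
  apply: half_le; first exact: sqr_ge0.
  apply: le_trans (moll_commutator x sp mr u2 ux2 wu u2 ux2 wu) _.
  by apply: commutator_le => //; exact: le_trans u1' _.
have s21 : 8 * s ^+ 2 <= 8 by rewrite ler_piMr// exprn_ile1// ltW.
(* The commutator contributes at most 8, the product of the mollified functions at most 1. *)
have S9 x : `|mS u eta rho t 0 x| <= 9.
  rewrite -[mS _ _ _ _ _ _](subrK (mU u rho t 0 x * mH eta rho t 0 x)).
  apply: le_trans (ler_normD _ _) _; have -> : 9 = 8 + 1 * 1 :> R by ring.
  apply: lerD; first exact: le_trans (hS x) _.
  by rewrite normrM ler_pM// (le_trans (Ue x), le_trans (He' x)).
have T9 x : `|mT u rho t 0 x| <= 9.
  rewrite -[mT _ _ _ _ _](subrK (mU u rho t 0 x ^+ 2 / 2)).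
  apply: le_trans (ler_normD _ _) _; have -> : 9 = 8 + 1 * 1 :> R by ring.
  apply: lerD; first exact: le_trans (hT x) _.
  rewrite normrM ler_pM//; last by rewrite ger0_norm// invf_le1// ler1n.
  by rewrite normrX exprn_ile1// (le_trans (Ue x)).
have U1 x : `|mU u rho t 1 x| <= E4 / s.
  rewrite /mU (moll_weak 0 x trho (L2_locint u2) wu).
  by apply: (moll_L2_le _ s01 mr) => //; exact: le_trans u1' _.
have H1' x : `|mH eta rho t 1 x| <= E4 / s.
  rewrite /mH (moll_weak 0 x trho (L2_locint e2) we).
  by apply: (moll_L2_le _ s01 mr) => //; exact: le_trans e1'' _.
have tU := tower_mU sol trho t; have tH := tower_mH sol trho t.
have tS := tower_mS sol trho t; have tT' := tower_mT sol trho t.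
have hp x : `|mp a r u eta rho t 1 x| <= flux_cst / s.
  by apply: flux_bound => //; rewrite lerDl.
have hq x : `|mq c r u eta rho t 1 x| <= flux_cst / s.
  by apply: flux_bound => //; rewrite lerDr.
apply: le_trans (energy_rate_le y z t abc r0 rb HK K1 s0 e0 nu01 k0 kb coef
  tU tH tS tT' Ue He' hS hT hp hq) _.
have Wt := Rintegral_weight_le tT.
have w0 : 0 <= \int[mu]_x weight k sigma y z t x.
  by apply: Rintegral_ge0 => x _; rewrite ltW// weight_gt0.
have h1 : 0 <= 8 * 64 * kappa * k.
  exact: (mulr_ge0 (mulr_ge0 (mulr_ge0 (ler0n _ _) (ler0n _ _)) kap0) (ltW k0)).
have h2 : 0 <= 16 * flux_cst * s by exact: (mulr_ge0 (mulr_ge0 (ler0n _ _) F0) (ltW sp)).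
(* The commutator bound [8 s^2] multiplied by the flux bound [flux_cst / s] still leaves one power
   of [s]. *)
have -> : 8 * kappa * k * (8 * s ^+ 2) ^+ 2 + 2 * (8 * s ^+ 2) * (flux_cst / s) =
    8 * 64 * kappa * k * s ^+ 4 + 16 * flux_cst * s.
  by move: kappa flux_cst => *; field; rewrite gt_eqF.
have -> : C * s = (8 * 64 * kappa * k * s + 16 * flux_cst * s) * W by rewrite /C; ring.
have s4 : s ^+ 4 <= s by rewrite -[leRHS]expr1 ler_wiXn2l// ltW.
apply: (ler_pM _ w0 _ Wt); last by rewrite lerD2r ler_wpM2l.
by apply: addr_ge0 h2; apply: mulr_ge0 h1 _; rewrite exprn_ge0// ltW.
Qed.

End EnergyGrowth.

(** * The weighted estimate *)

Section WeightedEstimate.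
Context {R : realType}.
Notation mu := (@lebesgue_measure R).
Implicit Types (t x : R) (n : nat).

(** At the final time only an upper bound on the limit is needed, so Fatou's lemma with almost
    everywhere convergence replaces L^2 convergence of the mollifications. *)
Lemma Rintegral_fatou_le (gs : nat -> R -> R) (g : R -> R) (v : nat -> R) (M : R) :
  (forall n, mu.-integrable setT (EFin \o gs n)) -> (forall n x, 0 <= gs n x) ->
  mu.-integrable setT (EFin \o g) -> (forall x, 0 <= g x) ->
  {ae mu, forall x, gs n x @[n --> \oo] --> g x} ->
  (forall n, \int[mu]_x gs n x <= v n) -> v n @[n --> \oo] --> M ->
  \int[mu]_x g x <= M.
Proof.
move=> igs gs0 ig g0 cg gv vM.
rewrite -lee_fin /Rintegral fineK; last exact: integrable_fin_num ig.
have mgs n : measurable_fun setT (EFin \o gs n) by case/integrableP : (igs n).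
have -> : (\int[mu]_x (g x)%:E = \int[mu]_x limn_einf (fun n => (gs n x)%:E))%E.
  apply: ae_eq_integral => //.
  - by case/integrableP : ig.
  - apply: (measurableT_comp (@oppe_measurable _ setT)).
    apply: measurable_fun_limn_esup => n.
    by apply: (measurableT_comp _ (mgs n)); exact: oppe_measurable.
  apply: ae_mono cg => x cx _.
  have cE : (gs n x)%:E @[n --> \oo] --> (g x)%:E by apply: cvg_EFin => //; exact: nearW.
  by rewrite (cvg_limn_einf_sup cE).1.
apply: le_trans (fatou mu measurableT mgs _) _; first by move=> n x _; rewrite lee_fin.
have vE : (v n)%:E @[n --> \oo] --> M%:E by apply: cvg_EFin => //; exact: nearW.
rewrite limn_einf_lim -(cvg_lim _ vE)//; apply: lee_lim.
- exact: is_cvg_einfs.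
- by apply: cvgP vE.
apply: nearW => n; apply: (@le_trans _ _ (\int[mu]_x (gs n x)%:E)%E).
  by apply: ereal_inf_lbound; exists n => /=.
rewrite -(fineK (integrable_fin_num _ (igs n)))// lee_fin.
exact: gv.
Qed.

Lemma Rintegral_moll_weighted (h K : R) (rho v w : R -> R) : mollifier h rho -> L2 v ->
  continuous w -> (forall x, 0 <= w x <= 1) -> 0 <= K ->
  (forall x y, `|x - y| <= h -> w x <= K * w y) ->
  [/\ mu.-integrable setT (EFin \o (fun x => w x * moll rho v 0 x ^+ 2)),
      mu.-integrable setT (EFin \o (fun x => w x * v x ^+ 2)) &
  \int[mu]_x (w x * moll rho v 0 x ^+ 2) <= K * \int[mu]_x (w x * v x ^+ 2)].
Proof.
move=> mr v2 cw w01 K0 wK.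
have mw : measurable_fun setT w by exact: continuous_measurable_fun.
have [trho _ _ _ _] := mr.
have dom (f : R -> R) : measurable_fun setT f -> mu.-integrable setT (EFin \o (fun x => f x ^+ 2)) ->
    mu.-integrable setT (EFin \o (fun x => w x * f x ^+ 2)).
  move=> mf if2; apply: (integrable_dominated measurableT _ if2).
    by apply: measurable_funM => //; exact: measurable_funX.
  move=> x _; have /andP[w0 w1] := w01 x.
  by rewrite normrM [`|w x|]ger0_norm// [`|_ ^+ 2|]ger0_norm ?sqr_ge0// ler_piMl// sqr_ge0.
have i1 := dom _ (moll_measurable 0 trho (L2_locint v2)) (integrable_moll_sqr mr v2).
have i2 := dom _ (L2_measurable v2) (L2_integrable_sqr v2).
split => //.
have i3 := integrableZT K i2; rewrite -RintegralZT//.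
rewrite -lee_fin /Rintegral !fineK; [|exact: integrable_fin_num i3|exact: integrable_fin_num i1].
by apply: (moll_weighted mr v2 mw _ K0 wK) => x; have /andP[] := w01 x.
Qed.


Lemma integrable_weight_H1density (k s y z t : R) (f g : R -> R) : H1 f -> H1 g ->
  mu.-integrable setT (EFin \o (fun x => weight k s y z t x * H1density f g x)).
Proof.
move=> Hf Hg; have iD := integrable_H1density Hf Hg.
have cw := derivable_continuous (is_derive_weight_x k s y z t).
have mD : measurable_fun setT (H1density f g) by case/integrableP : iD => /measurable_EFinP.
apply: (integrable_dominated measurableT _ iD).
  by apply: measurable_funM => //; exact: continuous_measurable_fun.
move=> x _; have w0 := weight_gt0 k s y z t x; have D0 := H1density_ge0 f g x.
by rewrite normrM (ger0_norm D0) gtr0_norm// ler_piMl// weight_le1.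
Qed.

(** With [|H| <= 1/2] the cubic term takes away at most half of [U^2]. *)
Lemma energy_density_bounds (a c al be U U1 H H1 : R) : 0 < al <= 1 -> al <= - a -> al <= - c ->
  1 <= be -> - a <= be -> - c <= be -> `|H| <= 2^-1 ->
  let D := U ^+ 2 + U1 ^+ 2 + H ^+ 2 + H1 ^+ 2 in
  D <= 4 / al * energy_density a c U U1 H H1 /\ energy_density a c U U1 H H1 <= be * D.
Proof.
move=> /andP[al0 al1] ala alc be1 bea bec hH D.
have := sqr_ge0 U; have := sqr_ge0 U1; have := sqr_ge0 H; have := sqr_ge0 H1.
rewrite /D /energy_density.
have /andP[h1 h2] : - 2^-1 <= H <= 2^-1 by rewrite -ler_norml.
move: (U ^+ 2) (U1 ^+ 2) (H ^+ 2) (H1 ^+ 2) => X1 X2 X3 X4 P4 P3 P2 P1.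
split; last first.
  have k1 : X1 * H <= X1 * 2^-1 by rewrite ler_wpM2l.
  have k2 : - a * X2 <= be * X2 by rewrite ler_wpM2r.
  have k3 : - c * X4 <= be * X4 by rewrite ler_wpM2r.
  have k4 : 1 * X1 <= be * X1 by rewrite ler_wpM2r.
  have k5 : 1 * X3 <= be * X3 by rewrite ler_wpM2r.
  have k6 : 0 <= be * X2 by rewrite mulr_ge0// (le_trans ler01).
  have k7 : 0 <= be * X4 by rewrite mulr_ge0// (le_trans ler01).
  move: k1 k2 k3 k4 k5 k6 k7 P1 P2 P3 P4; clear; lra.
have -> : 4 / al * ((X1 + X3 - a * X2 - c * X4 + X1 * H) / 2) =
    2 * (X1 + X3 - a * X2 - c * X4 + X1 * H) / al by field; rewrite gt_eqF.
rewrite ler_pdivlMr//.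
have k1 : X1 * - 2^-1 <= X1 * H by rewrite ler_wpM2l.
have k2 : al * X2 <= - a * X2 by rewrite ler_wpM2r.
have k3 : al * X4 <= - c * X4 by rewrite ler_wpM2r.
have k4 : al * X1 <= 1 * X1 by rewrite ler_wpM2r.
have k5 : al * X3 <= 1 * X3 by rewrite ler_wpM2r.
have k6 : 0 <= al * X2 by rewrite mulr_ge0// ltW.
have k7 : 0 <= al * X4 by rewrite mulr_ge0// ltW.
move: k1 k2 k3 k4 k5 k6 k7 P1 P2 P3 P4; clear.
have e : (X1 + X2 + X3 + X4) * al = al * X1 + al * X2 + al * X3 + al * X4 by ring.
by rewrite e; lra.
Qed.

Variables (a b c r : R).
Hypotheses (abc : abcd_parameters a b c) (r0 : 0 < r) (rb : r ^- 2 = b).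
Variables (u eta : R -> R -> R).
Hypothesis (sol : global_H1_solution a b c u eta).
Notation N t := (H1sqnorm (u t) (eta t)).
Let Hu t : H1 (u t). Proof. by have [[/(_ t)[]]] := sol. Qed.
Let He t : H1 (eta t). Proof. by have [[/(_ t)[]]] := sol. Qed.

Variables (K sigma eps nu k y z al be : R).
Hypothesis HK : ediag_dominates a b c K.
Hypotheses (K1 : 1 <= K) (s0 : 0 <= sigma) (e0 : 0 < eps) (e1 : eps <= 2^-1)
  (nu01 : 0 < nu <= 1) (k0 : 0 < k) (kb : 6 * b + 3 <= k^-1).
Let kappa := (1 + b - a - c) / nu * (1 + (2 * b)^-1).
Hypothesis coef : 1 + (1 + b - a - c) * nu * K + sigma * eps * K / 2 +
  3 * (1 + sigma) * K / k^-1 + 5 * kappa * eps ^+ 2 * K <= sigma.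
Hypotheses (al01 : 0 < al <= 1) (ala : al <= - a) (alc : al <= - c)
  (be1 : 1 <= be) (bea : - a <= be) (bec : - c <= be).

Let w t x := weight k sigma y z t x.
Let cw t : continuous (w t).
Proof. exact: derivable_continuous (is_derive_weight_x k sigma y z t). Qed.
Let w01 t x : 0 <= w t x <= 1.
Proof. by rewrite weight_le1 ltW// weight_gt0. Qed.

Let mdens rho t x := mU u rho t 0 x ^+ 2 + mU u rho t 1 x ^+ 2 +
  mH eta rho t 0 x ^+ 2 + mH eta rho t 1 x ^+ 2.

Let mdens_le (s : R) rho t : 0 < s <= 1 -> mollifier (s ^+ 2) rho ->
  mu.-integrable setT (EFin \o (fun x => w t x * mdens rho t x)) /\
  \int[mu]_x (w t x * mdens rho t x) <=
    expR k * \int[mu]_x (w t x * H1density (u t) (eta t) x).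
Proof.
move=> /andP[sp s1] mr; have [trho _ _ _ _] := mr.
have [ux2 wu] := weak_derivativeP (Hu t); have [ex2 we] := weak_derivativeP (He t).
have [[u2 _] [e2 _]] := (Hu t, He t).
have s2 : s ^+ 2 <= 1 by rewrite exprn_ile1// ltW.
(* The mollification scale is at most 1, so the weight varies by a factor at most [expR k] across
   it, uniformly in the scale. *)
have wslow x x' : `|x - x'| <= s ^+ 2 -> w t x <= expR k * w t x'.
  move=> h; have h1 : `|x - x'| <= 1 by exact: le_trans h s2.
  by rewrite -[k in expR k]mulr1; apply: weight_slow.
have ek : 0 <= expR k by exact: expR_ge0.
have [i1 j1 l1] := Rintegral_moll_weighted mr u2 (@cw t) (w01 t) ek wslow.
have [i2 j2 l2] := Rintegral_moll_weighted mr ux2 (@cw t) (w01 t) ek wslow.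
have [i3 j3 l3] := Rintegral_moll_weighted mr e2 (@cw t) (w01 t) ek wslow.
have [i4 j4 l4] := Rintegral_moll_weighted mr ex2 (@cw t) (w01 t) ek wslow.
have E1 : (fun x => w t x * mdens rho t x) = (fun x =>
    w t x * moll rho (u t) 0 x ^+ 2 + w t x * moll rho (weak_derivative (u t)) 0 x ^+ 2 +
    w t x * moll rho (eta t) 0 x ^+ 2 + w t x * moll rho (weak_derivative (eta t)) 0 x ^+ 2).
  apply/funext => x; rewrite /mdens /mU /mH (moll_weak 0 x trho (L2_locint u2) wu).
  by rewrite (moll_weak 0 x trho (L2_locint e2) we) !mulrDr.
have E2 : (fun x => w t x * H1density (u t) (eta t) x) = (fun x =>
    w t x * u t x ^+ 2 + w t x * weak_derivative (u t) x ^+ 2 +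
    w t x * eta t x ^+ 2 + w t x * weak_derivative (eta t) x ^+ 2).
  by apply/funext => x; rewrite /H1density !mulrDr.
have i12 := integrableDT i1 i2; have i123 := integrableDT i12 i3.
have j12 := integrableDT j1 j2; have j123 := integrableDT j12 j3.
rewrite E1 E2; split; first exact: integrableDT i123 i4.
rewrite (RintegralDT i123 i4) (RintegralDT i12 i3) (RintegralDT i1 i2).
rewrite (RintegralDT j123 j4) (RintegralDT j12 j3) (RintegralDT j1 j2).
rewrite !mulrDr; exact: lerD (lerD (lerD l1 l2) l3) l4.
Qed.

(** The factor [4 / al] is the coercivity of the energy at time [T], [be] its upper bound at time 0,
    and [expR k] the cost of removing the mollification at time 0. *)
Lemma weighted_estimate T : 0 <= T -> (forall t, 0 <= t <= T -> N t <= eps ^+ 2 / 2) ->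
  \int[mu]_x (w T x * H1density (u T) (eta T) x) <=
  4 / al * be * expR k * \int[mu]_x (w 0 x * H1density (u 0) (eta 0) x).
Proof.
move=> T0 HN; have /andP[al0 al1] := al01.
have e1' : eps <= 1 by apply: le_trans e1 _; rewrite invf_le1// ler1n.
have [C C0 HC] := menergy_growth abc r0 rb sol y z HK K1 s0 e0 e1' nu01 k0 kb coef T0 HN.
have [s [rhos [s01 scv mr]]] := @mollifier_sequence R.
have trho n : test_function (rhos n) by have [] := mr n.
have He' n t x : 0 <= t <= T -> `|mH eta (rhos n) t 0 x| <= 2^-1.
  move=> tT; have [e2 _] := He t; have [ex2 we] := weak_derivativeP (He t).
  have [_ [_ [_ [_ [_ es]]]]] := H1sqnorm_ge (Hu t) (He t).
  apply: le_trans e1; rewrite -(@ler_pXn2r _ 2) ?nnegrE ?normr_ge0 ?(ltW e0)//.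
  rewrite real_normK ?num_real// (le_trans (moll_sobolev x (mr n) e2 ex2 we))//.
  by rewrite (le_trans es)// mulrC -ler_pdivlMr// HN.
pose en n t x := energy_density a c (mU u (rhos n) t 0 x) (mU u (rhos n) t 1 x)
  (mH eta (rhos n) t 0 x) (mH eta (rhos n) t 1 x).
have ien n t : mu.-integrable setT (EFin \o (fun x => w t x * en n t x)).
  exact: integrable_cdecay k0 (cdecay_energy sol (trho n) y z k0 s0 t).
have bnd n t x tT := energy_density_bounds (mU u (rhos n) t 0 x) (mU u (rhos n) t 1 x)
  (mH eta (rhos n) t 1 x) al01 ala alc be1 bea bec (He' n t x tT).
have tT0 : 0 <= (0 : R) <= T by rewrite lexx.
have tTT : 0 <= T <= T by rewrite T0 lexx.
have wp t x : 0 <= w t x by have /andP[] := w01 t x.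
pose M := 4 / al * be * expR k * \int[mu]_x (w 0 x * H1density (u 0) (eta 0) x).
apply: (@Rintegral_fatou_le (fun n x => w T x * mdens (rhos n) T x) _
   (fun n => M + 4 / al * C * s n)).
- by move=> n; have [] := mdens_le T (s01 n) (mr n).
- by move=> n x; apply: mulr_ge0 => //; rewrite /mdens !addr_ge0 ?sqr_ge0.
- exact: integrable_weight_H1density.
- by move=> x; apply: mulr_ge0 => //; exact: H1density_ge0.
- have [ux2 wu] := weak_derivativeP (Hu T); have [ex2 we] := weak_derivativeP (He T).
  have [[u2 _] [e2 _]] := (Hu T, He T).
  have c1 := ae_cvg_moll s01 scv mr (L2_locint u2).
  have c2 := ae_cvg_moll s01 scv mr (L2_locint ux2).
  have c3 := ae_cvg_moll s01 scv mr (L2_locint e2).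
  have c4 := ae_cvg_moll s01 scv mr (L2_locint ex2).
  apply: ae_mono (ae_and (ae_and c1 c2) (ae_and c3 c4)) => x [[d1 d2] [d3 d4]].
  have -> : (fun n => w T x * mdens (rhos n) T x) = (fun n => w T x *
    (moll (rhos n) (u T) 0 x ^+ 2 + moll (rhos n) (weak_derivative (u T)) 0 x ^+ 2 +
     moll (rhos n) (eta T) 0 x ^+ 2 + moll (rhos n) (weak_derivative (eta T)) 0 x ^+ 2)).
    apply/funext => n; rewrite /mdens /mU /mH (moll_weak 0 x (trho n) (L2_locint u2) wu).
    by rewrite (moll_weak 0 x (trho n) (L2_locint e2) we).
  have sq (v : nat -> R) (l : R) : v n @[n --> \oo] --> l -> v n ^+ 2 @[n --> \oo] --> l ^+ 2.
    by move=> vl; rewrite expr2; under eq_fun do rewrite expr2; exact: cvgM.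
  by apply: cvgM; [exact: cvg_cst|apply: cvgD; [apply: cvgD; [apply: cvgD|]|]; exact: sq].
- move=> n.
  apply: (@le_trans _ _ (4 / al * \int[mu]_x (w T x * en n T x))).
    rewrite -RintegralZT//; apply: le_Rintegral => //.
    + by have [] := mdens_le T (s01 n) (mr n).
    + exact: integrableZT.
    + by move=> x _; rewrite mulrCA ler_wpM2l//; have [] := bnd n T x tTT.
  rewrite /M -!mulrA -!mulrDr; apply: ler_wpM2l => //; apply: ler_wpM2l; first by rewrite invr_ge0 ltW.
  apply: le_trans (HC _ _ (s01 n) (mr n)) _; rewrite lerD2r.
  have [j1 j2] := mdens_le 0 (s01 n) (mr n).
  have be0 : 0 <= be by apply: le_trans be1.
  apply: le_trans (ler_wpM2l be0 j2); rewrite -RintegralZT//; apply: le_Rintegral => //.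
  + exact: ien.
  + exact: integrableZT.
  + move=> x _; rewrite [leRHS]mulrCA; apply: ler_wpM2l; first exact: wp 0 x.
    by have [] := bnd n 0 x tT0.
- rewrite -/M -[X in _ --> X]addr0 -[X in M + X](mulr0 (4 / al * C)).
  by apply: cvgD; [exact: cvg_cst|apply: cvgM; [exact: cvg_cst|]].
Qed.

End WeightedEstimate.

(** * Small solutions *)

Section SmallSolutions.
Context {R : realType}.
Notation mu := (@lebesgue_measure R).
Implicit Types (t x : R) (n : nat).

Lemma small_factor (X M th : R) : 0 <= X -> 0 < M -> 0 < th ->
  exists2 e : R, 0 < e <= M & X * e <= th.
Proof.
move=> X0 M0 th0; have X1 : 0 < X + 1 by rewrite ltr_pwDr.
(* Dividing by [X + 1] covers the case [X = 0]. *)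
exists (Num.min M (th / (X + 1))).
  by rewrite lt_min M0 divr_gt0//= ge_min lexx.
apply: (@le_trans _ _ (X * (th / (X + 1)))).
  by rewrite ler_wpM2l// ge_min lexx orbT.
by rewrite mulrA ler_pdivrMr// mulrC; apply: ler_wpM2l; [exact: ltW|rewrite lerDl].
Qed.

Lemma integrable_restrict (I : set R) (f : R -> R) : measurable I ->
  mu.-integrable setT (EFin \o f) -> mu.-integrable setT (EFin \o (f \_ I)).
Proof.
move=> mI fi; rewrite -restrict_EFin.
by apply: (proj1 (@integrable_mkcond _ _ _ mu I _ mI)); apply: integrableS fi.
Qed.

Definition weighted_control (u eta : R -> R -> R) (k sigma C e : R) :=
  forall y z T, 0 <= T -> (forall t, 0 <= t <= T -> H1sqnorm (u t) (eta t) <= e) ->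
  \int[mu]_x (weight k sigma y z T x * H1density (u T) (eta T) x) <=
  C * \int[mu]_x (weight k sigma y z 0 x * H1density (u 0) (eta 0) x).

Lemma weighted_control_exists (a b c sigma : R) : abcd_parameters a b c -> 1 < sigma ->
  exists k C e : R, [/\ 0 < k, 1 <= C, 0 < e & forall u eta,
    global_H1_solution a b c u eta -> weighted_control u eta k sigma C e].
Proof.
move=> abc s1; have [b0 a0 c0 _] := abc.
have [K K1 HK] := ediag_bounds abc.
(* Three groups of terms each receive a quarter of the gap [sigma - 1]. The choice of [nu] precedes
   that of [eps], because [kappa] depends on [nu]. *)
pose th := (sigma - 1) / 4; have th0 : 0 < th by rewrite divr_gt0// subr_gt0.
have s0 : 0 <= sigma by rewrite ltW// (lt_trans ltr01).
have K0 : 0 <= K by rewrite (le_trans ler01).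
pose A := 1 + b - a - c; have A0 : 0 <= A by rewrite /A; lra.
have [nu /andP[nu0 nu1] hnu] := small_factor (mulr_ge0 A0 K0) ltr01 th0.
have kb0 : 0 < 6 * b + 3 by lra.
have [k /andP[k0 k1] hk] := @small_factor (3 * (1 + sigma) * K) (6 * b + 3)^-1 th
  (mulr_ge0 (mulr_ge0 (ler0n _ 3) (addr_ge0 ler01 s0)) K0) (eqbRL (invr_gt0 _) kb0) th0.
pose kappa := A / nu * (1 + (2 * b)^-1).
have kap0 : 0 <= kappa.
  apply: mulr_ge0; first by apply: divr_ge0 => //; exact: ltW.
  by apply: addr_ge0 => //; rewrite invr_ge0 mulr_ge0// ltW.
have h2 : 0 < 2^-1 :> R by [].
have [eps /andP[e0 e1] he] := @small_factor (sigma * K / 2 + 5 * kappa * K) 2^-1 th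
  (addr_ge0 (divr_ge0 (mulr_ge0 s0 K0) (ler0n _ 2)) (mulr_ge0 (mulr_ge0 (ler0n _ 5) kap0) K0)) h2 th0.
have kb : 6 * b + 3 <= k^-1 by rewrite -[leLHS]invrK lef_pV2// posrE invr_gt0.
have coef : 1 + A * nu * K + sigma * eps * K / 2 + 3 * (1 + sigma) * K / k^-1 +
    5 * kappa * eps ^+ 2 * K <= sigma.
  rewrite invrK.
  have g1 : 5 * kappa * eps ^+ 2 * K <= 5 * kappa * K * eps.
    have -> : 5 * kappa * eps ^+ 2 * K = 5 * kappa * K * eps * eps by ring.
    apply: ler_piMr; last by apply: le_trans e1 _; rewrite invf_le1// ler1n.
    exact: (mulr_ge0 (mulr_ge0 (mulr_ge0 (ler0n _ 5) kap0) K0) (ltW e0)).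
  have g2 : A * nu * K = A * K * nu by ring.
  have g3 : (sigma * K / 2 + 5 * kappa * K) * eps = sigma * eps * K / 2 + 5 * kappa * K * eps by ring.
  have g4 : sigma = 1 + 4 * th by rewrite /th; field.
  rewrite g3 in he; move: th0 g1 g2 hnu hk he g4.
  move: (5 * kappa * eps ^+ 2 * K) (5 * kappa * K * eps) (A * nu * K) (A * K * nu)
    (sigma * eps * K / 2) (3 * (1 + sigma) * K * k).
  by clearbody th; clear; move=> *; lra.
pose r := (Num.sqrt b)^-1; have r0 : 0 < r by rewrite invr_gt0 sqrtr_gt0.
have rb : r ^- 2 = b by rewrite /r exprVn invrK sqr_sqrtr// ltW.
pose al := Num.min 1 (Num.min (- a) (- c)); pose be := Num.max 1 (Num.max (- a) (- c)).
have al01 : 0 < al <= 1 by rewrite /al !lt_min ltr01 !oppr_gt0 a0 c0/= ge_min lexx.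
have ala : al <= - a by rewrite !ge_min lexx !orbT.
have alc : al <= - c by rewrite !ge_min lexx !orbT.
have be1 : 1 <= be by rewrite le_max lexx.
have bea : - a <= be by rewrite !le_max lexx !orbT.
have bec : - c <= be by rewrite !le_max lexx !orbT.
exists k, (4 / al * be * expR k), (eps ^+ 2 / 2); split => //.
- have /andP[al0 al1] := al01.
  have e4 : 1 <= 4 / al by rewrite ler_pdivlMr// mul1r (le_trans al1)// ler1n.
  have ek : 1 <= expR k by rewrite -expR0 ler_expR ltW.
  by apply: mulr_ege1 => //; apply: mulr_ege1.
- by rewrite divr_gt0// exprn_gt0.
move=> u eta sol y z T T0 HN.
by apply: (weighted_estimate abc r0 rb sol y z HK K1 s0 e0 e1 _ k0 kb coef) => //; rewrite nu0.
Qed.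

Variables (u eta : R -> R -> R) (k sigma C e : R).
Hypotheses (sol : H1_continuous u eta) (k0 : 0 < k) (C1 : 1 <= C) (e0 : 0 < e).
Hypothesis ctrl : weighted_control u eta k sigma C e.
Notation N t := (H1sqnorm (u t) (eta t)).
Notation D t := (H1density (u t) (eta t)).

Let Hu t : H1 (u t). Proof. by have [/(_ t)[]] := sol. Qed.
Let He t : H1 (eta t). Proof. by have [/(_ t)[]] := sol. Qed.
Let iD t : mu.-integrable setT (EFin \o D t).
Proof. exact: integrable_H1density. Qed.
Let D0 t x : 0 <= D t x. Proof. exact: H1density_ge0. Qed.
Let N0 t : 0 <= N t. Proof. by apply: Rintegral_ge0 => x _; exact: D0. Qed.
Let C0 : 0 <= C. Proof. exact: le_trans C1. Qed.

Let iwD y z s t : mu.-integrable setT (EFin \o (fun x => weight k sigma y z s x * D t x)).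
Proof. exact: integrable_weight_H1density. Qed.

Lemma exhaust_le (I : set R) (t M : R) : measurable I ->
  (forall n, \int[mu]_(x in I `&` `[- n%:R, n%:R]%classic) D t x <= M) ->
  \int[mu]_(x in I) D t x <= M.
Proof.
move=> mI HM.
have iI : mu.-integrable I (EFin \o D t) by apply: integrableS (iD t).
have mA n : measurable (I `&` `[- n%:R, n%:R]%classic : set R).
  by apply: measurableI => //; exact: measurable_itv.
have cv := @cvg_Rintegral_exhaust R I (fun n => I `&` `[- n%:R, n%:R]%classic) (D t) mI mA.
apply: (cvgr_to_le (cv _ _ iI)); last exact: nearW.
  by move=> n x [].
move=> x Ix; near=> n; split => //=; rewrite in_itv/= -ler_norml.
by near: n; exact: nbhs_infty_ger.
Unshelve. all: by end_near. Qed.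

Lemma Rintegral_indic_le (I : set R) (t : R) (w : R -> R) : measurable I ->
  mu.-integrable setT (EFin \o (fun x => w x * D t x)) -> (forall x, 0 <= w x) ->
  (forall x, I x -> 3^-1 <= w x) ->
  \int[mu]_(x in I) D t x <= 3 * \int[mu]_x (w x * D t x).
Proof.
move=> mI iw w0 wI.
have iI : mu.-integrable I (EFin \o D t) by apply: integrableS (iD t).
rewrite Rintegral_mkcond -RintegralZT//; apply: le_Rintegral => //.
- exact: integrable_restrict (iD t).
- exact: integrableZT.
move=> x _; rewrite /patch; case: ifPn => [/set_mem/wI h|_]; last first.
  by apply: mulr_ge0 => //; apply: mulr_ge0.
by rewrite mulrA ler_peMl// mulrC -ler_pdivrMr// div1r.
Qed.

Lemma H1sqnorm_control T : 0 <= T -> (forall t, 0 <= t <= T -> N t <= e) -> N T <= 3 * C * N 0.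
Proof.
move=> T0 HN.
apply: exhaust_le => // n; rewrite setTI.
(* Fronts starting at distance [n + sigma T] from the origin have reached distance [n] at time [T];
   letting [n] grow recovers the whole line. *)
pose X := n%:R + sigma * T.
apply: (@le_trans _ _ (3 * \int[mu]_x (weight k sigma (- X) X T x * D T x))).
  apply: (Rintegral_indic_le _ (iwD (- X) X T T)); first exact: measurable_itv.
    by move=> x; rewrite ltW// weight_gt0.
  move=> x /=; rewrite in_itv/= => /andP[x1 x2].
  by apply: weight_ge => //; rewrite /X opprD subrK addrK x1 x2.
rewrite -mulrA ler_pM2l//; apply: le_trans (ctrl _ _ T0 HN) _.
apply: ler_wpM2l => //; apply: le_Rintegral => // x _.
by rewrite ler_piMl// weight_le1.
Qed.

(** A continuation argument: as long as the norm stays below [e], [H1sqnorm_control] improves the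
    bound to [e / 8], the constant 24 being [3 * 8]. The improvement survives the loss of
    [H1sqnorm_le] and lets the interval be extended. *)
Lemma H1sqnorm_small : N 0 <= e / (24 * C) -> forall T, 0 <= T -> N T <= e.
Proof.
move=> N0e.
have e8 : 3 * C * N 0 <= e / 8.
  have -> : e / 8 = 3 * C * (e / (24 * C)) by field; rewrite gt_eqF// (lt_le_trans ltr01).
  by rewrite ler_wpM2l// mulr_ge0.
have C3 : 1 <= 3 * C by rewrite (le_trans C1)// ler_peMl// ler1n.
have e8e : e / 8 <= e.
  by rewrite ler_pdivrMr//; apply: ler_peMr; [exact: ltW|rewrite ler1n].
have e2e : e / 2 <= e.
  by rewrite ler_pdivrMr//; apply: ler_peMr; [exact: ltW|rewrite ler1n].
pose A := [set T : R | 0 <= T /\ forall t, 0 <= t <= T -> N t <= e].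
have A0 : A 0.
  split=> // t /andP[t0 t1]; have -> : t = 0 by apply/eqP; rewrite eq_le t0 t1.
  apply: le_trans e8e.
  apply: le_trans e8; by rewrite ler_peMl.
(* An unbounded set of good times contains times beyond any [T], and goodness at a time covers the
   whole past. *)
have [bA|nbA] := pselect (has_ubound A); last first.
  move=> T T0; apply: contrapT => NT; apply: nbA; exists T => t [t0 At].
  rewrite leNgt; apply/negP => Tt; apply: NT; apply: At.
  by rewrite T0 ltW.
have hA : has_sup A by split => //; exists 0.
have S0 : 0 <= sup A by exact: ub_le_sup.
have lt_sup t : 0 <= t -> t < sup A -> N t <= e / 8.
  move=> t0 tS; have [s [s0' As] ts] := sup_adherent (eqbRL (subr_gt0 _ _) tS) hA.
  rewrite opprB addrC subrK in ts; apply: le_trans e8; apply: H1sqnorm_control => // t' /andP[t'0 t't].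
  by apply: As; rewrite t'0 (le_trans t't)// ltW.
have e80 : 0 < e / 8 by rewrite divr_gt0.
have [d d0 hd] := H1sqnorm_cvg (sup A) sol e80.
(* Control at the supremum presupposes the bound [e] there as well. It is obtained from slightly
   earlier times by continuity, except when the supremum is 0 and the initial bound applies. *)
have at_sup : N (sup A) <= e / 2.
  have [->|Sn] := eqVneq (sup A) 0.
    apply: (@le_trans _ _ (e / 8)); last by apply: ler_wpM2l; [exact: ltW|rewrite lef_pV2 ?posrE// ler_nat].
    by apply: le_trans e8; rewrite ler_peMl.
  have Sp : 0 < sup A by rewrite lt_def Sn.
  pose t := Num.max 0 (sup A - d / 2).
  have t0 : 0 <= t by rewrite le_max lexx.
  have tS : t < sup A by rewrite gt_max Sp/= ltrBlDr ltrDl divr_gt0.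
  have td : `|t - sup A| < d.
    rewrite distrC gtr0_norm ?subr_gt0// ltrBlDr -ltrBlDl.
    apply: lt_le_trans (_ : sup A - d / 2 <= t); last by rewrite le_max lexx orbT.
    by rewrite ltrD2l ltrN2 ltr_pdivrMr// ltr_pMr// ltr1n.
  apply: le_trans (H1sqnorm_le (Hu _) (He _) (Hu t) (He t)) _.
  have h1 := lt_sup t t0 tS; have h2 := hd t td.
  have h3 := H1sqnorm_subC_le (Hu (sup A)) (He (sup A)) (Hu t) (He t).
  have -> : e / 2 = 2 * (e / 8) + 2 * (e / 8) by field.
  exact: lerD (ler_wpM2l (ler0n _ 2) h1) (ler_wpM2l (ler0n _ 2) (ltW (le_lt_trans h3 h2))).
(* At the supremum the bound improves from [e / 2] to [e / 8]; continuity then carries a bound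
   [e / 2] past it, a contradiction. *)
have AS : A (sup A + d / 2).
  split; first by rewrite addr_ge0// divr_ge0 ?ltW.
  move=> t /andP[t0 tS]; have [tltS|Slet] := ltP t (sup A).
    exact: le_trans (lt_sup t t0 tltS) e8e.
  have td : `|t - sup A| < d.
    rewrite ger0_norm ?subr_ge0// (le_lt_trans (_ : _ <= d / 2))//.
      by rewrite lerBlDl.
    by rewrite ltr_pdivrMr// ltr_pMr// ltr1n.
  have S8 : N (sup A) <= e / 8.
    apply: le_trans e8; apply: H1sqnorm_control => // t' /andP[t'0]; rewrite le_eqVlt => /orP[/eqP ->|t'S].
      exact: le_trans at_sup e2e.
    exact: le_trans (lt_sup _ t'0 t'S) e8e.
  apply: le_trans (H1sqnorm_le (Hu t) (He t) (Hu (sup A)) (He (sup A))) _.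
  apply: le_trans e2e; have -> : e / 2 = 2 * (e / 8) + 2 * (e / 8) by field.
  exact: lerD (ler_wpM2l (ler0n _ 2) S8) (ler_wpM2l (ler0n _ 2) (ltW (hd t td))).
have := ub_le_sup bA AS; rewrite gerDl => /le_lt_trans/(_ (divr_gt0 d0 (ltr0Sn _ 1))).
by rewrite ltxx.
Qed.

End SmallSolutions.

(** * Decay in the exterior region *)

Section Decay.
Context {R : realType}.
Notation mu := (@lebesgue_measure R).
Implicit Types (t x : R) (n : nat).

Lemma shift_le (M q v x : R) : M + q <= v -> x <= M -> x - v <= - q.
Proof. lra. Qed.

Lemma tail_small (f : R -> R) (e : R) : mu.-integrable setT (EFin \o f) -> (forall x, 0 <= f x) ->
  0 < e -> exists2 M : R, 0 <= M & forall w : R -> R,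
  mu.-integrable setT (EFin \o (fun x => w x * f x)) -> (forall x, 0 <= w x <= 1) ->
  (forall x, `|x| <= M -> w x <= e) ->
  \int[mu]_x (w x * f x) <= e * (1 + \int[mu]_x f x).
Proof.
move=> fi f0 e0.
pose A n : set R := `[- n%:R, n%:R]%classic.
have mA n : measurable (A n) by exact: measurable_itv.
have cv : \int[mu]_(x in A n) f x @[n --> \oo] --> \int[mu]_x f x.
  apply: (@cvg_Rintegral_exhaust R setT A f) => // x _; near=> n.
  by rewrite /A/= in_itv/= -ler_norml; near: n; exact: nbhs_infty_ger.
have [n hn] : exists n, \int[mu]_x f x - e <= \int[mu]_(x in A n) f x.
  have lt : \int[mu]_x f x - e < \int[mu]_x f x by rewrite ltrBlDr ltrDl.
  have [m _ hm] := cvgr_ge _ cv _ lt.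
  by exists m; apply: hm => /=.
exists n%:R => // w wi w01 we.
have fAi := integrable_restrict (mA n) fi.
(* Adding the restriction of [f] to both regions gives a single comparison: inside, [w <= e];
   outside, [w <= 1]. The integral of [f] over [A n] is then subtracted. *)
have : \int[mu]_x (w x * f x + (f \_ (A n)) x) <= \int[mu]_x (e * f x + f x).
  apply: le_Rintegral => //.
  - exact: integrableDT.
  - by apply: integrableDT => //; exact: integrableZT.
  move=> x _; have /andP[w0 w1] := w01 x; rewrite /patch; case: ifPn => [/set_mem|_].
    by rewrite /A/= in_itv/= -ler_norml => /we h; rewrite lerD2r ler_wpM2r.
  change (w x * f x + 0 <= e * f x + f x); rewrite addr0.
  apply: le_trans (_ : f x <= _); first by rewrite ler_piMl.
  by rewrite lerDr mulr_ge0// ltW.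
rewrite (RintegralDT wi fAi) (RintegralDT (integrableZT e fi) fi) (RintegralZT e fi).
rewrite -Rintegral_mkcond mulrDr mulr1; move: hn.
move: (\int[mu]_x (w x * f x)) (\int[mu]_(x in A n) f x) (\int[mu]_x f x) => X Y Z.
by clear; move=> *; lra.
Unshelve. all: by end_near. Qed.

Variables (u eta : R -> R -> R) (k sigma C e : R).
Hypotheses (sol : H1_continuous u eta) (k0 : 0 < k) (C1 : 1 <= C) (e0 : 0 < e).
Hypothesis ctrl : weighted_control u eta k sigma C e.
Notation N t := (H1sqnorm (u t) (eta t)).
Notation D t := (H1density (u t) (eta t)).
Hypothesis N0e : N 0 <= e / (24 * C).

Let Hu t : H1 (u t). Proof. by have [/(_ t)[]] := sol. Qed.
Let He t : H1 (eta t). Proof. by have [/(_ t)[]] := sol. Qed.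
Let iD t : mu.-integrable setT (EFin \o D t).
Proof. exact: integrable_H1density. Qed.
Let D0 t x : 0 <= D t x. Proof. exact: H1density_ge0. Qed.
Let C0 : 0 < C. Proof. exact: lt_le_trans C1. Qed.

Lemma measurable_Iext (vl vr t : R) : measurable (Iext vl vr t).
Proof. by apply: measurableU; exact: measurable_itv. Qed.

Lemma exterior_mass_small (vl vr d : R) : sigma < vl -> sigma < vr -> 0 < d ->
  exists T1 : R, forall T, T1 <= T -> \int[mu]_(x in Iext vl vr T) D T x <= d.
Proof.
move=> svl svr d0.
have N00 : 0 <= N 0 by apply: Rintegral_ge0 => x _; exact: D0.
have N10 : 0 < 1 + N 0 by rewrite ltr_pwDl.
(* The 6 is the factor 3 from the plateau of the weight, times two for the two half-lines. *)
pose e' := d / (6 * C * (1 + N 0)).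
have e'0 : 0 < e' by rewrite divr_gt0 ?mulr_gt0.
have [M M0 HM] := tail_small (iD 0) (D0 0) e'0.
pose th := Num.min vl vr - sigma.
have th0 : 0 < th by rewrite subr_gt0 lt_min svl svr.
have thl : th <= vl - sigma by rewrite lerD2r ge_min lexx.
have thr : th <= vr - sigma by rewrite lerD2r ge_min lexx orbT.
(* At distance [q] before its front the initial weight is at most [expR (- e'^-1)], which is at most
   [e']. *)
pose q := (k * e')^-1; have q0 : 0 < q by rewrite invr_gt0 mulr_gt0.
exists ((M + q) / th) => T; rewrite ler_pdivrMr// mulrC => hT.
have T0 : 0 <= T.
  by rewrite -(pmulr_rge0 _ th0) (le_trans _ hT)// addr_ge0// ltW.
have small : expR (- (k * q)) <= e'.
  have -> : k * q = e'^-1 by rewrite /q; field; rewrite !gt_eqF.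
  rewrite expRN -[leRHS]invrK lef_pV2 ?posrE ?expR_gt0 ?invr_gt0//.
  by apply: le_trans (expR_ge1Dx _); rewrite lerDr.
have Ne t : 0 <= t <= T -> N t <= e.
  by move=> /andP[t0 _]; exact: (H1sqnorm_small sol k0 C1 e0 ctrl N0e).
apply: (exhaust_le sol) => [|n]; first exact: measurable_Iext.
(* Each weight has one front that ends at the edge of the exterior region and started [sigma T]
   closer to the origin, still beyond [M + q]. Its other front ends at distance [n], where the
   region is truncated. *)
pose yr := (vr - sigma) * T; pose zr := n%:R + sigma * T.
pose yl := - n%:R - sigma * T; pose zl := - ((vl - sigma) * T).
have mul_th v : th <= v - sigma -> M + q <= (v - sigma) * T.
  by move=> h; apply: le_trans hT _; rewrite ler_wpM2r.
have iw y z t : mu.-integrable setT (EFin \o (fun x => weight k sigma y z t x * D t x)).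
  exact: integrable_weight_H1density.
have w01 y z t x : 0 <= weight k sigma y z t x <= 1.
  by rewrite weight_le1 ltW// weight_gt0.
have hR : \int[mu]_x (weight k sigma yr zr 0 x * D 0 x) <= e' * (1 + N 0).
  apply: HM => // x; rewrite ler_norml => /andP[x1 x2].
  apply: le_trans (weight_le_left k sigma yr zr 0 x) _; rewrite mulr0 subr0.
  apply: le_trans small; rewrite ler_expR -[leRHS]mulrN ler_pM2l//.
  exact: shift_le (mul_th vr thr) x2.
have hL : \int[mu]_x (weight k sigma yl zl 0 x * D 0 x) <= e' * (1 + N 0).
  apply: HM => // x; rewrite ler_norml => /andP[x1 x2].
  apply: le_trans (weight_le_right k sigma yl zl 0 x) _; rewrite mulr0 subr0.
  apply: le_trans small; rewrite ler_expR -[leRHS]mulrN ler_pM2l//.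
  by rewrite /zl addrC; apply: shift_le (mul_th vl thl) _; rewrite lerNl.
have cR := ctrl yr zr T0 Ne; have cL := ctrl yl zl T0 Ne.
pose w x := weight k sigma yl zl T x + weight k sigma yr zr T x.
have wE : (fun x => w x * D T x) =
    (fun x => weight k sigma yl zl T x * D T x + weight k sigma yr zr T x * D T x).
  by apply/funext => x; rewrite mulrDl.
have wi : mu.-integrable setT (EFin \o (fun x => w x * D T x)).
  by rewrite wE; exact: integrableDT.
apply: (@le_trans _ _ (3 * \int[mu]_x (w x * D T x))).
  apply: (Rintegral_indic_le sol _ wi).
  - by apply: measurableI; [exact: measurable_Iext|exact: measurable_itv].
  - by move=> x; rewrite addr_ge0// ltW// weight_gt0.
  move=> x [+ /=]; rewrite in_itv/= => + /andP[x1 x2].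
  have wl0 := weight_gt0 k sigma yl zl T x; have wr0 := weight_gt0 k sigma yr zr T x.
  case=> /=; rewrite in_itv/= ?andbT => hx.
    apply: le_trans (_ : weight k sigma yl zl T x <= _); last by rewrite lerDl ltW.
    apply: weight_ge => //; rewrite /yl subrK x1/= /zl.
    by rewrite (_ : - ((vl - sigma) * T) - sigma * T = - (vl * T)) ?ltW//; ring.
  apply: le_trans (_ : weight k sigma yr zr T x <= _); last by rewrite lerDr ltW.
  apply: weight_ge => //; rewrite /zr addrK x2 andbT /yr.
  by rewrite (_ : (vr - sigma) * T + sigma * T = vr * T) ?ltW//; ring.
rewrite wE (RintegralDT (iw yl zl T) (iw yr zr T)).
have -> : d = 3 * (C * (e' * (1 + N 0)) + C * (e' * (1 + N 0))).
  by rewrite /e'; field; rewrite !gt_eqF.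
rewrite ler_pM2l//; apply: lerD.
  exact: le_trans cL (ler_wpM2l (ltW C0) hL).
exact: le_trans cR (ler_wpM2l (ltW C0) hR).
Qed.

Lemma exterior_decay_of_control (vl vr : R) : sigma < vl -> sigma < vr ->
  exterior_decay u eta vl vr.
Proof.
move=> svl svr; rewrite /exterior_decay.
have -> : (fun t => H1norm (Iext vl vr t) (u t) (eta t)) =
    (fun t => (Num.sqrt (\int[mu]_(x in Iext vl vr t) D t x))%:E).
  by apply/funext => t; rewrite H1norm_sqrt//; exact: measurable_Iext.
apply: cvg_EFin; first exact: nearW.
apply/cvgrPdist_le => d d0.
have [T1 HT] := exterior_mass_small svl svr (exprn_gt0 2 d0).
near=> t; rewrite sub0r normrN ger0_norm ?sqrtr_ge0//.
rewrite -[leRHS](ger0_norm (ltW d0)) -sqrtr_sqr ler_sqrt ?exprn_ge0 ?(ltW d0)//.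
by apply: HT; near: t; apply: nbhs_pinfty_ge; rewrite num_real.
Unshelve. all: by end_near. Qed.

End Decay.

Section SmallDataDecay.
Context {R : realType}.

(** Half of [th] makes the fronts faster than 1; the other half keeps them strictly slower than the
    edges of the exterior region. *)
Lemma small_data_decay (a b c th : R) : abcd_parameters a b c -> 0 < th ->
  exists2 eps0 : R, 0 < eps0 & forall (u eta : R -> R -> R),
  global_H1_solution a b c u eta -> (H1norm setT (u 0%R) (eta 0%R) < eps0%:E)%E ->
  forall vl vr : R, 1 + th <= vl -> 1 + th <= vr -> exterior_decay u eta vl vr.
Proof.
move=> abc th0.
have s1 : 1 < 1 + th / 2 by rewrite ltrDl divr_gt0.
have [k [C [e [k0 C1 e0 ctrl]]]] := weighted_control_exists abc s1.
have C0 : 0 < C by exact: lt_le_trans C1.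
have d0 : 0 < e / (24 * C) by rewrite divr_gt0 ?mulr_gt0.
exists (Num.sqrt (e / (24 * C))); first by rewrite sqrtr_gt0.
move=> u eta sol; have [cont _] := sol; have [/(_ 0)[Hu He] _] := cont.
rewrite H1norm_sqrt// lte_fin ltr_sqrt// => /ltW N0e vl vr hl hr.
have sth : 1 + th / 2 < 1 + th by rewrite ltrD2l ltr_pdivrMr// ltr_pMr// ltr1n.
exact: (exterior_decay_of_control cont k0 C1 e0 (ctrl _ _ sol) N0e
  (lt_le_trans sth hl) (lt_le_trans sth hr)).
Qed.

End SmallDataDecay.

(** * Comparison of the speeds *)

Section Speeds.
Context {R : realType}.
Implicit Types (a b c : R).

(** The hypothesis says that [X = 54 a c] is at least the positive root of
    [X^2 + 2 Z b X = 48 (6 b - 1)^2 b^2], with [Z = 21 b - 2]. For [b >= 1/4] this root is at least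
    [6 b^2], which is the claim. *)
Lemma speed_hypothesis_ge1 a b c : abcd_parameters a b c ->
  54 * (a * c) >= b * (Num.sqrt (48 * (6 * b - 1) ^+ 2 + (21 * b - 2) ^+ 2) - (21 * b - 2)) ->
  1 <= 3 * (Num.sqrt (a * c) / b).
Proof.
move=> abc; have [b0 a0 c0 _] := abc; have [b6 _ acb] := abcd_param_facts abc.
have ac0 : 0 < a * c by rewrite nmulr_rgt0.
move: (a * c) ac0 acb => m m0 mb hyp.
suff hm : b ^+ 2 <= 9 * m.
  rewrite mulrA ler_pdivlMr// mul1r -[leLHS](ger0_norm (ltW b0)) -sqrtr_sqr.
  have -> : 3 = Num.sqrt (3 ^+ 2) :> R by rewrite sqrtr_sqr ger0_norm.
  rewrite -sqrtrM ?exprn_ge0// ler_sqrt ?mulr_ge0 ?exprn_ge0 ?(ltW m0)//.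
  by have -> : 3 ^+ 2 = 9 :> R by ring.
pose X := 54 * m; have X0 : 0 < X by rewrite mulr_gt0.
pose Z := 21 * b - 2; have Z0 : 0 < Z by rewrite /Z; lra.
have hX : 48 * (6 * b - 1) ^+ 2 * b ^+ 2 <= X * (X + 2 * Z * b).
  pose s := Num.sqrt (48 * (6 * b - 1) ^+ 2 + Z ^+ 2).
  have s2 : s ^+ 2 = 48 * (6 * b - 1) ^+ 2 + Z ^+ 2.
    by rewrite sqr_sqrtr// addr_ge0 ?sqr_ge0// mulr_ge0 ?sqr_ge0.
  have h1 : b * s <= X + b * Z by move: hyp; rewrite -/Z -/s -/X mulrBr lerBlDr.
  have bs0 : 0 <= b * s by rewrite mulr_ge0 ?sqrtr_ge0// ltW.
  have h2 : (b * s) ^+ 2 <= (X + b * Z) ^+ 2.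
    by rewrite lerXn2r ?nnegrE// (le_trans bs0).
  rewrite exprMn s2 in h2.
  have -> : X * (X + 2 * Z * b) = (X + b * Z) ^+ 2 - b ^+ 2 * Z ^+ 2 by ring.
  rewrite lerBrDr; apply: le_trans h2; rewrite le_eqVlt; apply/orP; left; apply/eqP; ring.
have [b4|b4] := leP 4^-1 b.
  rewrite leNgt; apply/negP => hm.
  have hX6 : X < 6 * b ^+ 2 by rewrite /X; move: hm; lra.
  have : X * (X + 2 * Z * b) < 6 * b ^+ 2 * (6 * b ^+ 2 + 2 * Z * b).
    apply: ltr_pM; rewrite ?(ltW X0)//; last by rewrite ltrD2r.
    by rewrite addr_ge0 ?(ltW X0)// !mulr_ge0// ltW.
  move=> /(le_lt_trans hX); apply/negP; rewrite -leNgt -subr_ge0.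
  have -> : 48 * (6 * b - 1) ^+ 2 * b ^+ 2 - 6 * b ^+ 2 * (6 * b ^+ 2 + 2 * Z * b) =
    b ^+ 2 * (24 * ((4 * b - 1) * (15 * b - 2))) by rewrite /Z; ring.
  by apply: mulr_ge0; rewrite ?sqr_ge0// mulr_ge0// mulr_ge0//; lra.
(* For [b < 1/4] even the largest possible [a c], namely [(b - 1/6)^2], stays below the root, so the
   hypothesis cannot hold. *)
exfalso; pose z := 6 * b - 1; have z0 : 0 < z by rewrite /z; lra.
have Xz : X <= 3 / 2 * z ^+ 2.
  have -> : 3 / 2 * z ^+ 2 = 54 * (b - 6^-1) ^+ 2 by rewrite /z; field.
  by rewrite ler_wpM2l.
have : X * (X + 2 * Z * b) <= 3 / 2 * z ^+ 2 * (3 / 2 * z ^+ 2 + 2 * Z * b).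
  apply: ler_pM; rewrite ?(ltW X0)//; last by rewrite lerD2r.
  by rewrite addr_ge0 ?(ltW X0)// !mulr_ge0// ltW.
move=> /(le_trans hX); apply/negP; rewrite -ltNge -subr_gt0.
have -> : 48 * (6 * b - 1) ^+ 2 * b ^+ 2 - 3 / 2 * z ^+ 2 * (3 / 2 * z ^+ 2 + 2 * Z * b) =
  z ^+ 2 * (9 / 4 * ((32 * b - 3) * (1 - 4 * b) / 3)) by rewrite /z /Z; field.
apply: mulr_gt0; first by rewrite exprn_gt0.
by rewrite mulr_gt0// divr_gt0// mulr_gt0//; lra.
Qed.

Lemma sigma_speed_gt0 b : 6^-1 < b -> 0 < sigma_speed b.
Proof. by move=> b6; rewrite /sigma_speed divr_gt0// !mulr_gt0//; lra. Qed.

(** The threshold is the larger root of [b^2 - b / 2 + 1/24], which is the numerator minus the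
    denominator of [sigma_speed b]. *)
Lemma sigma_speed_ge1 b : 6^-1 < b -> 12^-1 * (3 + Num.sqrt 3) < b -> 1 <= sigma_speed b.
Proof.
move=> b6 hb; rewrite /sigma_speed ler_pdivlMr ?mul1r; last by rewrite mulr_gt0//; lra.
rewrite -subr_ge0.
have -> : 2 * (b - 6^-1) * (b - 8^-1) - b * (b - 12^-1) =
  (b - 12^-1 * (3 + Num.sqrt 3)) * (b - 12^-1 * (3 - Num.sqrt 3)) +
    (Num.sqrt 3 ^+ 2 - 3) / 144 by field.
rewrite sqr_sqrtr// subrr mul0r addr0.
have s0 : 0 <= Num.sqrt 3 :> R by exact: sqrtr_ge0.
by apply: mulr_ge0; lra.
Qed.

End Speeds.

Theorem theorem2p3 (R : realType) (a b c epsilon delta : R) :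
  abcd_parameters a b c -> 0 < epsilon -> 0 < delta ->
  exists2 eps0 : R, 0 < eps0 &
  forall eps : R, 0 < eps < eps0 ->
  forall u eta : R -> R -> R,
  global_H1_solution a b c u eta ->
  (H1norm setT (u 0%R) (eta 0%R) < eps%:E)%E ->
  [/\ (153 * b ^+ 2 - 54 * b + 4 <= 9 * (a * c) ->
       exterior_decay u eta (1 + epsilon) (1 + delta)),
      (54 * (a * c) >=
         b * (Num.sqrt (48 * (6 * b - 1) ^+ 2 + (21 * b - 2) ^+ 2)
              - (21 * b - 2)) ->
       exterior_decay u eta (3 * (Num.sqrt (a * c) / b) + epsilon)
                            (3 * (Num.sqrt (a * c) / b) + delta)) &
      (a = 6^-1 - b -> c = 6^-1 - b ->
       [/\ 0 < sigma_speed b,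
        (6^-1 < b <= 12^-1 * (3 + Num.sqrt 3) ->
         exterior_decay u eta (1 + epsilon) (1 + delta)) &
        (12^-1 * (3 + Num.sqrt 3) < b ->
         exterior_decay u eta (sigma_speed b + epsilon)
                              (sigma_speed b + delta))])].
Proof.
move=> abc e0 d0; have [b6 _ _] := abcd_param_facts abc.
have th0 : 0 < Num.min epsilon delta by rewrite lt_min e0 d0.
have [eps0 eps00 decay] := small_data_decay abc th0.
exists eps0 => // eps /andP[_ epslt] u eta sol init.
have small : (H1norm setT (u 0%R) (eta 0%R) < eps0%:E)%E.
  by apply: lt_trans init _; rewrite lte_fin.
have main (v : R) : 1 <= v -> exterior_decay u eta (v + epsilon) (v + delta).
  move=> v1; apply: (decay u eta sol small).
    by rewrite lerD// ge_min lexx.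
  by rewrite lerD// ge_min lexx orbT.
split=> [_|hyp|_ _]; first exact: main.
- exact: main (speed_hypothesis_ge1 abc hyp).
- split=> [|_|hb]; [exact: sigma_speed_gt0|exact: main|].
  by apply: main; exact: sigma_speed_ge1.
Qed.
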